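(* Let $q$ be a power of an odd prime, let $G=1+\mathfrak{g}$ be a pattern subgroup of $UT_{2n}(\mathbb{F}_{q^k})$, let $\dagger$ be an anti-involution of the $\mathbb{F}_q$-algebra $\mathfrak{g}$ with $(\alpha e_{ij})^\dagger\in\mathbb{F}_{q^k}^\times e_{\bar j\bar i}$ for all $\alpha\in\mathbb{F}_{q^k}^\times$ and all $i<j$ with $e_{ij}\in\mathfrak{g}$ (where $\bar i=2n+1-i$), and let $U=\{u\in G\mid u^\dagger=u^{-1}\}$, with the decomposition $U=N\rtimes H$ and the lattice $\mathcal{L}$ of subgroups of $H$ described in the context. For $\lambda\in\mathfrak{n}^*$ and $\psi_\lambda=\theta\circ\lambda\circ f\in\mathrm{Irr}(N)$, put $$H_{\psi_\lambda}=\{h\in H\mid h\bar\lambda=\bar\lambda\}.$$ Then the supercharacter theory of $U$ obtained from $\mathcal{L}$ and these choices of $H_\psi$ by the little groups construction is the same as the supercharacter theory of $U$ with superclasses $$K_u=\{v\in U\mid f(v)\in G\cdot f(u)\}\quad(u\in U)$$ and supercharacters $$\chi_\lambda=\frac{|P\cdot\lambda|}{|G\cdot\lambda|}\sum_{\mu\in G\cdot\lambda}\theta\circ\mu\circ f\quad(\lambda\in\mathfrak{u}^* ).$$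
   Context: **Supercharacter theories.** A supercharacter theory of a finite group is a pair $(\mathcal{K},\mathcal{X})$, where $\mathcal{K}$ is a partition of the group into unions of conjugacy classes and $\mathcal{X}$ is a set of characters, such that $|\mathcal{X}|=|\mathcal{K}|$, each $\chi\in\mathcal{X}$ is constant on the blocks of $\mathcal{K}$ (superclasses), and each irreducible character is a constituent of exactly one element of $\mathcal{X}$ (supercharacters). Two supercharacter theories are the same if they have the same superclasses; equivalently, the same supercharacters up to positive scalar multiples. **Pattern groups.** For a partial order $\mathcal{P}$ on $\{1,\dots,N_0\}$ contained in the usual linear order, the pattern group in $UT_{N_0}(F)$ ($F$ a finite field; unipotent upper-triangular matrices) is $\{g\in UT_{N_0}(F)\mid g_{ij}\neq0\Rightarrow i\preceq_{\mathcal{P}}j\}=1+\mathfrak{g}$, with $\mathfrak{g}$ the corresponding algebra of strictly upper-triangular matrices. Here $N_0=2n$, $F=\mathbb{F}_{q^k}$, and $\mathfrak{g}$ is regarded as an $\mathbb{F}_q$-algebra; all dual spaces are $\mathbb{F}_q$-duals. $\theta:\mathbb{F}_q^+\to\mathbb{C}^\times$ is a fixed nontrivial homomorphism. **The group $U$.** For $g=1+x\in G$, $g^\dagger=1+x^\dagger$. $\mathfrak{u}=\{x\in\mathfrak{g}\mid x^\dagger=-x\}$. $G$ acts on $\mathfrak{u}$ by $g\cdot x=gxg^\dagger$ and on $\mathfrak{u}^*$ by $(g\cdot\lambda)(x)=\lambda(g^{-1}x(g^{-1})^{\dagger})$. $f$ is any Springer morphism: a map $f:G\to\mathfrak{g}$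 of the form $f(1+x)=x+\sum_{i\ge2}a_ix^i$ with $a_i\in\mathbb{F}_q$ and $f(U)=\mathfrak{u}$. $P=1+\mathfrak{p}$, where $\mathfrak{p}=\{x\in\mathfrak{g}\mid x_{ij}=0\text{ if }j\le n\}$. It is known that $(\{K_u\},\{\chi_\lambda\})$ in the claim is a supercharacter theory of $U$, independent of $\theta$ and $f$. **Decomposition.** For $h\in UT_n(\mathbb{F}_{q^k})$ with $\begin{pmatrix}h&0\\0&I\end{pmatrix}\in G$, define $\widetilde h$ by $\begin{pmatrix}I&0\\0&\widetilde h\end{pmatrix}=\begin{pmatrix}h&0\\0&I\end{pmatrix}^\dagger$. Let $$H=\left\{\begin{pmatrix}h&0\\0&\widetilde h^{-1}\end{pmatrix}\;\middle|\;\begin{pmatrix}h&0\\0&I\end{pmatrix}\in G\right\},\qquad N=\left\{\begin{pmatrix}I&x\\0&I\end{pmatrix}\;\middle|\;\begin{pmatrix}0&x\\0&0\end{pmatrix}\in\mathfrak{u}\right\}.$$ $N$ is an abelian normal subgroup and $U=N\rtimes H$. The map $\varphi:\begin{pmatrix}h&0\\0&\widetilde h^{-1}\end{pmatrix}\mapsto h$ is an isomorphism of $H$ onto a pattern subgroup of $UT_n(\mathbb{F}_{q^k})$. Let $\mathfrak{n}=f(N)$; the irreducible characters of $N$ are exactly $\psi_\lambda=\theta\circ\lambda\circ f$, $\lambda\in\mathfrak{n}^*$. Let $\bar{\mathfrak{n}}=\{x\in\mathfrak{g}\mid x_{ij}=0\text{ if }i>n\text{ or }j\le n\}$, and for $\lambda\in\mathfrak{n}^*$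 define $\bar\lambda\in\bar{\mathfrak{n}}^*$ by $\bar\lambda(x)=\frac12\lambda(x-x^\dagger)$. For $h\in H$, $(h\bar\lambda)(x)=\bar\lambda(h^{-1}x)$ (matrix multiplication, $x\in\bar{\mathfrak{n}}$). **The lattice $\mathcal{L}$.** Write $A=\varphi(H)=1+\mathfrak{a}$, an algebra group over $\mathbb{F}_q$. A subgroup $B=1+\mathfrak{b}$ of $A$ is a right ideal subgroup if $\mathfrak{b}$ is a right ideal of $\mathfrak{a}$. Its right ideal supercharacter theory has superclasses $\{h\in B\mid h-1\in B(g-1)A\}$, $g\in B$, and supercharacters $\frac{|\lambda A|}{|B\lambda A|}\sum_{\mu\in B\lambda A}\theta\circ\mu\circ f_0$, $\lambda\in\mathfrak{b}^*$, where $f_0(g)=g-1$ and $(g\lambda h)(x)=\lambda(g^{-1}xh^{-1})$. $\mathcal{L}$ is the lattice of subgroups of $H$ mapped by $\varphi$ to right ideal subgroups of $A$; each $C\in\mathcal{L}$ has the supercharacter theory with supercharacters $\chi\circ\varphi$, $\chi$ a right ideal supercharacter of $\varphi(C)$. **Little groups construction.** For $\psi\in\mathrm{Irr}(N)$, $I_H(\psi)$ is the stabilizer of $\psi$ in $H$ under conjugation. For a subgroup $K\subseteq I_H(\psi)$ and a character $\chi$ of $K$, let $\psi\rtimes\chi=\mathrm{Ind}_{NK}^U(\vartheta)$, where $\vartheta(nk)=\psi(n)\chi(k)$ ($n\in N$, $k\in K$). The subgroups $H_\psi$ of the claim lie in $\mathcal{L}$ and are normal in $I_H(\psi)$. Let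 $S_\psi=\{\mathrm{Ind}_{H_\psi}^{I_H(\psi)}(\chi)\mid\chi\text{ a supercharacter of }H_\psi\}$ and let $S$ be a set of representatives of the $U$-orbits on $\mathrm{Irr}(N)$. The supercharacter theory obtained by the little groups construction is the one whose set of supercharacters is $\{\psi\rtimes\chi\mid\psi\in S,\ \chi\in S_\psi\}$. *)

(* Defs.v *)
From HB Require Import structures.
From mathcomp Require Import all_boot all_order all_algebra all_fingroup.
From mathcomp Require Import all_solvable all_field all_character.

Set Implicit Arguments.
Unset Strict Implicit.
Unset Printing Implicit Defensive.

Import Order.TTheory GRing.Theory Num.Theory GroupScope.
Local Open Scope ring_scope.

(** * Supercharacter theories and the method of little groups *)

Section Supercharacters.

Variable gT : finGroupType.
Implicit Types (G U N H K C : {group gT}).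

(* A finite set of characters is represented by a sequence considered up to
   order and repetitions, whence [undup]. In MathComp 0 \is a character. *)
Definition supercharacter_theory U (T : {set {set gT}} * seq 'CF(U)) : Prop :=
  let: (K, X) := T in
  [/\ partition K U /\ (forall B x, B \in K -> x \in B -> x ^: U \subset B),
      {subset X <= character} /\ 0 \notin X,
      size (undup X) = #|K|,
      (forall B chi, B \in K -> chi \in X ->
         {in B &, forall x y, chi x = chi y})
    & forall i : Iirr U,
        size [seq chi <- undup X | i \in irr_constt chi] = 1%N].

Definition same_supercharacter_theory U
    (T1 T2 : {set {set gT}} * seq 'CF(U)) : Prop :=
  T1.1 = T2.1.

(* The class function on G that agrees with F on G. The value 0 is a dummy, used
   only if F is not a class function on G. *)
Definition class_fun G (F : gT -> algC) : 'CF(G) :=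
  insubd (0 : 'CF(G)) [ffun x => if x \in G then F x else 0].

Lemma class_funE G (F : gT -> algC) :
  {in G &, forall x y, F (x ^ y)%g = F x} -> {in G, class_fun G F =1 F}.
Proof.
move=> FJ x Gx; rewrite /class_fun /fun_of_cfun [cfun_val _]insubdK ?ffunE ?Gx //.
rewrite unfold_in genGid; apply: intro_class_fun => [y z Gy Gz | y /negPf-> //].
by rewrite groupJ ?Gy ?FJ.
Qed.

(* psi ><| chi = Ind_(NK)^U (nk |-> psi n * chi k). If N :&: K = 1, then
   n = divgr N K (n * k) and k = remgr N K (n * k) for n \in N and k \in K. *)
Definition sdprod_ind U N K (psi : 'CF(N)) (chi : 'CF(K)) : 'CF(U) :=
  'Ind[U, N <*> K]
    (class_fun (N <*> K) (fun x => psi (divgr N K x) * chi (remgr N K x))).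

Definition orbit_representatives U N (S : {set Iirr N}) : Prop :=
  forall i : Iirr N, #|[set j in S | 'chi_j \in ('chi_i ^: U)%CF]| = 1%N.

(* The characters contributed by psi, for H_psi = C with supercharacters X; here
   'I_H[psi] is the stabilizer of psi in H. *)
Definition little_group_chars U N H (psi : 'CF(N)) C (X : seq 'CF(C)) :
    seq 'CF(U) :=
  [seq sdprod_ind U psi xi | xi <- [seq 'Ind['I_H[psi], C] chi | chi <- X]].

End Supercharacters.

(** * Matrix algebras over F_(q^k), regarded as F_q-algebras *)

(* F = F_q and L = F_(q^k), with the embedding iota. *)

Section MatrixSpaces.

Variables (F L : finFieldType) (iota : {rmorphism F -> L}) (r : nat).
Implicit Types (V W a b : {set 'M[L]_r}) (A B : {set 'M[L]_r}).
Implicit Types l m : {ffun 'M[L]_r -> F}.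

Definition Fsubspace V : Prop :=
  [/\ 0 \in V, {in V &, forall x y, x + y \in V}
    & forall c : F, {in V, forall x, iota c *: x \in V}].

(* The F_q-dual of V: a functional on V is extended by 0 outside V, so that it is
   determined by its values on V. *)
Definition Fdual V : {set {ffun 'M[L]_r -> F}} :=
  [set l : {ffun 'M[L]_r -> F} |
    [&& [forall x in V, forall y in V, l (x + y) == l x + l y],
        [forall c : F, forall x in V, l (iota c *: x) == c * l x]
      & [forall x, (x \notin V) ==> (l x == 0)]]].

Definition restrict V (l : 'M[L]_r -> F) : {ffun 'M[L]_r -> F} :=
  [ffun x => if x \in V then l x else 0].

Definition right_ideal b a : Prop :=
  [/\ Fsubspace b, b \subset a & {in b & a, forall x y, x *m y \in b}].

(* g - 1 for g in B, i.e., b if B = 1 + b *)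
Definition alg_of B : {set 'M[L]_r} := [set g - 1%:M | g in B].

(* (g l h)(x) = l (g^-1 x h^-1), for l in the dual of V *)
Definition biact V (g h : 'M[L]_r) l :=
  restrict V (fun x => l (invmx g *m x *m invmx h)).

(* The term theta (m (g - 1)) is theta \o m \o f_0, with f_0(g) = g - 1. *)
Definition right_ideal_superchar (theta : F -> algC) A B l (g : 'M[L]_r) : algC :=
  let b := alg_of B in
  let lA := [set biact b 1%:M h l | h in A] in
  let BlA := [set biact b g h l | g in B, h in A] in
  #|lA|%:R / #|BlA|%:R * \sum_(m in BlA) theta (m (g - 1%:M)).

Definition pattern_order (P : rel 'I_r) : Prop :=
  [/\ reflexive P, antisymmetric P, transitive P
    & forall i j : 'I_r, P i j -> (i <= j)%N].

Definition pattern_algebra (P : rel 'I_r) : {set 'M[L]_r} :=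
  [set x : 'M[L]_r | [forall i : 'I_r, forall j : 'I_r,
     (x i j != 0) ==> (i < j)%N && P i j]].

Definition anti_involution a (dag : 'M[L]_r -> 'M[L]_r) : Prop :=
  [/\ {in a, forall x, dag x \in a /\ dag (dag x) = x},
      {in a &, forall x y, dag (x + y) = dag x + dag y},
      (forall c : F, {in a, forall x, dag (iota c *: x) = iota c *: dag x})
    & {in a &, forall x y, dag (x *m y) = dag y *m dag x}].

(* With indices starting at 0, the index 2n + 1 - i becomes rev_ord i. *)
Definition reverses_matrix_units a (dag : 'M[L]_r -> 'M[L]_r) : Prop :=
  forall (i j : 'I_r) (c : L),
    (i < j)%N -> delta_mx i j \in a -> c != 0 ->
  exists2 c' : L, c' != 0 &
    dag (c *: delta_mx i j) = c' *: delta_mx (rev_ord j) (rev_ord i).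

(* g^dag = 1 + x^dag for g = 1 + x *)
Definition group_dag (dag : 'M[L]_r -> 'M[L]_r) (g : 'M[L]_r) : 'M[L]_r :=
  1%:M + dag (g - 1%:M).

Definition nontrivial_additive_char (theta : F -> algC) : Prop :=
  [/\ theta 0 = 1, forall c d, theta (c + d) = theta c * theta d
    & exists c, theta c != 1].

Section PatternFacts.

Variables (P : rel 'I_r) (dag : 'M[L]_r -> 'M[L]_r).
Hypothesis hP : pattern_order P.
Hypothesis hdag : anti_involution (pattern_algebra P) dag.
Local Notation g := (pattern_algebra P).

Lemma pattern_algebraP (x : 'M[L]_r) :
  reflect (forall i j, x i j != 0 -> (i < j)%N && P i j) (x \in g).
Proof.
rewrite inE; apply: (iffP 'forall_forallP) => xP i j.
  by move/(implyP (xP i j)).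
by apply/implyP/xP.
Qed.

Lemma pattern0 : 0 \in g.
Proof. by apply/pattern_algebraP=> i j; rewrite mxE eqxx. Qed.

Lemma patternD : {in g &, forall x y, x + y \in g}.
Proof.
move=> x y /pattern_algebraP xg /pattern_algebraP yg.
apply/pattern_algebraP=> i j; rewrite mxE.
have [x0 | /xg //] := eqVneq (x i j) 0; rewrite x0 add0r; exact: yg.
Qed.

Lemma patternM : {in g &, forall x y, x *m y \in g}.
Proof.
case: hP => _ _ tP _ x y /pattern_algebraP xg /pattern_algebraP yg.
apply/pattern_algebraP=> i k; rewrite mxE => nz.
case: (pickP (fun j => (x i j != 0) && (y j k != 0))) => [j /andP[] | z].
  move=> /xg/andP[ij Pij] /yg/andP[jk Pjk].
  by rewrite (ltn_trans ij jk) (tP _ _ _ Pij Pjk).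
case/eqP: nz; apply: big1 => j _; apply/eqP; rewrite mulf_eq0.
by have /negbT := z j; rewrite negb_and !negbK.
Qed.

Lemma group_dag1 : group_dag dag 1%:M = 1%:M.
Proof.
rewrite /group_dag subrr; case: hdag => _ dagD _ _.
have := dagD 0 0 pattern0 pattern0; rewrite addr0 => /eqP.
by rewrite -subr_eq subrr eq_sym => /eqP->; rewrite addr0.
Qed.

Lemma pattern_mul (u v : 'M[L]_r) :
  u *m v - 1%:M = (u - 1%:M) *m (v - 1%:M) + ((u - 1%:M) + (v - 1%:M)).
Proof.
rewrite -{1}[u](subrK 1%:M) -{1}[v](subrK 1%:M).
rewrite mulmxDl !mulmxDr mulmx1 !mul1mx -!addrA; congr (_ + _).
by rewrite !addrA addrK.
Qed.

Lemma pattern1M (u v : 'M[L]_r) :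
  u - 1%:M \in g -> v - 1%:M \in g -> u *m v - 1%:M \in g.
Proof.
move=> gu gv; rewrite pattern_mul.
by apply: patternD; [apply: patternM | apply: patternD].
Qed.

Lemma group_dagM (u v : 'M[L]_r) : u - 1%:M \in g -> v - 1%:M \in g ->
  group_dag dag (u *m v) = group_dag dag v *m group_dag dag u.
Proof.
case: hdag => _ dagD _ dagM gu gv; rewrite /group_dag pattern_mul.
rewrite (dagD _ _ (patternM gu gv) (patternD gu gv)) dagM // (dagD _ _ gu gv).
rewrite mulmxDl !mulmxDr !mulmx1 !mul1mx -!addrA; congr (_ + _).
by rewrite [LHS]addrC -addrA.
Qed.

Lemma group_dag_in (u : 'M[L]_r) :
  u - 1%:M \in g -> group_dag dag u - 1%:M \in g.
Proof.
by case: hdag => dag_in _ _ _ /dag_in[gu _]; rewrite /group_dag addrC addKr.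
Qed.

End PatternFacts.

End MatrixSpaces.

(** * The group U and its supercharacter theories *)

(* The size of the matrices is 2n for n = n'.+1, written as n + n so that they
   split into blocks; {'GL_(n + n)[L]} is the finite group type in which all the
   groups live. *)

Section UnipotentGroups.

Variables (F L : finFieldType) (iota : {rmorphism F -> L}) (n' : nat).
Local Notation n := n'.+1.
Local Notation matrix2n := 'M[L]_(n + n).
Local Notation gT := {'GL_(n + n)[L]}.
Local Notation dual_elt := {ffun matrix2n -> F}.

Definition mx_of (u : gT) : matrix2n := GLval u.

Lemma mx_ofM (u v : gT) : mx_of (u * v)%g = mx_of u *m mx_of v.
Proof. by []. Qed.

Lemma mx_of1 : mx_of 1%g = 1%:M.
Proof. by []. Qed.

Lemma mx_ofV (u : gT) : mx_of u^-1%g = invmx (mx_of u).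
Proof. by []. Qed.

Lemma mx_of_unit (u : gT) : mx_of u \in unitmx.
Proof. exact: (GL_unitmx u). Qed.

Lemma mx_of_inj : injective mx_of.
Proof. exact: val_inj. Qed.

Section Groups.

Variables (P : rel 'I_(n + n)) (dag : matrix2n -> matrix2n).
Local Notation g := (pattern_algebra L P).

Definition pattern_set : {set gT} := [set u : gT | mx_of u - 1%:M \in g].

Definition anti_fixed : {set matrix2n} := [set x in g | dag x == - x].
Local Notation u_ := anti_fixed.

Definition U_set : {set gT} :=
  [set v in pattern_set | group_dag dag (mx_of v) == mx_of v^-1%g].

Definition N_set : {set gT} :=
  [set v : gT | [exists x : 'M[L]_n, (block_mx 0 x 0 0 \in u_)
                 && (mx_of v == block_mx 1%:M x 0 1%:M)]].

(* diag(I, tilde h) = diag(h, I)^dag *)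
Definition tilde (h : 'M[L]_n) : 'M[L]_n :=
  drsubmx (group_dag dag (block_mx h 0 0 1%:M)).

Definition H_set : {set gT} :=
  [set v : gT | [exists h : 'M[L]_n, (block_mx h 0 0 1%:M - 1%:M \in g)
                 && (mx_of v == block_mx h 0 0 (invmx (tilde h)))]].

Definition phi (v : gT) : 'M[L]_n := ulsubmx (mx_of v).

(* Indices start at 0: i > n becomes (n <= i)%N and j <= n becomes (j < n)%N. *)
Definition nbar : {set matrix2n} :=
  [set x in g | [forall i : 'I_(n + n), forall j : 'I_(n + n),
     (n <= i)%N || (j < n)%N ==> (x i j == 0)]].

Definition p_alg : {set matrix2n} :=
  [set x in g | [forall i : 'I_(n + n), forall j : 'I_(n + n),
     (j < n)%N ==> (x i j == 0)]].

Definition P_set : {set gT} := [set v : gT | mx_of v - 1%:M \in p_alg].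

Hypothesis hP : pattern_order P.
Hypothesis hdag : anti_involution iota g dag.
Hypothesis hunits : reverses_matrix_units g dag.

Lemma in_pattern (v : gT) : (v \in pattern_set) = (mx_of v - 1%:M \in g).
Proof. by rewrite [LHS]in_set. Qed.

Lemma in_U (v : gT) : (v \in U_set) =
  (mx_of v - 1%:M \in g) && (group_dag dag (mx_of v) == mx_of v^-1%g).
Proof. by rewrite [LHS]in_set in_pattern. Qed.

Lemma in_anti_fixed x : (x \in u_) = (x \in g) && (dag x == - x).
Proof. by rewrite [LHS]in_set. Qed.

Lemma pattern_group_set : group_set pattern_set.
Proof.
apply/group_setP; split=> [|u v]; first by rewrite in_pattern mx_of1 subrr pattern0.
by rewrite !in_pattern mx_ofM; apply: pattern1M.
Qed.
Definition pattern_group := Group pattern_group_set.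

Lemma U_group_set : group_set U_set.
Proof.
apply/group_setP; split=> [|u v].
  by rewrite in_U invg1 mx_of1 subrr pattern0 (group_dag1 hdag) /=.
rewrite !in_U => /andP[gu /eqP du] /andP[gv /eqP dv].
rewrite invMg !mx_ofM (pattern1M hP gu gv) /=.
by rewrite (group_dagM hP hdag) // du dv.
Qed.
Definition U_group := Group U_group_set.

Lemma anti_fixed0 : 0 \in u_.
Proof.
rewrite in_anti_fixed pattern0 oppr0; have := group_dag1 hdag.
by rewrite /group_dag subrr => /(canRL (addKr _)) ->; rewrite addNr eqxx.
Qed.

Lemma anti_fixedD : {in u_ &, forall x y, x + y \in u_}.
Proof.
move=> x y; rewrite !in_anti_fixed => /andP[gx /eqP dx] /andP[gy /eqP dy].
case: hdag => _ dagD _ _.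
by rewrite patternD //= dagD // dx dy opprD.
Qed.

Lemma N_group_set : group_set N_set.
Proof.
apply/group_setP; split=> [|u v].
  rewrite in_set; apply/existsP; exists 0; rewrite block_mx0 anti_fixed0.
  by rewrite mx_of1 -scalar_mx_block /=.
rewrite !in_set => /existsP[x /andP[ux /eqP du]] /existsP[y /andP[uy /eqP dv]].
apply/existsP; exists (y + x); rewrite mx_ofM du dv mulmx_block.
rewrite !mulmx0 !mul0mx !mulmx1 !mul1mx !addr0 add0r eqxx andbT.
by have := anti_fixedD uy ux; rewrite add_block_mx !addr0.
Qed.
Definition N_group := Group N_group_set.

Lemma dag_sum (I : finType) (x : I -> matrix2n) :
  (forall i, x i \in g) -> dag (\sum_i x i) = \sum_i dag (x i).
Proof.
move=> gx; case: hdag => _ dagD _ _.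
suff: \sum_i x i \in g /\ dag (\sum_i x i) = \sum_i dag (x i) by case.
apply: (big_rec2 (fun a b => a \in g /\ dag a = b)) => [|i b a _ [ga <-]].
  by have := anti_fixed0; rewrite in_anti_fixed oppr0 => /andP[-> /eqP->].
by split; [apply: patternD | apply: dagD].
Qed.

Lemma delta_pattern (x : matrix2n) i j : x \in g -> x i j *: delta_mx i j \in g.
Proof.
move/pattern_algebraP=> gx; apply/pattern_algebraP=> k l.
rewrite !mxE mulf_eq0 negb_or => /andP[xij].
by case: (k =P i) => [->|]; case: (l =P j) => [->|]; rewrite ?eqxx // => *; apply: gx.
Qed.

Lemma dag_entry (x : matrix2n) a b : x \in g -> dag x a b != 0 ->
  exists i j, [/\ x i j != 0, a = rev_ord j & b = rev_ord i].
Proof.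
move=> gx; rewrite {1}(matrix_sum_delta x) pair_bigA /=.
rewrite dag_sum => [|[i j]]; last exact: delta_pattern.
rewrite summxE => nz.
have [[i j] /= nzij | z] := pickP (fun k : 'I_(n + n) * 'I_(n + n) =>
    dag (x k.1 k.2 *: delta_mx k.1 k.2) a b != 0); last first.
  by case/eqP: nz; apply: big1 => k _; apply/eqP/negbFE/z.
have xij : x i j != 0.
  apply: contraNneq nzij => ->; rewrite scale0r.
  have := anti_fixed0; rewrite in_anti_fixed oppr0 => /andP[_ /eqP->].
  by rewrite mxE.
have /pattern_algebraP/(_ i j xij)/andP[ltij Pij] := gx.
have gij : delta_mx i j \in g.
  apply/pattern_algebraP=> k l; rewrite mxE.
  by case: (k =P i) => [->|]; case: (l =P j) => [->|]; rewrite ?eqxx // ltij.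
have [c _ dc] := hunits ltij gij xij.
exists i, j; move: nzij; rewrite dc !mxE mulf_eq0 negb_or => /andP[_].
by case: (a =P _) => [->|]; case: (b =P _) => [->|]; rewrite ?eqxx.
Qed.

Lemma tilde_dag (h : 'M[L]_n) : block_mx h 0 0 1%:M - 1%:M \in g ->
  group_dag dag (block_mx h 0 0 1%:M) = block_mx 1%:M 0 0 (tilde h).
Proof.
move=> gh; rewrite -[LHS]submxK -/(tilde h); set x := _ - _ in gh.
have ulx i j : x i j != 0 -> (i < n)%N && (j < n)%N.
  rewrite /x scalar_mx_block opp_block_mx add_block_mx !oppr0 !addr0 subrr.
  by case: (split_ordP i) => k ->; case: (split_ordP j) => l ->;
    rewrite ?(block_mxEul, block_mxEur, block_mxEdl, block_mxEdr) ?mxE ?eqxx //= !ltn_ord.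
have dr a b : dag x a b != 0 -> (n <= a)%N && (n <= b)%N.
  case/(dag_entry gh) => i [j [/ulx/andP[lti ltj] -> ->]] /=.
  by rewrite !leq_subRL ?ltn_ord // !leq_add2r lti ltj.
have dag0 (a b : 'I_(n + n)) :
    ~~ ((n <= a)%N && (n <= b)%N) -> dag x a b = 0.
  by apply: contraNeq; apply: dr.
congr block_mx; apply/matrixP => i j; rewrite !mxE -/x dag0 ?addr0 //=.
- by rewrite negb_and -!ltnNge ltn_ord.
- by rewrite eq_lrshift.
- by rewrite negb_and -!ltnNge ltn_ord.
- by rewrite eq_rlshift.
by rewrite negb_and -!ltnNge ltn_ord orbT.
Qed.

Lemma in_H (v : gT) : reflect
  (exists2 h : 'M[L]_n, block_mx h 0 0 1%:M - 1%:M \in g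
                      & mx_of v = block_mx h 0 0 (invmx (tilde h)))
  (v \in H_set).
Proof.
rewrite in_set; apply: (iffP existsP) => [[h /andP[gh /eqP hv]]|[h gh hv]].
  by exists h.
by exists h; rewrite gh hv eqxx.
Qed.

Lemma H_blocks_unit (v : gT) h k : mx_of v = block_mx h 0 0 (invmx k) ->
  (h \in unitmx) && (k \in unitmx).
Proof.
move=> vhk.
have : @block_mx L n n n n h 0 0 (invmx k) \in unitmx by rewrite -vhk mx_of_unit.
by rewrite [X in is_true X -> _]unitmxE det_ublock unitrM -!unitmxE unitmx_inv.
Qed.

Lemma H_group_set : group_set H_set.
Proof.
have blockM (h k : 'M[L]_n) : block_mx (h *m k) 0 0 1%:M
    = block_mx h 0 0 1%:M *m block_mx k 0 0 1%:M :> matrix2n.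
  by rewrite mulmx_block !mulmx0 !mul0mx !mulmx1 !addr0 add0r.
apply/group_setP; split=> [|u v].
  apply/in_H; exists 1%:M; first by rewrite -scalar_mx_block subrr pattern0.
  rewrite mx_of1 /tilde -scalar_mx_block (group_dag1 hdag).
  by rewrite {2}scalar_mx_block block_mxKdr invmx1 -scalar_mx_block.
case/in_H=> [h gh uh] /in_H[k gk vk]; apply/in_H.
exists (h *m k); first by rewrite blockM; apply: pattern1M.
have -> : tilde (h *m k) = tilde k *m tilde h.
  rewrite {1}/tilde blockM (group_dagM hP hdag) // !tilde_dag //.
  by rewrite mulmx_block block_mxKdr mul0mx add0r.
have [/andP[_ uth] /andP[_ uvk]] := (H_blocks_unit uh, H_blocks_unit vk).
rewrite mx_ofM uh vk mulmx_block !mulmx0 !mul0mx !addr0 add0r.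
congr block_mx; apply: (can_inj (mulKmx (_ : tilde k *m tilde h \in unitmx))).
  by rewrite unitmx_mul uth uvk.
rewrite mulmxV ?unitmx_mul ?uth ?uvk // -mulmxA (mulmxA (tilde h)).
by rewrite mulmxV // mul1mx mulmxV.
Qed.
Definition H_group := Group H_group_set.

Lemma H_sub_pattern : H_set \subset pattern_set.
Proof.
apply/subsetP=> v /in_H[h gh vh].
have [uh uth] := andP (H_blocks_unit vh).
have uu : block_mx h 0 0 1%:M \is a @GRing.unit 'M[L]_((n + n).-1.+1).
  have: @block_mx L n n n n h 0 0 1%:M \in unitmx.
    by rewrite unitmxE det_ublock det1 mulr1 -unitmxE.
  by [].
have uw : @block_mx L n n n n 1%:M 0 0 (tilde h) \is a @GRing.unit 'M[L]_((n + n).-1.+1).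
  have: @block_mx L n n n n 1%:M 0 0 (tilde h) \in unitmx.
    by rewrite unitmxE det_ublock det1 mul1r -unitmxE.
  by [].
pose a : gT := FinRing.Unit uu; pose b : gT := FinRing.Unit uw.
have ga : a \in pattern_group by rewrite in_pattern.
have gb : b \in pattern_group.
  by rewrite in_pattern /mx_of /= -(tilde_dag gh); exact: (group_dag_in hdag gh).
suff -> : v = (a * b^-1)%g by rewrite -[_ \in _]/(_ \in pattern_group) groupM ?groupV.
apply: (mulIg b); rewrite mulgKV; apply: mx_of_inj; rewrite mx_ofM vh.
rewrite /mx_of /= mulmx_block !mulmx0 !mul0mx mulmx1 !addr0 add0r.
by rewrite mulVmx.
Qed.

Lemma in_nbar x : reflect
  (x \in g /\ forall i j : 'I_(n + n), (n <= i)%N || (j < n)%N -> x i j = 0)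
  (x \in nbar).
Proof.
rewrite [X in reflect _ X]in_set; apply: (iffP andP) => [] [gx x0]; split=> //.
  by move=> i j ij; apply/eqP; move/'forall_forallP/(_ i j)/implyP: x0; apply.
by apply/'forall_forallP=> i j; apply/implyP=> /x0->.
Qed.

Lemma nbarM (v : gT) x : v \in pattern_set -> x \in nbar ->
  mx_of v *m x \in nbar.
Proof.
rewrite in_pattern => gv /in_nbar[gx x0].
have vx : mx_of v *m x = x + (mx_of v - 1%:M) *m x.
  by rewrite mulmxBl mul1mx addrC subrK.
apply/in_nbar; split=> [|i k ik].
  by rewrite vx; apply: patternD => //; apply: patternM.
rewrite mxE big1 // => j _; have [ji|ij] := leqP n j.
  by rewrite (x0 j k) ?ji ?mulr0.
have [kn|nk] := ltnP k n; first by rewrite (x0 j k) ?kn ?orbT ?mulr0.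
have ni : (n <= i)%N by move: ik; rewrite (ltnNge k) nk orbF.
suff -> : mx_of v i j = 0 by rewrite mul0r.
have lt_ji := leq_trans ij ni.
move/pattern_algebraP/(_ i j): gv; rewrite !mxE -val_eqE /= gtn_eqF // subr0.
by have [-> //|_ /(_ isT)] := eqVneq (mx_of v i j) 0; rewrite ltnNge (ltnW lt_ji).
Qed.

Definition nbar_act (h : gT) (l : dual_elt) : dual_elt :=
  restrict nbar (fun x => l (mx_of h^-1%g *m x)).

Definition bar (l : dual_elt) : dual_elt :=
  restrict nbar (fun x => 2%:R^-1 * l (x - dag x)).

Definition Hpsi_set (l : dual_elt) : {set gT} :=
  [set h in H_set | nbar_act h (bar l) == bar l].

Lemma Hpsi_group_set l : group_set (Hpsi_set l).
Proof.
have in_Hpsi h : (h \in Hpsi_set l) = (h \in H_group) && (nbar_act h (bar l) == bar l).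
  by rewrite [LHS]in_set.
apply/group_setP; split=> [|h k].
  rewrite in_Hpsi group1; apply/eqP/ffunP=> x; rewrite ffunE.
  by rewrite invg1 mx_of1 mul1mx; case: ifP => // nx; rewrite ffunE nx.
rewrite !in_Hpsi => /andP[Hh /eqP hl] /andP[Hk /eqP kl]; rewrite groupM //=.
apply/eqP/ffunP=> x; rewrite [LHS]ffunE invMg mx_ofM -mulmxA.
case: ifP => [nx|nx]; last by rewrite ffunE nx.
have nhx : mx_of h^-1%g *m x \in nbar.
  by apply: nbarM => //; apply: (subsetP H_sub_pattern); apply: (groupVr Hh).
have := congr1 (fun m : dual_elt => m (mx_of h^-1%g *m x)) kl.
rewrite /= {1}/nbar_act ffunE nhx => ->.
by have := congr1 (fun m : dual_elt => m x) hl; rewrite /= {1}/nbar_act ffunE nx.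
Qed.
Definition Hpsi_group l := Group (Hpsi_group_set l).

(** ** The theory with superclasses K_u and supercharacters chi_lambda *)

(* The sum may stop at 2n since (g - 1)^2n = 0. *)
Definition springer_morphism (f : gT -> matrix2n) : Prop :=
  (exists c : nat -> F, {in pattern_set, forall v,
     f v = (mx_of v - 1%:M)
           + \sum_(2 <= i < n + n) iota (c i) *: (mx_of v - 1%:M) ^+ i})
  /\ [set f v | v in U_set] = u_.

Definition G_orbit (x : matrix2n) : {set matrix2n} :=
  [set mx_of v *m x *m group_dag dag (mx_of v) | v in pattern_set].

Definition dual_act (v : gT) (l : dual_elt) : dual_elt :=
  restrict u_
    (fun x => l (mx_of v^-1%g *m x *m group_dag dag (mx_of v^-1%g))).

Variables (theta : F -> algC) (f : gT -> matrix2n).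

Definition superclass (v : gT) : {set gT} :=
  [set w in U_set | f w \in G_orbit (f v)].

Definition superchar (l : dual_elt) : 'CF(U_group) :=
  let Gl := [set dual_act v l | v in pattern_set] in
  let Pl := [set dual_act v l | v in P_set] in
  class_fun U_group
    (fun v => #|Pl|%:R / #|Gl|%:R * \sum_(m in Gl) theta (m (f v))).

Definition orbit_theory : {set {set gT}} * seq 'CF(U_group) :=
  ([set superclass v | v in U_set], [seq superchar l | l in Fdual iota u_]).

(** ** The theory obtained from the lattice by the method of little groups *)

Definition in_lattice (C : {group gT}) : Prop :=
  C \subset H_set
  /\ right_ideal iota (alg_of [set phi v | v in C]) (alg_of [set phi v | v in H_set]).

Definition lattice_superchars (C : {group gT}) : seq 'CF(C) :=
  let A := [set phi v | v in H_set] in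
  let B := [set phi v | v in C] in
  [seq class_fun C (fun v => right_ideal_superchar theta A B l (phi v))
     | l in Fdual iota (alg_of B)].

Definition n_alg : {set matrix2n} := [set f v | v in N_set].

Definition psi (l : dual_elt) : 'CF(N_group) :=
  class_fun N_group (fun v => theta (l (f v))).

Definition little_groups_superchars (S : {set Iirr N_group}) : seq 'CF(U_group) :=
  flatten
    [seq little_group_chars U_group H_group (psi l)
           (lattice_superchars (Hpsi_group l))
       | l in [set l in Fdual iota n_alg | psi l \in [seq 'chi_j | j in S]]].

Definition little_groups_theory (S : {set Iirr N_group})
    (T : {set {set gT}} * seq 'CF(U_group)) : Prop :=
  [/\ {in Fdual iota n_alg, forall l,
         in_lattice (Hpsi_group l) /\ Hpsi_group l <| 'I_H_group[psi l]},
      supercharacter_theory T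
    & T.2 =i little_groups_superchars S].

End Groups.

End UnipotentGroups.

(* Main.v *)
Require Import Defs.
From mathcomp Require Import all_boot all_order all_algebra all_fingroup.
From mathcomp Require Import all_solvable all_field all_character.
From mathcomp Require Import ring.

Set Implicit Arguments.
Unset Strict Implicit.
Unset Printing Implicit Defensive.

Import Order.TTheory GRing.Theory Num.Theory GroupScope.
Local Open Scope ring_scope.

(* The two theories have literally the same supercharacters: if l in u^* restricts to
   l_n on n, if C = H_psi = 1 + c for psi = psi_(l_n), and if nu in c^* is the
   functional a |-> l (a - a^dag), then psi ><| Ind chi_nu = chi_l.
   To see this, write G = P H and average theta (l (v f(u) v^dag)) over v in G. For
   p = 1 + w^dag in P, where w has upper blocks a and y, and for x in u with upper
   left block s, one finds that p x p^dag is x with s replaced by s (1 + a), plus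
   z - z^dag where z = s y. The sum over y therefore vanishes unless s belongs to c,
   and what remains is an average of theta (nu (s (1 + a))); it is a product of a value
   of psi and of a term that averages over C to the right ideal supercharacter of
   C. Averaging over H gives the induced character, and the normalizations agree
   because |P l| = |H : C| |nu A|, a count of stabilizers by Fourier analysis.
   Right ideal supercharacters are afforded by monomial representations, so every
   chi_l is a character. The chi_l are pairwise orthogonal as f : U -> u is bijective,
   they span the regular character with nonzero coefficients, and there are as many
   of them as superclasses by Burnside's lemma, because an element of G has as many
   fixed points on u as on u^*. *)

(** * Orbits and induction from semidirect products *)

(** The obstacle is that [f] is an arbitrary Springer morphism, so for [m] in [N] and [k] in [H] the
    value [f (m * k)] mixes both factors. Writing [f v] as [v - 1] times [1 + fcof v], an element of
    [G], isolates the damage. On the upper left block the extra factor is absorbed by the sum over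
    [H]. On the upper right block the functional does not see it, because $\bar\lambda$ is invariant
    under [C] on both sides: on the left by definition of [C], on the right because $\bar\lambda$
    changes sign under dagger and [C] lies in [U]. [P] matters as the kernel of the upper left block
    on [G]: it is normal, so the size of the [P]-orbit is constant on [G]-orbits. Inducing from [C]
    to the inertia group leaves no trace in the final average over [U], so the identity holds for
    every group between [C] and [H] that fixes $\psi$. That the two sets of supercharacters agree
    also requires that a functional on $\mathfrak{n}$ and one on [c] always come from a single
    functional on $\mathfrak{u}$. Supercharacters determine superclasses, so nothing more has to be
    compared. *)

Section Orbits.

Variables (gT : finGroupType) (T : finType) (G : {group gT}) (S : {set T}).
Variable act : gT -> T -> T.
Hypothesis act1 : {in S, forall x, act 1%g x = x}.
Hypothesis actM : {in G & G & S, forall v w x, act (v * w)%g x = act v (act w x)}.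
Hypothesis actS : {in G & S, forall v x, act v x \in S}.

Definition orb x := [set act v x | v in G].

Lemma orb_refl x : x \in S -> x \in orb x.
Proof. by move=> Sx; apply/imsetP; exists 1%g; rewrite ?group1 ?act1. Qed.

Lemma orb_sub x : x \in S -> orb x \subset S.
Proof. by move=> Sx; apply/subsetP=> _ /imsetP[v Gv ->]; apply: actS. Qed.

Lemma orb_eq x y : x \in S -> y \in orb x -> orb y = orb x.
Proof.
move=> Sx /imsetP[w Gw ->]; apply/setP=> z; apply/imsetP/imsetP=> [[v Gv ->]|[v Gv ->]].
  by exists (v * w)%g; rewrite ?groupM ?actM.
by exists (v * w^-1)%g; rewrite ?groupM ?groupV -?actM ?groupM ?groupV ?mulgKV.
Qed.

Lemma orb_partition : partition [set orb x | x in S] S.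
Proof.
apply/and3P; split.
- apply/eqP/setP=> x; apply/bigcupP/idP=> [[_ /imsetP[y Sy ->]]|Sx].
    exact: (subsetP (orb_sub Sy)).
  by exists (orb x); rewrite ?imset_f ?orb_refl.
- apply/trivIsetP=> _ _ /imsetP[x Sx ->] /imsetP[y Sy ->]; apply: contraR.
  by case/pred0Pn=> z /andP[/= /(orb_eq Sx) <- /(orb_eq Sy) <-].
by apply/negP=> /imsetP[x Sx e0]; have := orb_refl Sx; rewrite -e0 inE.
Qed.

(** The fibres of [v |-> act v x] over the orbit are cosets of the stabilizer, of common size [c].
    The case [E = 1] gives [c] times the orbit length as the order of [G], so [c] is eliminated
    without division. *)
Lemma orb_sum x (E : T -> algC) : x \in S ->
  (\sum_(v in G) E (act v x)) * #|orb x|%:R = #|G|%:R * \sum_(y in orb x) E y.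
Proof.
move=> Sx; pose c := #|[set v in G | act v x == x]|.
have fibre y : y \in orb x -> #|[set v in G | act v x == y]| = c.
  case/imsetP=> w Gw ->; rewrite /c -(card_lcoset [set v in G | act v x == x] w).
  apply: eq_card=> v; rewrite mem_lcoset !inE groupMl ?groupV //.
  have [Gv|//] := boolP (v \in G); rewrite /= actM ?groupV //.
  apply/eqP/eqP=> [->|e]; first by rewrite -actM ?groupV // mulVg act1.
  by rewrite -{2}e -actM ?groupV ?actS // mulgV act1 ?actS.
have sumE (E' : T -> algC) :
    \sum_(v in G) E' (act v x) = c%:R * \sum_(y in orb x) E' y.
  rewrite (partition_big (act^~ x) (mem (orb x))) /=; last first.
    by move=> v Gv; apply: imset_f.
  rewrite mulr_sumr; apply: eq_bigr=> y Oy.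
  rewrite (eq_bigr (fun=> E' y)) => [|v /andP[_ /eqP->] //].
  rewrite sumr_const mulr_natl -(fibre y Oy); congr (_ *+ _).
  by apply: eq_card=> v; rewrite [RHS]inE.
have := sumE (fun=> 1); rewrite !sumr_const => ->.
by rewrite sumE mulrAC.
Qed.

Lemma orb_stab x : x \in S ->
  (\sum_(v in G) (act v x == x)%:R) * #|orb x|%:R = #|G|%:R :> algC.
Proof.
move=> Sx; rewrite (orb_sum (fun y => (y == x)%:R) Sx).
rewrite (bigD1 x) ?orb_refl //= eqxx big1 ?addr0 ?mulr1 // => y /andP[_ /negPf->].
by [].
Qed.

(** Burnside's lemma, cleared of its denominator: a point contributes the order of its stabilizer,
    so the points of one orbit together contribute the order of [G]. *)
Lemma card_orbits : #|[set orb x | x in S]|%:R * #|G|%:R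
  = \sum_(v in G) \sum_(x in S) (act v x == x)%:R :> algC.
Proof.
rewrite exchange_big /= (set_partition_big _ orb_partition) /=.
rewrite -sumr_const mulr_suml; apply: eq_bigr=> _ /imsetP[x Sx ->].
have Ox : #|orb x|%:R != 0 :> algC.
  by rewrite pnatr_eq0 -lt0n; apply/card_gt0P; exists x; apply: orb_refl.
rewrite (eq_bigr (fun=> #|G|%:R / #|orb x|%:R)).
  by rewrite sumr_const -[RHS]mulr_natr divfK // mul1r.
move=> y Oy; have Sy : y \in S by apply: (subsetP (orb_sub Sx)).
by rewrite -(orb_stab Sy) (orb_eq Sx Oy) mulfK.
Qed.

End Orbits.

(** [r g] has in column [t] the single entry [w g t], in row [to g t]. The last hypothesis is the
    cocycle condition that makes [r] multiplicative, and only fixed points reach the diagonal. *)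
Lemma monomial_character (gT : finGroupType) (G : {group gT}) (T : finType)
    (O : {set T}) (to : gT -> T -> T) (w : gT -> T -> algC) :
    {in O, forall t, to 1%g t = t /\ w 1%g t = 1} ->
    {in G & O, forall g t, to g t \in O} ->
    {in G & G & O, forall g h t, to (g * h)%g t = to g (to h t)
       /\ w (g * h)%g t = w h t * w g (to h t)} ->
  exists2 chi : 'CF(G), chi \is a character
    & {in G, forall g, chi g = \sum_(t in O | to g t == t) w g t}.
Proof.
move=> to1 toO toM.
pose r g : 'M[algC]_#|O| := \matrix_(i, j)
  (if to g (enum_val j) == enum_val i then w g (enum_val j) else 0).
have rP : mx_repr G r.
  split=> [|g h Gg Gh].
    apply/matrixP=> i j; rewrite !mxE; have [-> ->] := to1 _ (enum_valP j).
    by rewrite (inj_eq enum_val_inj) eq_sym; case: eqP.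
  apply/matrixP=> i j; rewrite !mxE.
  have Oj := enum_valP j; have [-> ->] := toM g h _ Gg Gh Oj.
  rewrite (bigD1 (enum_rank_in (toO _ _ Gh Oj) (to h (enum_val j)))) //= !mxE.
  rewrite enum_rankK_in ?toO // eqxx big1 => [|k nk].
    by rewrite addr0; case: ifP; rewrite ?mul0r // mulrC.
  rewrite !mxE; case: (to h (enum_val j) =P enum_val k) => [e|]; last by rewrite mulr0.
  by case/eqP: nk; apply: enum_val_inj; rewrite enum_rankK_in ?toO.
exists (cfRepr (MxRepresentation rP)); first exact: cfRepr_char.
move=> g Gg; rewrite cfunE Gg mulr1n /= /mxtrace.
rewrite big_mkcondr [RHS]big_enum_val; apply: eq_bigr=> i _.
by rewrite mxE.
Qed.

(** * Induction from N K to U, rewritten as an average over U *)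

Section SemidirectInduction.

Variables (gT : finGroupType) (U N H K : {group gT}) (psi : 'CF(N)).
Hypothesis defU : N ><| H = U.
Hypothesis sKH : K \subset H.
Hypothesis psiM : {in N &, {morph psi : x y / (x * y)%g >-> x * y}}.
Hypothesis psi1 : psi 1%g = 1.
Hypothesis psiJ : {in K & N, forall k m, psi (m ^ k)%g = psi m}.

(** Elements are split along [N] and [H] instead of [N] and [K], so that one formula on [U] serves
    for every subgroup [K] of [H]. *)
Definition sdprod_fun (a : gT -> algC) x := psi (divgr N H x) * a (remgr N H x).

Let NH_TI : N :&: H = 1%g. Proof. by case/sdprodP: defU. Qed.
Let NK_TI : N :&: K = 1%g.
Proof. by apply/trivgP; rewrite -NH_TI setIS. Qed.
Let nNH : H \subset 'N(N). Proof. by case/sdprodP: defU. Qed.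
Let nNK : K \subset 'N(N). Proof. exact: subset_trans nNH. Qed.
Let mulNH : (N * H)%g = U. Proof. by case/sdprodP: defU. Qed.
Let sNU : N \subset U. Proof. by case/sdprod_context: defU => /andP[]. Qed.
Let sHU : H \subset U. Proof. by case/sdprod_context: defU. Qed.

Let joinNK : N <*> K = (N * K)%g. Proof. by rewrite norm_joinEr. Qed.

Lemma sdprod_split y : y \in U ->
  [/\ divgr N H y \in N, remgr N H y \in H & y = (divgr N H y * remgr N H y)%g].
Proof. by rewrite -mulNH => Uy; rewrite mem_divgr ?mem_remgr -?divgr_eq. Qed.

Lemma psi_conjV k m : k \in K -> m \in N -> psi (m ^ k^-1)%g = psi m.
Proof. by move=> Kk Nm; apply: psiJ; rewrite ?groupV. Qed.

Lemma sdprod_join_class_fun (chi : 'CF(K)) : {in N <*> K &, forall x y,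
  psi (divgr N K (x ^ y)%g) * chi (remgr N K (x ^ y)%g)
  = psi (divgr N K x) * chi (remgr N K x)}.
Proof.
rewrite joinNK => _ _ /mulsgP[m k Nm Kk ->] /mulsgP[m' k' Nm' Kk' ->].
have NJ h a : h \in K -> a \in N -> (a ^ h)%g \in N.
  by move=> Kh Na; rewrite memJ_norm // (subsetP nNK).
have -> : ((m * k) ^ (m' * k'))%g = ((m'^-1 * m * m' ^ k^-1) ^ k' * k ^ k')%g.
  by rewrite -conjMg conjgM; congr (_ ^ _)%g; rewrite /conjg !invgK !mulgA mulgKV.
have Nv := groupVr Nm'; have NJ' := NJ _ _ (groupVr Kk) Nm'.
have Nx := groupM (groupM Nv Nm) NJ'.
rewrite !(divgrMid NK_TI) ?(remgrMid NK_TI) ?NJ ?groupJ // psiJ // cfunJ //.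
rewrite (psiM (groupM Nv Nm) NJ') (psiM Nv Nm) psi_conjV // [_ * psi m]mulrC.
by rewrite -[psi m * _ * _]mulrA -(psiM Nv Nm') mulVg psi1 mulr1.
Qed.

(** On [N K] the two splittings agree; outside it the [H]-part lies outside [K], where [chi]
    vanishes. *)
Lemma sdprod_ind_sum (chi : 'CF(K)) x : x \in U ->
  sdprod_ind U psi chi x
  = (#|N|%:R * #|K|%:R)^-1 * \sum_(w in U) sdprod_fun chi (x ^ w)%g.
Proof.
move=> Ux; rewrite /sdprod_ind cfIndE; last first.
  by rewrite join_subG sNU (subset_trans sKH).
rewrite -natrM -(TI_cardMg NK_TI) -joinNK; congr (_ * _); apply: eq_bigr => w Uw.
have := groupJ Ux Uw; move: (x ^ w)%g => y Uy; rewrite /sdprod_fun.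
have [Nd Hr ey] := sdprod_split Uy.
have [NKy | nNKy] := boolP (y \in N <*> K).
  rewrite class_funE //; last exact: sdprod_join_class_fun.
  have := NKy; rewrite joinNK => /mulsgP[m k Nm Kk ->].
  by rewrite !(divgrMid NK_TI) ?(remgrMid NK_TI) ?(divgrMid NH_TI) ?(remgrMid NH_TI)
    ?(subsetP sKH).
rewrite [LHS]cfun0 // (@cfun0 _ _ chi) ?mulr0 //; apply: contra nNKy => Kr.
by rewrite ey joinNK mem_mulg.
Qed.

(** As [psi] is [K]-stable, conjugation by [k] changes only the argument of [a], and the sum over
    [U] absorbs [k]. This removes averages over the inertia group and over [C] alike. *)
Lemma sdprod_fun_average (a : gT -> algC) x : x \in U ->
  \sum_(w in U) sdprod_fun (fun h => \sum_(k in K) a (h ^ k)%g) (x ^ w)%g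
  = #|K|%:R * \sum_(w in U) sdprod_fun a (x ^ w)%g.
Proof.
move=> Ux.
have step y : y \in U -> sdprod_fun (fun h => \sum_(k in K) a (h ^ k)%g) y
    = \sum_(k in K) sdprod_fun a (y ^ k)%g.
  move=> Uy; rewrite /sdprod_fun mulr_sumr; apply: eq_bigr => k Kk.
  have [Nd Hr ey] := sdprod_split Uy; have Hk := subsetP sKH _ Kk.
  have Ndk : (divgr N H y ^ k)%g \in N by rewrite memJ_norm // (subsetP nNH).
  have -> : divgr N H (y ^ k)%g = (divgr N H y ^ k)%g.
    by rewrite {1}ey conjMg (divgrMid NH_TI Ndk (groupJ Hr Hk)).
  rewrite (psiJ Kk Nd); congr (_ * a _).
  by rewrite {2}ey conjMg (remgrMid NH_TI Ndk (groupJ Hr Hk)).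
under eq_bigr => w Uw do rewrite step ?groupJ //.
rewrite exchange_big /= mulr_natl -sumr_const; apply: eq_bigr => k Kk.
have Uk : k \in U by rewrite (subsetP sHU) ?(subsetP sKH).
rewrite [RHS](reindex_inj (mulIg k)) /=.
by apply: eq_big => [w|w _]; rewrite ?groupMr ?conjgM.
Qed.

(** [psi] extends to a linear character of [N K] that is trivial on [K]; the function to be induced
    is its product with the inflation of [chi]. *)
Lemma sdprod_ind_char (chi : 'CF(K)) :
  chi \is a character -> sdprod_ind U psi chi \is a character.
Proof.
move=> Nchi; apply: cfInd_char.
have defNK : N ><| K = (N <*> K)%G by rewrite sdprodEY.
have [chi1 Nchi1 chi1E] : exists2 xi : 'CF(N <*> K), xi \is a character
    & {in N <*> K, forall x, xi x = psi (divgr N K x)}.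
  (* A monomial representation on one point is a linear character. *)
  have [||g h t|xi Nxi xiE] := @monomial_character _ (N <*> K) unit [set: unit]
    (fun _ t => t) (fun x _ => psi (divgr N K x)).
  - move=> t _; split=> //.
    by have := divgrMid NK_TI (group1 N) (group1 K); rewrite mulg1 => ->.
  - by move=> *; rewrite inE.
  - rewrite /= joinNK => /mulsgP[m k Nm Kk ->] /mulsgP[m' k' Nm' Kk' ->] _; split=> //.
    have Nmk : (m' ^ k^-1)%g \in N by rewrite memJ_norm // (subsetP nNK) ?groupV.
    have -> : (m * k * (m' * k') = m * m' ^ k^-1 * (k * k'))%g.
      by rewrite /conjg invgK !mulgA mulgKV.
    rewrite (divgrMid NK_TI (groupM Nm Nmk) (groupM Kk Kk')) (psiM Nm Nmk).
    by rewrite !(divgrMid NK_TI) // psi_conjV // mulrC.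
  exists xi => // x NKx; rewrite xiE // (bigD1 tt) ?inE //= big1 ?addr0 // => -[].
  by rewrite andbF.
have -> : class_fun (N <*> K) (fun x => psi (divgr N K x) * chi (remgr N K x))
    = chi1 * cfSdprod defNK chi.
  apply/cfun_inP=> x NKx; rewrite class_funE //; last exact: sdprod_join_class_fun.
  rewrite cfunE chi1E //; congr (_ * _).
  have : x \in (N * K)%g by rewrite -joinNK.
  case/mulsgP=> m k Nm Kk ->.
  by rewrite cfSdprodE // (remgrMid NK_TI).
by rewrite rpredM ?cfSdprod_char.
Qed.

End SemidirectInduction.

(** * Duals of F-subspaces *)

Section AdditiveCharacters.

Variables (F L : finFieldType) (iota : {rmorphism F -> L}) (r : nat).
Variable theta : F -> algC.
Hypothesis htheta : nontrivial_additive_char theta.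
Implicit Types V W : {set 'M[L]_r}.

Lemma theta0 : theta 0 = 1. Proof. by case: htheta. Qed.

Lemma thetaD c d : theta (c + d) = theta c * theta d.
Proof. by case: htheta. Qed.

Lemma theta_neq0 c : theta c != 0.
Proof.
apply/negP=> /eqP c0; have := thetaD c (- c).
by rewrite subrr theta0 c0 mul0r => /eqP; rewrite oner_eq0.
Qed.

Lemma thetaN c : theta (- c) = (theta c)^-1.
Proof.
by apply: (mulfI (theta_neq0 c)); rewrite -thetaD subrr theta0 divff ?theta_neq0.
Qed.

(** The values of [theta] are roots of unity of order dividing the characteristic, and for these
    inversion is conjugation. *)
Lemma thetaN_conj c : theta (- c) = (theta c)^*.
Proof.
have [p p_pr pF] := finPcharP F.
have thetaX k : theta c ^+ k = theta (c *+ k).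
  by elim: k => [|k IH]; rewrite ?mulr0n ?theta0 // exprS mulrS thetaD IH.
have u : theta c ^+ p = 1 by rewrite thetaX -mulr_natr (pcharf0 pF) mulr0 theta0.
rewrite thetaN; apply/eqP; rewrite -(inj_eq (mulfI (theta_neq0 c))).
rewrite divff ?theta_neq0 // -normCK eq_sym sqrp_eq1 //.
have := congr1 Num.norm u; rewrite normrX normr1 => /eqP.
by rewrite pexprn_eq1 // eqn0Ngt (prime_gt0 (pcharf_prime pF)).
Qed.

Definition Flinear V (m : 'M[L]_r -> F) : Prop :=
  {in V &, forall x y, m (x + y) = m x + m y} /\
  (forall c : F, {in V, forall x, m (iota c *: x) = c * m x}).

Lemma Fdual_linear V (l : {ffun 'M[L]_r -> F}) : l \in Fdual iota V -> Flinear V l.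
Proof.
rewrite inE => /and3P[/forall_inP lD /'forall_forall_inP lZ _]; split.
  by move=> x y Vx Vy; apply/eqP; move/(_ x Vx)/forall_inP: lD; apply.
by move=> c x Vx; apply/eqP; apply: lZ.
Qed.

Lemma Fdual_out V (l : {ffun 'M[L]_r -> F}) x :
  l \in Fdual iota V -> x \notin V -> l x = 0.
Proof. by rewrite inE => /and3P[_ _ /forallP/(_ x)/implyP l0] /l0/eqP. Qed.

Lemma Fdual_eq V (l m : {ffun 'M[L]_r -> F}) :
  l \in Fdual iota V -> m \in Fdual iota V -> {in V, l =1 m} -> l = m.
Proof.
move=> Vl Vm lm; apply/ffunP=> x; have [/lm//|nVx] := boolP (x \in V).
by rewrite !(Fdual_out _ nVx).
Qed.

Lemma restrictE V (m : 'M[L]_r -> F) x : x \in V -> restrict V m x = m x.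
Proof. by rewrite ffunE => ->. Qed.

Lemma restrict_out V (m : 'M[L]_r -> F) x : x \notin V -> restrict V m x = 0.
Proof. by rewrite ffunE => /negPf->. Qed.

Lemma restrict_Fdual V m : Fsubspace iota V -> Flinear V m ->
  restrict V m \in Fdual iota V.
Proof.
case=> _ VD VZ [mD mZ]; rewrite inE; apply/and3P; split.
- apply/forall_inP=> x Vx; apply/forall_inP=> y Vy.
  by rewrite !restrictE ?VD ?mD.
- by apply/'forall_forall_inP=> c x Vx; rewrite !restrictE ?VZ ?mZ.
by apply/forallP=> x; apply/implyP=> /restrict_out->.
Qed.

(** Translation by a [y] with [m y = c] and [theta c != 1] multiplies the sum by [theta c]. Such a
    [y] exists once [m] is nonzero, since its values then fill [F]. *)
Lemma sum_theta_linear V m : Fsubspace iota V -> Flinear V m ->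
  \sum_(x in V) theta (m x) = #|V|%:R * [forall x in V, m x == 0]%:R.
Proof.
move=> [V0 VD VZ] [mD mZ]; case: forall_inP => [m0|mn0].
  rewrite mulr1 -sumr_const; apply: eq_bigr=> x /m0/eqP->; exact: theta0.
rewrite mulr0; have /exists_inP[x Vx mx] : [exists x in V, m x != 0].
  by apply/exists_inPn=> H; apply: mn0 => x /H; rewrite negbK.
have [_ _ [c nc]] := htheta; pose y := iota (c / m x) *: x.
have Vy : y \in V by apply: VZ.
have VN : - y \in V by rewrite -scaleN1r -(rmorphN1 iota); apply: VZ.
have my : m y = c by rewrite mZ // divfK.
set s := \sum_(x in V) _; have : s = theta c * s.
  rewrite {1}/s (reindex_inj (addrI y)) mulr_sumr; apply: eq_big => [z|z].
    by apply/idP/idP=> [/(VD _ _ VN)|/(VD _ _ Vy)//]; rewrite addKr.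
  by move=> Vyz; rewrite mD ?my ?thetaD //; have := VD _ _ VN Vyz; rewrite addKr.
move/eqP; rewrite -subr_eq0 -{1}[s]mul1r -mulrBl mulf_eq0 subr_eq0 eq_sym (negPf nc).
by move/eqP.
Qed.

Section Subspace.

Variable V : {set 'M[L]_r}.
Hypothesis hV : Fsubspace iota V.

Lemma Fsubspace0 : 0 \in V. Proof. by case: hV. Qed.

Lemma FsubspaceD : {in V &, forall x y, x + y \in V}. Proof. by case: hV. Qed.

Lemma FsubspaceZ c : {in V, forall x, iota c *: x \in V}.
Proof. by case: hV => _ _ VZ x; apply: VZ. Qed.

Lemma FsubspaceN : {in V, forall x, - x \in V}.
Proof.
by move=> x Vx; rewrite -scaleN1r -(rmorphN1 iota); apply: FsubspaceZ.
Qed.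

Lemma FsubspaceB : {in V &, forall x y, x - y \in V}.
Proof. by move=> x y Vx Vy; apply: FsubspaceD => //; apply: FsubspaceN. Qed.

Lemma Flinear0 m : Flinear V m -> m 0 = 0.
Proof.
by case=> _ mZ; rewrite -(scale0r 0) -(rmorph0 iota) mZ ?mul0r // Fsubspace0.
Qed.

Lemma FlinearN m : Flinear V m -> {in V, forall x, m (- x) = - m x}.
Proof.
case=> _ mZ x Vx.
by rewrite -scaleN1r -(rmorphN1 iota) mZ // mulN1r.
Qed.

Lemma FlinearB m : Flinear V m -> {in V &, forall x y, m (x - y) = m x - m y}.
Proof.
by move=> hm x y Vx Vy; have [mD _] := hm; rewrite mD ?FsubspaceN // FlinearN.
Qed.

(* The functional is the coordinate along y with respect to a subspace maximal
   among those that do not contain y. *)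
Lemma Fdual_separates y : y \in V -> y != 0 ->
  exists2 l, l \in Fdual iota V & l y != 0.
Proof.
move=> Vy ny.
pose good (W : {set 'M[L]_r}) := [&& 0 \in W, y \notin W, W \subset V,
  [forall x in W, forall z in W, x + z \in W] &
  [forall c, forall x in W, iota c *: x \in W]].
have good0 : good [set (0 : 'M[L]_r)].
  rewrite /good !inE eqxx ny sub1set Fsubspace0 /=; apply/andP; split.
    by do 2!apply/forall_inP=> ? /set1P->; rewrite addr0 inE.
  by apply/'forall_forall_inP=> c x /set1P->; rewrite scaler0 inE.
have [W /maxsetP[/and5P[W0 nWy sWV /forall_inP WD /'forall_forall_inP WZ] Wmax] _] :=
  maxset_exists good0.
have {}WD x z : x \in W -> z \in W -> x + z \in W.
  by move/WD/forall_inP; apply.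
have WN x : x \in W -> - x \in W.
  by move=> Wx; rewrite -scaleN1r -(rmorphN1 iota); apply: WZ.
have coordP x : x \in V -> exists c, x - iota c *: y \in W.
  move=> Vx; have [Wx|nWx] := boolP (x \in W).
    by exists 0; rewrite rmorph0 scale0r subr0.
  (* If [x] is outside [W], then [W'], the sum of [W] and the line of [x], is strictly larger and
     contains [y] by maximality. The coefficient of [x] in [y] is nonzero, and solving for [x] gives
     its coordinate. *)
  pose W' : {set 'M[L]_r} := [set z.1 + iota z.2 *: x | z : 'M[L]_r * F & z.1 \in W].
  have inW' z c : z \in W -> z + iota c *: x \in W'.
    by move=> Wz; apply/imsetP; exists (z, c); rewrite ?inE.
  have sWW' : W \subset W'.
    apply/subsetP=> z Wz; have := inW' z 0 Wz.
    by rewrite rmorph0 scale0r addr0.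
  have W'x : x \in W' by have := inW' 0 1 W0; rewrite rmorph1 scale1r add0r.
  have [W'y|nW'y] := boolP (y \in W').
    have /imsetP[[z c] /[!inE]/= Wz ey] := W'y.
    have nc : c != 0.
      by apply: contraNneq nWy => c0; rewrite ey c0 rmorph0 scale0r addr0.
    exists c^-1; rewrite ey scalerDr scalerA -rmorphM mulVf // rmorph1 scale1r.
    by rewrite opprD addrCA subrr addr0 WN ?WZ.
  suff goodW' : good W' by case/negP: nWx; rewrite -(Wmax W' goodW' sWW').
  apply/and5P; split=> //; first exact: (subsetP sWW').
  - apply/subsetP=> _ /imsetP[[z c] /[!inE]/= Wz ->].
    by rewrite FsubspaceD ?FsubspaceZ //; apply: (subsetP sWV).
  - apply/forall_inP=> _ /imsetP[[z c] /[!inE]/= Wz ->].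
    apply/forall_inP=> _ /imsetP[[z' c'] /[!inE]/= Wz' ->].
    by rewrite addrACA -scalerDl -rmorphD inW' ?WD.
  apply/'forall_forall_inP=> d _ /imsetP[[z c] /[!inE]/= Wz ->].
  by rewrite scalerDr scalerA -rmorphM inW' ?WZ.
pose coord x := if [pick c | x - iota c *: y \in W] is Some c then c else 0.
have coordE x c : x \in V -> x - iota c *: y \in W -> coord x = c.
  move=> Vx Wc; rewrite /coord; case: pickP => [d Wd|/(_ c)]; last by rewrite Wc.
  apply: contraNeq nWy => ndc.
  have : (x - iota c *: y) - (x - iota d *: y) \in W by rewrite WD ?WN.
  rewrite opprB addrC addrA subrK -scalerBl -rmorphB => We.
  have := WZ (d - c)^-1 _ We; rewrite scalerA -rmorphM mulVf ?subr_eq0 //.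
  by rewrite rmorph1 scale1r.
have coordP' x : x \in V -> x - iota (coord x) *: y \in W.
  by move=> Vx; have [c Wc] := coordP x Vx; rewrite (coordE x c).
exists (restrict V coord).
  apply: restrict_Fdual => //; split=> [x z Vx Vz|c x Vx].
    apply: coordE; rewrite ?FsubspaceD // rmorphD scalerDl opprD addrACA.
    by rewrite WD ?coordP'.
  apply: coordE; rewrite ?FsubspaceZ // rmorphM -scalerA -scalerBr.
  by rewrite WZ ?coordP'.
rewrite restrictE // (coordE y 1) ?oner_eq0 //.
by rewrite rmorph1 scale1r subrr.
Qed.

Lemma Fdual_add l m : l \in Fdual iota V -> m \in Fdual iota V ->
  [ffun x => l x + m x] \in Fdual iota V.
Proof.
move=> Vl Vm; have [[lD lZ] [mD mZ]] := (Fdual_linear Vl, Fdual_linear Vm).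
suff -> : [ffun x => l x + m x] = restrict V (fun x => l x + m x).
  apply: restrict_Fdual => //; split=> [x y Vx Vy|c x Vx].
    by rewrite lD ?mD // addrACA.
  by rewrite lZ ?mZ // mulrDr.
apply/ffunP=> x; rewrite !ffunE; case: ifPn => // nVx.
by rewrite (Fdual_out Vl) ?(Fdual_out Vm) ?addr0.
Qed.

Lemma Fdual_scale c l : l \in Fdual iota V ->
  [ffun x => c * l x] \in Fdual iota V.
Proof.
move=> Vl; have [lD lZ] := Fdual_linear Vl.
suff -> : [ffun x => c * l x] = restrict V (fun x => c * l x).
  apply: restrict_Fdual => //; split=> [x y Vx Vy|d x Vx].
    by rewrite lD // mulrDr.
  by rewrite lZ // mulrCA.
apply/ffunP=> x; rewrite !ffunE; case: ifPn => // nVx.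
by rewrite (Fdual_out Vl) ?mulr0.
Qed.

(** The translation argument on the dual side: adding a functional [k] with [k y = c] rescales the
    sum. The size of the dual stays in the formula because [card_Fdual] is deduced from it. *)
Lemma sum_theta_dual_raw y : y \in V ->
  \sum_(l in Fdual iota V) theta (l y) = #|Fdual iota V|%:R * (y == 0)%:R.
Proof.
move=> Vy; have [->|ny] := eqVneq y 0.
  rewrite mulr1 -sumr_const; apply: eq_bigr=> l Vl.
  by rewrite (Flinear0 (Fdual_linear Vl)) theta0.
rewrite mulr0; have [m Vm my] := Fdual_separates Vy ny.
have [_ _ [c nc]] := htheta.
pose k := [ffun x => (c / m y) * m x].
have Vk : k \in Fdual iota V by apply: Fdual_scale.
have ky : k y = c by rewrite ffunE divfK.
pose k' := [ffun x => -1 * k x]; have Vk' : k' \in Fdual iota V by apply: Fdual_scale.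
pose sh (l : {ffun 'M[L]_r -> F}) := [ffun x => k x + l x].
pose sh' (l : {ffun 'M[L]_r -> F}) := [ffun x => k' x + l x].
have shK : cancel sh sh' by move=> l; apply/ffunP=> x; rewrite !ffunE mulN1r addKr.
set s := \sum_(l in _) _; have : s = theta c * s.
  rewrite {1}/s (reindex_inj (can_inj shK)) mulr_sumr; apply: eq_big => [l|l _].
    apply/idP/idP=> [Vl|]; last exact: Fdual_add.
    by rewrite -(shK l); apply: Fdual_add.
  by rewrite ffunE thetaD ky.
move/eqP; rewrite -subr_eq0 -{1}[s]mul1r -mulrBl mulf_eq0 subr_eq0 eq_sym (negPf nc).
by move/eqP.
Qed.

Lemma Fdual0 : [ffun=> 0] \in Fdual iota V.
Proof.
rewrite (_ : [ffun=> 0] = restrict V (fun=> 0)).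
  by apply: restrict_Fdual => //; split=> [x y|c x] _; rewrite ?addr0 ?mulr0.
by apply/ffunP=> x; rewrite !ffunE if_same.
Qed.

Lemma sum_theta_Fdual l : l \in Fdual iota V ->
  \sum_(x in V) theta (l x) = #|V|%:R * (l == [ffun=> 0])%:R.
Proof.
move=> Vl; rewrite sum_theta_linear //; last exact: Fdual_linear.
congr (_ * (nat_of_bool _)%:R); apply/forall_inP/eqP=> [l0|-> x _]; last by rewrite ffunE.
apply: (Fdual_eq Vl Fdual0)=> x Vx.
by rewrite (eqP (l0 x Vx)) ffunE.
Qed.

(** Summing [theta (l x)] over all pairs, in one order only [x = 0] contributes and in the other
    only [l = 0]. *)
Lemma card_Fdual : #|Fdual iota V| = #|V|.
Proof.
apply/eqP; rewrite -(eqr_nat algC); apply/eqP.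
transitivity (\sum_(x in V) \sum_(l in Fdual iota V) theta (l x)).
  under eq_bigr => x Vx do rewrite sum_theta_dual_raw //.
  rewrite (bigD1 0) ?Fsubspace0 //= eqxx mulr1 big1 ?addr0 // => x /andP[_ /negPf->].
  by rewrite mulr0.
rewrite exchange_big /=; under eq_bigr => l Vl do rewrite sum_theta_Fdual //.
rewrite (bigD1 _ Fdual0) /= eqxx mulr1 big1 ?addr0 // => x /andP[_ /negPf->].
by rewrite mulr0.
Qed.

Lemma sum_theta_dual y : y \in V ->
  \sum_(l in Fdual iota V) theta (l y) = #|V|%:R * (y == 0)%:R.
Proof. by move=> Vy; rewrite sum_theta_dual_raw // card_Fdual. Qed.

End Subspace.

(* Fourier inversion counts the extensions of l: there are #|V| / #|W| of them. *)
Lemma Fdual_extend V W l : Fsubspace iota V -> Fsubspace iota W -> W \subset V ->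
  l \in Fdual iota W -> exists2 m, m \in Fdual iota V & {in W, m =1 l}.
Proof.
move=> hV hW sWV Wl.
have /exists_inP[m Vm /forall_inP ml] :
    [exists m in Fdual iota V, [forall x in W, m x == l x]].
  apply: contraT => /exists_inPn none.
  have := Fsubspace0 hW; set z : 'M[L]_r := 0 => Wz.
  (* If no [m] extended [l], every inner sum would vanish; in the other order [x = 0] survives and
     contributes [#|V|]. *)
  have : \sum_(m in Fdual iota V) \sum_(x in W) theta (m x - l x) = 0.
    apply: big1 => m Vm; have := none m Vm.
    rewrite sum_theta_linear //.
      rewrite (_ : [forall x in W, m x - l x == 0] = [forall x in W, m x == l x]).
        by move/negPf->; rewrite mulr0.
      by apply: eq_forallb_in => x _; rewrite subr_eq0.
    have [[lD lZ] [mD mZ]] := (Fdual_linear Wl, Fdual_linear Vm).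
    split=> [x y Wx Wy|c x Wx].
      by rewrite lD ?mD ?(subsetP sWV) // opprD addrACA.
    by rewrite lZ ?mZ ?(subsetP sWV) // mulrBr.
  rewrite exchange_big /=; under eq_bigr => x Wx.
    under eq_bigr => m _ do rewrite thetaD.
    rewrite -mulr_suml sum_theta_dual ?(subsetP sWV) //; over.
  rewrite (bigD1 z) //= eqxx mulr1 big1 => [|x /andP[_ /negPf->]]; last first.
    by rewrite mulr0 mul0r.
  rewrite addr0 => /eqP; rewrite mulf_eq0 (negPf (theta_neq0 _)) orbF pnatr_eq0.
  by rewrite cards_eq0 => /eqP V0; have := Fsubspace0 hV; rewrite V0 inE.
by exists m => // x /ml/eqP.
Qed.

End AdditiveCharacters.

(** * The groups G, P, U, N and H *)

Section Blocks.

Variables (F L : finFieldType) (iota : {rmorphism F -> L}) (n' : nat).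
Local Notation n := n'.+1.
Local Notation matrix2n := 'M[L]_(n + n).
Variables (P : rel 'I_(n + n)) (dag : matrix2n -> matrix2n).
Hypothesis hP : pattern_order P.
Local Notation g := (pattern_algebra L P).
Hypothesis hdag : anti_involution iota g dag.
Hypothesis hunits : reverses_matrix_units g dag.

Local Notation UL a := (block_mx a 0 0 0 : matrix2n).
Local Notation UR a := (block_mx 0 a 0 0 : matrix2n).
Local Notation DR a := (block_mx 0 0 0 a : matrix2n).
Local Notation u_ := (anti_fixed P dag).
(* gT stands for {'GL_(n + n)[L]}: only the faithful representation mx is used, and
   the groups are known through the matrices of their elements. *)
Variables (gT : finGroupType) (mx : gT -> matrix2n) (G : {group gT}).
Hypothesis mxM : forall v w, mx (v * w)%g = mx v *m mx w.
Hypothesis mx1 : mx 1%g = 1%:M.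
Hypothesis mx_inj : injective mx.
Hypothesis mx_onto : forall m, m \in unitmx -> exists v, mx v = m.
Hypothesis in_G : forall v, (v \in G) = (mx v - 1%:M \in g).
Implicit Types u v w : gT.

Lemma pattern_supp (x y : matrix2n) : x \in g ->
  (forall i j, y i j != 0 -> x i j != 0) -> y \in g.
Proof.
by move=> /pattern_algebraP gx xy; apply/pattern_algebraP=> i j /xy; apply: gx.
Qed.

Lemma pattern_Fsubspace : Fsubspace iota g.
Proof.
split; [exact: pattern0 | exact: patternD |] => c x gx.
apply: pattern_supp gx _ => i j; rewrite mxE mulf_eq0 negb_or; by case/andP.
Qed.

Lemma dag_in x : x \in g -> dag x \in g.
Proof. by case: hdag => dI _ _ _ /dI[]. Qed.

Lemma dagK x : x \in g -> dag (dag x) = x.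
Proof. by case: hdag => dI _ _ _ /dI[]. Qed.

Lemma dagD x y : x \in g -> y \in g -> dag (x + y) = dag x + dag y.
Proof. by case: hdag => _ dD _ _; apply: dD. Qed.

Lemma dagZ c x : x \in g -> dag (iota c *: x) = iota c *: dag x.
Proof. by case: hdag => _ _ dZ _; apply: dZ. Qed.

Lemma dagM x y : x \in g -> y \in g -> dag (x *m y) = dag y *m dag x.
Proof. by case: hdag => _ _ _ dM; apply: dM. Qed.

Lemma dag0 : dag 0 = 0.
Proof. by have := dagZ 0 (pattern0 L P); rewrite rmorph0 !scale0r. Qed.

Lemma dagN x : x \in g -> dag (- x) = - dag x.
Proof. by move=> gx; have := dagZ (-1) gx; rewrite rmorphN1 !scaleN1r. Qed.

Lemma dagB x y : x \in g -> y \in g -> dag (x - y) = dag x - dag y.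
Proof.
by move=> gx gy; rewrite dagD ?dagN //; apply: (FsubspaceN pattern_Fsubspace).
Qed.

(** * Blocks of elements of g, and the effect of dagger on them *)

Lemma block_split (x : matrix2n) : x =
  block_mx (ulsubmx x) (ursubmx x) (dlsubmx x) (drsubmx x).
Proof. by rewrite submxK. Qed.

Lemma pattern_dl0 x : x \in g -> dlsubmx x = 0.
Proof.
move/pattern_algebraP=> gx; apply/matrixP=> i j; rewrite !mxE.
have [//|/gx/andP[]] := eqVneq (x (rshift n i) (lshift n j)) 0.
by rewrite ltnNge /= (leq_trans (ltnW (ltn_ord j))) ?leq_addr.
Qed.

Lemma pattern_blocks x : x \in g ->
  [/\ UL (ulsubmx x) \in g, UR (ursubmx x) \in g & DR (drsubmx x) \in g].
Proof.
move: (block_split x); move: (ulsubmx x) (ursubmx x) (dlsubmx x) (drsubmx x).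
move=> a b c d -> gx; split; apply: pattern_supp gx _ => i j;
  by case: (split_ordP i) => k ->; case: (split_ordP j) => l ->;
    rewrite ?(block_mxEul, block_mxEur, block_mxEdl, block_mxEdr) ?mxE ?eqxx.
Qed.

Lemma dag_blocks (x : matrix2n) : x \in g ->
  (forall i j, x i j = 0 -> dag x (rev_ord j) (rev_ord i) = 0).
Proof.
move=> gx i j xij; apply/eqP; apply: contraTT isT => /(dag_entry hdag hunits gx).
by case=> i' [j' [nz /rev_ord_inj ej /rev_ord_inj ei]]; rewrite -ei -ej xij eqxx in nz.
Qed.

Lemma dag_entry0 (x : matrix2n) i j : x \in g ->
  x (rev_ord j) (rev_ord i) = 0 -> dag x i j = 0.
Proof. by move=> gx /(dag_blocks gx); rewrite !rev_ordK. Qed.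

Lemma rev_lshift (i : 'I_n) : rev_ord (lshift n i) = rshift n (rev_ord i).
Proof. by apply: val_inj; rewrite /= addnBA. Qed.

Lemma rev_rshift (i : 'I_n) : rev_ord (rshift n i) = lshift n (rev_ord i).
Proof. by apply: val_inj; rewrite /= -addnS subnDl. Qed.

(** [dag] reflects positions in the antidiagonal, which exchanges the two diagonal blocks and keeps
    the upper right one. *)
Lemma dag_UL a : UL a \in g -> exists b, dag (UL a) = DR b.
Proof.
move=> ga; exists (drsubmx (dag (UL a))); rewrite [LHS]block_split.
by congr block_mx; apply/matrixP=> i j; rewrite !mxE;
  apply: dag_entry0 => //; rewrite ?(rev_lshift, rev_rshift)
  ?(block_mxEul, block_mxEur, block_mxEdl, block_mxEdr) ?mxE.
Qed.

Lemma dag_DR a : DR a \in g -> exists b, dag (DR a) = UL b.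
Proof.
move=> ga; exists (ulsubmx (dag (DR a))); rewrite [LHS]block_split.
by congr block_mx; apply/matrixP=> i j; rewrite !mxE;
  apply: dag_entry0 => //; rewrite ?(rev_lshift, rev_rshift)
  ?(block_mxEul, block_mxEur, block_mxEdl, block_mxEdr) ?mxE.
Qed.

Lemma dag_UR a : UR a \in g -> exists b, dag (UR a) = UR b.
Proof.
move=> ga; exists (ursubmx (dag (UR a))); rewrite [LHS]block_split.
by congr block_mx; apply/matrixP=> i j; rewrite !mxE;
  apply: dag_entry0 => //; rewrite ?(rev_lshift, rev_rshift)
  ?(block_mxEul, block_mxEur, block_mxEdl, block_mxEdr) ?mxE.
Qed.

Lemma unipotent_unit x : x \in g -> 1%:M + x \in unitmx.
Proof.
move/pattern_algebraP=> gx; rewrite unitmxE -det_tr det_trig.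
  rewrite big1 ?unitr1 // => i _; rewrite !mxE eqxx.
  by have [->|/gx] := eqVneq (x i i) 0; rewrite ?addr0 // ltnn.
apply/is_trig_mxP=> i j lij; rewrite !mxE.
rewrite -val_eqE /= gtn_eqF // add0r.
by have [//|/gx/andP[]] := eqVneq (x j i) 0; rewrite ltnNge ltnW.
Qed.

(* The value is 1 if m is not invertible. *)
Definition gl_of (m : matrix2n) : gT := odflt 1%g [pick v : gT | mx v == m].

Lemma gl_ofE x : x \in g -> mx (gl_of (1%:M + x)) = 1%:M + x.
Proof.
move=> /unipotent_unit/mx_onto[v ev]; rewrite /gl_of; case: pickP => [w /eqP //|/(_ v)].
by rewrite ev eqxx.
Qed.

Lemma mxV v : mx v^-1%g = invmx (mx v).
Proof.
have e : mx v *m mx v^-1%g = 1%:M by rewrite -mxM mulgV mx1.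
have [uv _] := mulmx1_unit e.
by rewrite -[LHS](mulKmx uv) e mulmx1.
Qed.

Lemma mx_unit v : mx v \in unitmx.
Proof.
have e : mx v *m mx v^-1%g = 1%:M by rewrite -mxM mulgV mx1.
by have [] := mulmx1_unit e.
Qed.

Lemma gl_of_in x : x \in g -> gl_of (1%:M + x) \in G.
Proof. by move=> gx; rewrite in_G gl_ofE // addrC addKr. Qed.

(** * The action of G on g and on u *)

Definition gdag (v : gT) := group_dag dag (mx v).

Lemma gdagE v : gdag v = 1%:M + dag (mx v - 1%:M). Proof. by []. Qed.

(** [dag] is controlled on the algebra only, which does not contain [mx v]; so [mx v] is split as
    [1] plus an element of the algebra. *)
Lemma dag_mull v x : v \in G -> x \in g -> dag (mx v *m x) = dag x *m gdag v.
Proof.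
rewrite in_G gdagE => gv gx; rewrite -{1}[mx v](subrK 1%:M) mulmxDl mul1mx.
by rewrite (dagD (patternM hP gv gx) gx) (dagM gv gx) mulmxDr mulmx1 addrC.
Qed.

Lemma dag_mulr v x : v \in G -> x \in g -> dag (x *m gdag v) = mx v *m dag x.
Proof.
rewrite in_G gdagE => gv gx; rewrite mulmxDr mulmx1.
have gdv := dag_in gv.
rewrite (dagD gx (patternM hP gx gdv)) (dagM gx gdv) (dagK gv).
by rewrite mulmxBl mul1mx addrC subrK.
Qed.

Lemma gdag1 : gdag 1%g = 1%:M. Proof. by rewrite /gdag mx1; apply: (group_dag1 hdag). Qed.

Lemma gdagM v w : v \in G -> w \in G -> gdag (v * w)%g = gdag w *m gdag v.
Proof. by rewrite !in_G => gv gw; rewrite /gdag mxM (group_dagM hP hdag). Qed.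

Lemma pattern_mull v x : v \in G -> x \in g -> mx v *m x \in g.
Proof.
rewrite in_G => gv gx; rewrite -[mx v](subrK 1%:M) mulmxDl mul1mx.
by rewrite patternD ?(patternM hP).
Qed.

Lemma pattern_mulr v x : v \in G -> x \in g -> x *m mx v \in g.
Proof.
rewrite in_G => gv gx; rewrite -[mx v](subrK 1%:M) mulmxDr mulmx1.
by rewrite patternD ?(patternM hP).
Qed.

Lemma pattern_mulr_dag v x : v \in G -> x \in g -> x *m gdag v \in g.
Proof.
rewrite in_G gdagE => gv gx; rewrite mulmxDr mulmx1.
by rewrite patternD ?(patternM hP) ?dag_in.
Qed.

Definition gact v x := mx v *m x *m gdag v.

Lemma gact1 x : gact 1%g x = x.
Proof. by rewrite /gact gdag1 mx1 mulmx1 mul1mx. Qed.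

Lemma gactM v w x : v \in G -> w \in G -> gact (v * w)%g x = gact v (gact w x).
Proof. by move=> Gv Gw; rewrite /gact gdagM // mxM !mulmxA. Qed.

Lemma gactD v x y : gact v (x + y) = gact v x + gact v y.
Proof. by rewrite /gact (mulmxDr (mx v)) mulmxDl. Qed.

Lemma gactN v x : gact v (- x) = - gact v x.
Proof. by rewrite /gact mulmxN mulNmx. Qed.

Lemma gactZ v c x : gact v (c *: x) = c *: gact v x.
Proof. by rewrite /gact -scalemxAr -scalemxAl. Qed.

Lemma gact_in v x : v \in G -> x \in g -> gact v x \in g.
Proof. by move=> Gv gx; rewrite pattern_mulr_dag // pattern_mull. Qed.

Lemma dag_gact v x : v \in G -> x \in g -> dag (gact v x) = gact v (dag x).
Proof.
by move=> Gv gx; rewrite dag_mulr ?pattern_mull // dag_mull // mulmxA.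
Qed.

Lemma anti_fixed_Fsubspace : Fsubspace iota u_.
Proof.
split; [exact: (anti_fixed0 hdag) | exact: (anti_fixedD hdag) |] => c x.
rewrite !in_anti_fixed => /andP[gx /eqP dx].
by rewrite (FsubspaceZ pattern_Fsubspace) // dagZ // dx scalerN eqxx.
Qed.

Lemma anti_fixed_pattern x : x \in u_ -> x \in g.
Proof. by rewrite in_anti_fixed => /andP[]. Qed.

Lemma gact_anti_fixed v x : v \in G -> x \in u_ -> gact v x \in u_.
Proof.
move=> Gv; rewrite !in_anti_fixed => /andP[gx /eqP dx].
by rewrite gact_in // dag_gact // dx gactN eqxx.
Qed.

Lemma sub_dag_anti_fixed x : x \in g -> x - dag x \in u_.
Proof.
move=> gx; rewrite in_anti_fixed (FsubspaceB pattern_Fsubspace) ?dag_in //=.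
by rewrite dagB ?dag_in // dagK // opprB.
Qed.

Lemma leq_lshift (i : 'I_n) : (n <= lshift n i)%N = false.
Proof. by apply/negbTE; rewrite -ltnNge; apply: (ltn_ord i). Qed.

Lemma leq_rshift (i : 'I_n) : (n <= rshift n i)%N.
Proof. exact: leq_addr. Qed.

Lemma ltn_lshift (i : 'I_n) : (lshift n i < n)%N.
Proof. exact: (ltn_ord i). Qed.

Lemma ltn_rshift (i : 'I_n) : (rshift n i < n)%N = false.
Proof. by apply/negbTE; rewrite -leqNgt leq_rshift. Qed.

Lemma nbarP x : reflect (x \in g /\ exists b, x = UR b) (x \in nbar L P).
Proof.
apply: (iffP (in_nbar _ _)) => [[gx x0]|[gx [b eb]]]; split=> //; last first.
  move=> i j; rewrite eb; case: (split_ordP i) => k ->; case: (split_ordP j) => l ->;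
    rewrite ?(block_mxEul, block_mxEur, block_mxEdl, block_mxEdr) ?mxE //.
  by rewrite leq_lshift.
exists (ursubmx x); rewrite [LHS]block_split.
congr block_mx; apply/matrixP=> i j; rewrite !mxE; apply: x0;
  by rewrite ?(leq_lshift, leq_rshift, ltn_lshift, ltn_rshift).
Qed.

Lemma nbar_pattern x : x \in nbar L P -> x \in g. Proof. by case/nbarP. Qed.

Lemma nbar_Fsubspace : Fsubspace iota (nbar L P).
Proof.
split=> [|x y /nbarP[gx [a ea]] /nbarP[gy [b eb]]|c x /nbarP[gx [a ea]]]; apply/nbarP.
- by split; [apply: pattern0 | exists 0; rewrite block_mx0].
- by split; [apply: patternD | exists (a + b); rewrite ea eb add_block_mx !addr0].
split; first exact: (FsubspaceZ pattern_Fsubspace).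
by exists (iota c *: a); rewrite ea scale_block_mx !scaler0.
Qed.

Lemma dag_nbar x : x \in nbar L P -> dag x \in nbar L P.
Proof.
case/nbarP=> gx [a ea]; apply/nbarP; split; first exact: dag_in.
by rewrite ea in gx *; apply: dag_UR.
Qed.

(** * The splitting of u into an upper left and an upper right part *)

Definition aalg : {set 'M[L]_n} := [set a | UL a \in g].
(** This is the image of [N] under [f], described without [f]; see [f_N]. *)
Definition nalg : {set matrix2n} := u_ :&: nbar L P.

Lemma aalgP a : (a \in aalg) = (UL a \in g). Proof. by rewrite inE. Qed.

Lemma ULD a b : UL (a + b) = UL a + UL b.
Proof. by rewrite add_block_mx !addr0. Qed.

Lemma ULZ c a : UL (c *: a) = c *: UL a.
Proof. by rewrite scale_block_mx !scaler0. Qed.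

Lemma ULM a b : UL (a *m b) = UL a *m UL b.
Proof. by rewrite mulmx_block !mulmx0 !mul0mx !addr0. Qed.

Lemma aalg_Fsubspace : Fsubspace iota aalg.
Proof.
split=> [|x y|c x]; rewrite !aalgP.
- by rewrite block_mx0 pattern0.
- by rewrite ULD; apply: patternD.
by rewrite ULZ; apply: (FsubspaceZ pattern_Fsubspace).
Qed.

Lemma aalgM a b : a \in aalg -> b \in aalg -> a *m b \in aalg.
Proof. by rewrite !aalgP ULM; apply: (patternM hP). Qed.

Lemma nalg_Fsubspace : Fsubspace iota nalg.
Proof.
split=> [|x y /setIP[ux nx] /setIP[uy ny]|c x /setIP[ux nx]]; rewrite inE.
- by rewrite (Fsubspace0 anti_fixed_Fsubspace) (Fsubspace0 nbar_Fsubspace).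
- by rewrite (FsubspaceD anti_fixed_Fsubspace) // (FsubspaceD nbar_Fsubspace).
by rewrite (FsubspaceZ anti_fixed_Fsubspace) // (FsubspaceZ nbar_Fsubspace).
Qed.

Lemma sub_dag_nalg x : x \in nbar L P -> x - dag x \in nalg.
Proof.
move=> nx; rewrite inE sub_dag_anti_fixed ?nbar_pattern //=.
by rewrite (FsubspaceB nbar_Fsubspace) ?dag_nbar.
Qed.

Lemma nalg_anti_fixed x : x \in nalg -> x \in u_. Proof. by case/setIP. Qed.
Lemma nalg_nbar x : x \in nalg -> x \in nbar L P. Proof. by case/setIP. Qed.

(* Every element of u is uniquely ucomb s t with s in aalg and t in nalg; s is its
   upper left block. *)
Definition ucomb s t := UL s - dag (UL s) + t.

Lemma ucomb_in s t : s \in aalg -> t \in nalg -> ucomb s t \in u_.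
Proof.
rewrite aalgP => gs nt; apply: (FsubspaceD anti_fixed_Fsubspace).
  exact: sub_dag_anti_fixed.
exact: nalg_anti_fixed.
Qed.

Definition upart (x : matrix2n) : matrix2n := UR (ursubmx x).

Lemma ucomb_ul s t : s \in aalg -> t \in nalg -> ulsubmx (ucomb s t) = s.
Proof.
rewrite aalgP => /dag_UL[b eb] /nalg_nbar/nbarP[_ [c ->]].
by rewrite /ucomb eb opp_block_mx !add_block_mx block_mxKul oppr0 !addr0.
Qed.

Lemma ucomb_ur s t : s \in aalg -> t \in nalg -> upart (ucomb s t) = t.
Proof.
rewrite aalgP /upart => /dag_UL[b eb] /nalg_nbar/nbarP[_ [c ->]].
by rewrite /ucomb eb opp_block_mx !add_block_mx block_mxKur oppr0 !add0r.
Qed.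

(** Read in blocks, [dag x = - x] expresses the lower right block through the upper left one and
    makes the upper right part anti-fixed. *)
Lemma ucombP x : x \in u_ -> [/\ ulsubmx x \in aalg, upart x \in nalg
  & x = ucomb (ulsubmx x) (upart x)].
Proof.
move=> ux; have gx := anti_fixed_pattern ux; have [g1 g2 g3] := pattern_blocks gx.
have ex : x = UL (ulsubmx x) + upart x + DR (drsubmx x).
  by rewrite {1}[x]block_split (pattern_dl0 gx) !add_block_mx !addr0 !add0r.
have [b1 eb1] := dag_UL g1; have [b2 eb2] := dag_UR g2; have [b3 eb3] := dag_DR g3.
have dx : dag x = - x by move: ux; rewrite in_anti_fixed => /andP[_ /eqP].
have dxE : dag x = dag (UL (ulsubmx x)) + dag (upart x) + dag (DR (drsubmx x)).
  by rewrite {1}ex (dagD (patternD g1 g2) g3) (dagD g1 g2).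
have : dag x = - (UL (ulsubmx x) + upart x + DR (drsubmx x)) by rewrite -ex.
rewrite dxE /upart eb1 eb2 eb3.
rewrite !add_block_mx opp_block_mx !addr0 !add0r.
case/eq_block_mx=> e1 e2 _ e3.
have nt : upart x \in nalg.
  rewrite inE in_anti_fixed g2 eb2 e2 opp_block_mx !oppr0 eqxx /=.
  by apply/nbarP; split=> //; exists (ursubmx x).
split=> //; first by rewrite aalgP.
rewrite {1}ex /ucomb eb1 e3 opp_block_mx opprK !oppr0.
by rewrite -addrA [upart x + _]addrC addrA.
Qed.

Lemma sum_anti_fixed (E : matrix2n -> algC) :
  \sum_(x in u_) E x = \sum_(s in aalg) \sum_(t in nalg) E (ucomb s t).
Proof.
rewrite pair_big /= (reindex_onto (fun st => ucomb st.1 st.2)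
  (fun x => (ulsubmx x, upart x))) => [|x /ucombP[_ _ <-] //].
apply: eq_bigl=> [[s t]] /=; apply/andP/andP=> [[/ucombP[sa ta _] /eqP[es et]]|[sa ta]].
  by move: sa ta; rewrite es et.
by rewrite ucomb_in ?ucomb_ul ?ucomb_ur ?eqxx.
Qed.

(** * The subgroup P and its action on u *)

Definition Pset : {set gT} := [set v | mx v - 1%:M \in p_alg L P].

Lemma in_p_alg x : (x \in p_alg L P) = (x \in g) && (ulsubmx x == 0).
Proof.
rewrite [LHS]in_set; apply: andb_id2l => gx; apply/'forall_forallP/eqP=> [x0|x0 i j].
  apply/matrixP=> i j; rewrite !mxE; apply/eqP.
  by have /implyP := x0 (lshift n i) (lshift n j); apply; apply: ltn_lshift.
apply/implyP=> ltj; rewrite [x]block_split (pattern_dl0 gx) x0.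
case: (split_ordP i) => k ->; case: (split_ordP j) ltj => l ->;
  rewrite ?(block_mxEul, block_mxEur, block_mxEdl, block_mxEdr) ?mxE ?eqxx //.
Qed.

Lemma in_Pset v : (v \in Pset) = (mx v - 1%:M \in p_alg L P).
Proof. by rewrite [LHS]in_set. Qed.

Lemma Pset_group_set : group_set Pset.
Proof.
apply/group_setP; split=> [|v w]; rewrite !in_Pset.
  rewrite mx1 subrr in_p_alg pattern0; apply/eqP/matrixP=> i j.
  by rewrite !mxE.
rewrite !in_p_alg mxM => /andP[gv /eqP v0] /andP[gw /eqP w0].
rewrite (pattern1M hP gv gw) pattern_mul.
move: (pattern_dl0 gv) (pattern_dl0 gw) v0 w0.
move: (mx v - 1%:M) (mx w - 1%:M) => x y x1 y1 x0 y0.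
rewrite [x]block_split [y]block_split x0 x1 y0 y1.
by rewrite mulmx_block !add_block_mx block_mxKul !mulmx0 !addr0 eqxx.
Qed.
Definition Pgroup := Group Pset_group_set.

Lemma Pset_sub : {subset Pset <= G}.
Proof. by move=> v; rewrite inE in_p_alg in_G => /andP[]. Qed.

Lemma dag_p_algP x : x \in p_alg L P ->
  exists2 a, a \in aalg & exists2 y, y \in nbar L P & dag x = UL a + y.
Proof.
rewrite in_p_alg => /andP[gx /eqP x0]; have [_ g2 g3] := pattern_blocks gx.
have ex : x = UR (ursubmx x) + DR (drsubmx x).
  by rewrite {1}[x]block_split (pattern_dl0 gx) x0 add_block_mx !addr0 add0r.
have [b eb] := dag_DR g3; exists b; first by rewrite aalgP -eb dag_in.
exists (dag (UR (ursubmx x))); last by rewrite {1}ex (dagD g2 g3) eb addrC.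
by apply: dag_nbar; apply/nbarP; split=> //; exists (ursubmx x).
Qed.

(* The element p of P with p^dag = 1 + UL a + y. *)
Definition pel a y := gl_of (1%:M + dag (UL a + y)).

Lemma UL_nbar_in a y : a \in aalg -> y \in nbar L P -> UL a + y \in g.
Proof. by rewrite aalgP => ga /nbar_pattern gy; apply: patternD. Qed.

Lemma pelE a y : a \in aalg -> y \in nbar L P ->
  mx (pel a y) = 1%:M + dag (UL a + y).
Proof. by move=> ga gy; rewrite gl_ofE ?dag_in ?UL_nbar_in. Qed.

Lemma gdag_pel a y : a \in aalg -> y \in nbar L P ->
  gdag (pel a y) = 1%:M + (UL a + y).
Proof.
move=> ga gy; rewrite gdagE pelE //; congr (_ + _).
by rewrite addrAC subrr add0r dagK ?UL_nbar_in.
Qed.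

Lemma pel_in a y : a \in aalg -> y \in nbar L P -> pel a y \in Pset.
Proof.
move=> ga gy; rewrite inE pelE // addrC addKr in_p_alg dag_in ?UL_nbar_in //=.
have gy' := nbar_pattern gy; rewrite aalgP in ga; rewrite (dagD ga gy').
have [b ->] := dag_UL ga; have /nbarP[_ [c ->]] := dag_nbar gy.
by rewrite add_block_mx block_mxKul addr0.
Qed.

Lemma sum_Pset (E : gT -> algC) :
  \sum_(v in Pset) E v = \sum_(a in aalg) \sum_(y in nbar L P) E (pel a y).
Proof.
rewrite pair_big /= (reindex_onto (fun ay => pel ay.1 ay.2)
  (fun v => (ulsubmx (dag (mx v - 1%:M)), upart (dag (mx v - 1%:M))))) => [|v].
  apply: eq_bigl=> [[a y]] /=.
  have inv a' y' : a' \in aalg -> y' \in nbar L P ->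
      ulsubmx (dag (mx (pel a' y') - 1%:M)) = a'
      /\ upart (dag (mx (pel a' y') - 1%:M)) = y'.
    move=> ga gy; rewrite pelE // [1%:M + _]addrC addrK dagK ?UL_nbar_in //.
    have /nbarP[_ [c ->]] := gy.
    by rewrite /upart add_block_mx block_mxKul block_mxKur addr0 add0r.
  apply/andP/andP=> [[Pv /eqP[ea ey]]|[ga gy]]; last first.
    by have [-> ->] := inv a y ga gy; rewrite pel_in.
  move: Pv; rewrite inE => /dag_p_algP[a' ga' [y' gy' e']].
  rewrite e' in ea ey; have [_ [c ec]] := nbarP _ gy'; move: ea ey.
  rewrite /upart ec add_block_mx block_mxKul block_mxKur addr0 add0r -ec.
  by move=> <- <-.
rewrite inE => Pv; have [a ga [y gy e]] := dag_p_algP Pv.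
have gv : mx v - 1%:M \in g by move: Pv; rewrite in_p_alg => /andP[].
apply: mx_inj; rewrite e.
have [_ [c ec]] := nbarP _ gy.
rewrite /upart ec add_block_mx block_mxKul block_mxKur addr0 add0r -ec.
by rewrite pelE // -e dagK // addrC subrK.
Qed.

Lemma UL_nbar s y : s \in aalg -> y \in nbar L P -> UL s *m y \in nbar L P.
Proof.
rewrite aalgP => gs /nbarP[gy [b ey]]; apply/nbarP; split.
  exact: (patternM hP).
by exists (s *m b); rewrite ey mulmx_block !mulmx0 !mul0mx !addr0.
Qed.

Lemma gact_pel a y s t : a \in aalg -> y \in nbar L P -> s \in aalg -> t \in nalg ->
  gact (pel a y) (ucomb s t)
  = ucomb (s + s *m a) (t + (UL s *m y - dag (UL s *m y))).
Proof.
move=> ga gy gs nt; rewrite /gact gdag_pel // pelE // /ucomb.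
have [gUa gUs gyy] : [/\ UL a \in g, UL s \in g & y \in g].
  by rewrite -!aalgP ga gs nbar_pattern.
have gsa : UL (s *m a) \in g by rewrite ULM (patternM hP).
rewrite ULD (dagD gUs gsa) ULM (dagM gUs gUa) (dagM gUs gyy) (dagD gUa gyy).
(* Once each dagger image is replaced by a matrix with a single unknown block, the claim is an
   identity between blocks. *)
have [a' ->] := dag_UL gUa; have [s' ->] := dag_UL gUs.
have /nbarP[_ [y' ->]] := dag_nbar gy; have /nbarP[_ [b ->]] := gy.
have /nbarP[_ [t' ->]] := nalg_nbar nt.
rewrite !scalar_mx_block; do ![rewrite ?opp_block_mx ?add_block_mx ?mulmx_block
  ?mulmx0 ?mul0mx ?mulmx1 ?mul1mx ?oppr0 ?addr0 ?add0r].
rewrite !mulmxDr !mulmxDl ?mulmx1 ?mul1mx ?mulmxN ?mulNmx ?opprD.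
congr block_mx; rewrite [s *m b + _]addrC -addrA; congr (_ + _).
by rewrite addrC.
Qed.

(** * The groups H and N, and the factorizations G = P H and U = N H *)

Variables U H N : {group gT}.
Hypothesis in_U : forall v, (v \in U) = (v \in G) && (gdag v == invmx (mx v)).
Hypothesis in_N : forall v, (v \in N) = (mx v - 1%:M \in nalg).
Hypothesis in_HP : forall v, reflect
  (exists2 h : 'M[L]_n, block_mx h 0 0 1%:M - 1%:M \in g
                      & mx v = block_mx h 0 0 (invmx (tilde dag h)))
  (v \in H).

Lemma block_UL (a : 'M[L]_n) :
  1%:M + UL a = block_mx (1%:M + a) 0 0 1%:M :> matrix2n.
Proof. by rewrite scalar_mx_block add_block_mx !addr0. Qed.

Lemma gdagV v : v \in G -> gdag v^-1%g = invmx (gdag v).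
Proof.
move=> Gv; have e : gdag v^-1%g *m gdag v = 1%:M.
  by rewrite -gdagM ?groupV // mulgV gdag1.
have [_ ud] := mulmx1_unit e.
by rewrite -[LHS](mulmxK ud) e mul1mx.
Qed.

Lemma mulmx_ul (x y : matrix2n) : dlsubmx y = 0 ->
  ulsubmx (x *m y) = ulsubmx x *m ulsubmx y.
Proof.
move=> y0; rewrite {1}[x]block_split {1}[y]block_split y0 mulmx_block block_mxKul.
by rewrite mulmx0 addr0.
Qed.

Definition ulphi v : 'M[L]_n := ulsubmx (mx v).

Lemma mx_dl0 v : v \in G -> dlsubmx (mx v) = 0.
Proof.
rewrite in_G => /pattern_dl0 e; rewrite -[mx v](subrK 1%:M).
rewrite [X in X + _]block_split e scalar_mx_block add_block_mx.
by rewrite block_mxKdl addr0.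
Qed.

Lemma ulphiM v w : w \in G -> ulphi (v * w)%g = ulphi v *m ulphi w.
Proof. by move=> Gw; rewrite /ulphi mxM mulmx_ul ?mx_dl0. Qed.

Lemma ulphi1 : ulphi 1%g = 1%:M.
Proof. by rewrite /ulphi mx1 scalar_mx_block block_mxKul. Qed.

Lemma ulphi_sub1 v : ulphi v - 1%:M = ulsubmx (mx v - 1%:M).
Proof. by rewrite /ulphi; apply/matrixP=> i j; rewrite !mxE eq_lshift. Qed.

Lemma ulphi_in v : v \in G -> ulphi v - 1%:M \in aalg.
Proof. by rewrite in_G => /pattern_blocks[gv _ _]; rewrite aalgP ulphi_sub1. Qed.

(* The element of H with upper left block 1 + a. *)
Definition hel a := (gl_of (1%:M + UL a) * (gl_of (1%:M + dag (UL a)))^-1)%g.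

Lemma hel_mx a : a \in aalg ->
  mx (hel a) = block_mx (1%:M + a) 0 0 (invmx (tilde dag (1%:M + a))).
Proof.
rewrite aalgP => ga; have gd := dag_in ga.
have e : block_mx (1%:M + a) 0 0 1%:M - 1%:M = UL a by rewrite -block_UL addrC addKr.
have et : 1%:M + dag (UL a) = block_mx 1%:M 0 0 (tilde dag (1%:M + a)).
  by rewrite -(tilde_dag hdag hunits) /group_dag ?e.
have ud := unipotent_unit gd.
have ut : tilde dag (1%:M + a) \in unitmx.
  by move: ud; rewrite et unitmxE det_ublock det1 mul1r -unitmxE.
apply: (can_inj (mulmxK ud)); rewrite /hel mxM mxV !gl_ofE // mulmxKV //.
rewrite et block_UL mulmx_block !mulmx0 !mul0mx !addr0 add0r mulmx1.
by rewrite mulVmx.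
Qed.

Lemma hel_in a : a \in aalg -> hel a \in H.
Proof.
move=> ga; apply/in_HP; exists (1%:M + a); last exact: hel_mx.
by rewrite -block_UL addrC addKr -aalgP.
Qed.

Lemma HP v : reflect (exists2 a, a \in aalg & v = hel a) (v \in H).
Proof.
apply: (iffP idP) => [/in_HP[h gh hv]|[a ga ->]]; last exact: hel_in.
have eh : h = 1%:M + (h - 1%:M) by rewrite addrC subrK.
have ga : h - 1%:M \in aalg by rewrite aalgP -(addKr 1%:M (UL _)) block_UL -eh addrC.
by exists (h - 1%:M) => //; apply: mx_inj; rewrite hel_mx // -eh.
Qed.

Lemma ulphi_hel a : a \in aalg -> ulphi (hel a) = 1%:M + a.
Proof. by move=> ga; rewrite /ulphi hel_mx // block_mxKul. Qed.

Lemma H_inj : {in H &, injective ulphi}.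
Proof.
move=> _ _ /HP[a ga ->] /HP[b gb ->]; rewrite !ulphi_hel // => /addrI->.
by [].
Qed.

(** [hel a] is [x * y^-1] with [y] the dagger of [x], and its dagger is [x^-1 * y]. This is the
    inverse because [x] and [y] live in opposite diagonal blocks and commute. *)
Lemma H_sub_U : H \subset U.
Proof.
apply/subsetP=> _ /HP[a ga ->]; rewrite /hel.
have gUa : UL a \in g by rewrite -aalgP.
have gd := dag_in gUa.
set x := gl_of (1%:M + UL a); set y := gl_of (1%:M + dag (UL a)).
have [Gx Gy] : x \in G /\ y \in G by split; apply: gl_of_in.
have xy : gdag x = mx y.
  by rewrite gdagE !gl_ofE //; congr (_ + _); rewrite addrC addKr.
have yx : gdag y = mx x.
  by rewrite gdagE !gl_ofE //; congr (_ + _); rewrite addrC addKr dagK.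
have cxy : commute x y.
  apply: mx_inj; rewrite !mxM !gl_ofE //.
  have [b ->] := dag_UL gUa; rewrite !mulmxDl !mulmxDr !mulmx1 !mul1mx.
  rewrite !mulmx_block !mulmx0 !mul0mx !addr0 -!addrA; congr (_ + _).
  by rewrite !addrA; congr (_ + _); rewrite addrC.
rewrite in_U groupM ?groupV //= gdagM ?groupV // gdagV // xy yx -!mxV -mxM.
rewrite invMg invgK; apply/eqP; congr mx.
exact/esym/commuteV/commute_sym.
Qed.

Lemma U_sub_G : U \subset G.
Proof. by apply/subsetP=> v; rewrite in_U => /andP[]. Qed.

Lemma H_sub_G : H \subset G. Proof. exact: subset_trans H_sub_U U_sub_G. Qed.

(** For [x] in the upper right block [x *m x = 0], so [1 - x] is the inverse of [1 + x]; it is also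
    its dagger when [x] is anti-fixed. *)
Lemma N_sub_U : N \subset U.
Proof.
apply/subsetP=> v; rewrite in_N in_U in_G => nv.
have gx := anti_fixed_pattern (nalg_anti_fixed nv); rewrite gx /=.
have dx : dag (mx v - 1%:M) = - (mx v - 1%:M).
  by apply/eqP; have := nalg_anti_fixed nv; rewrite in_anti_fixed => /andP[].
have [_ [b eb]] := nbarP _ (nalg_nbar nv).
apply/eqP; rewrite -[RHS]mul1mx; apply: (canRL (mulmxK (mx_unit v))).
rewrite gdagE dx; rewrite -{2}[mx v](subrK 1%:M) eb.
rewrite mulmxDr mulmx1 mulmxDl mul1mx mulNmx mulmx_block !mulmx0 !mul0mx !addr0.
by rewrite block_mx0 subr0 addrCA subrr addr0.
Qed.

Lemma ulphi_N v : v \in N -> ulphi v = 1%:M.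
Proof.
rewrite in_N => nv; have [_ [b eb]] := nbarP _ (nalg_nbar nv).
by apply/eqP; rewrite -subr_eq0 ulphi_sub1 eb block_mxKul.
Qed.

(* The component in H of v, for the factorizations G = P H and U = N H. *)
Definition hof v := hel (ulphi v - 1%:M).

Lemma hof_in v : v \in G -> hof v \in H.
Proof. by move=> Gv; apply: hel_in; apply: ulphi_in. Qed.

Lemma ulphi_hof v : v \in G -> ulphi (hof v) = ulphi v.
Proof. by move=> Gv; rewrite ulphi_hel ?ulphi_in // addrC subrK. Qed.

Lemma hof_H h : h \in H -> hof h = h.
Proof.
have sHG := subsetP H_sub_G.
by move=> Hh; apply: H_inj; rewrite ?hof_in ?ulphi_hof ?sHG.
Qed.

Lemma ulphi_div_hof v : v \in G -> ulphi (v * (hof v)^-1)%g = 1%:M.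
Proof.
move=> Gv; have Gh := subsetP H_sub_G _ (hof_in Gv).
rewrite ulphiM ?groupV // -(ulphi_hof Gv) -ulphiM ?groupV // mulgV.
exact: ulphi1.
Qed.

Lemma PsetE v : (v \in Pset) = (v \in G) && (ulphi v == 1%:M).
Proof. by rewrite in_Pset in_p_alg in_G -ulphi_sub1 subr_eq0. Qed.

(** [P] is the kernel of [ulphi] on [G], and [H] contains exactly one element for each value of
    [ulphi] on [G]. *)
Lemma sum_G (E : gT -> algC) :
  \sum_(v in G) E v = \sum_(h in H) \sum_(p in Pset) E (p * h)%g.
Proof.
have sHG := subsetP H_sub_G.
rewrite (partition_big hof (mem H)) /= => [|v Gv]; last exact: hof_in.
apply: eq_bigr => h Hh; rewrite (reindex_inj (mulIg h)) /=.
apply: eq_bigl => p; rewrite PsetE (groupMr _ (sHG _ Hh)); apply: andb_id2l => Gp.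
apply/eqP/eqP=> [e|e].
  have := ulphi_div_hof (groupM Gp (sHG _ Hh)); rewrite e mulgK => ->.
  by [].
have Gph := groupM Gp (sHG _ Hh); apply: H_inj => //; first exact: hof_in.
by rewrite ulphi_hof // ulphiM ?e ?mul1mx ?sHG.
Qed.

Lemma card_G : #|G|%:R = #|Pset|%:R * #|H|%:R :> algC.
Proof.
have := sum_G (fun=> 1); rewrite sumr_const => ->.
rewrite (eq_bigr (fun=> #|Pset|%:R)) => [|h _]; last by rewrite sumr_const.
by rewrite sumr_const mulr_natr.
Qed.

Lemma sum_aalg (E : 'M[L]_n -> algC) :
  \sum_(a in aalg) E (1%:M + a) = \sum_(h in H) E (ulphi h).
Proof.
have sHG := subsetP H_sub_G.
rewrite [RHS](reindex_onto hel (fun h => ulphi h - 1%:M)) /= => [|h Hh]; last first.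
  exact: hof_H.
rewrite [RHS](eq_big (mem aalg) (fun a => E (1%:M + a))) // => a; last first.
  move=> /andP[_ /eqP ea]; congr E.
  by apply/eqP; rewrite [1%:M + a]addrC -subr_eq ea.
apply/andP/idP=> [[Hh /eqP ea]|ga].
  by have := ulphi_in (sHG _ Hh); rewrite ea.
by rewrite hel_in // ulphi_hel // addrC addKr eqxx.
Qed.

Lemma card_H : #|H| = #|aalg|.
Proof.
apply/eqP; rewrite -(eqr_nat algC); apply/eqP.
by have := sum_aalg (fun=> 1); rewrite !sumr_const => ->.
Qed.

Lemma card_N : #|N| = #|nalg|.
Proof.
rewrite -(card_in_imset (f := fun v => mx v - 1%:M) (D := N)); last first.
  by move=> v w _ _ /addIr/mx_inj.
apply: eq_card => x; apply/imsetP/idP=> [[v Nv ->]|nx]; first by rewrite -in_N.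
have gx := anti_fixed_pattern (nalg_anti_fixed nx).
have e : mx (gl_of (1%:M + x)) - 1%:M = x by rewrite gl_ofE // addrC addKr.
by exists (gl_of (1%:M + x)); rewrite ?in_N e.
Qed.

(** The quotient [w] has trivial upper left block. Then [gdag w *m mx w = 1], read block by block,
    makes its lower right block trivial and its upper right part anti-fixed. *)
Lemma U_div_hof v : v \in U -> (v * (hof v)^-1)%g \in N.
Proof.
move=> Uv; have Gv := subsetP U_sub_G _ Uv.
have Hh := hof_in Gv; have Uh := subsetP H_sub_U _ Hh.
have := ulphi_div_hof Gv.
have : (v * (hof v)^-1)%g \in U by rewrite groupM ?groupV.
move: (v * _)%g => w Uw w1; rewrite in_N.
have Gw := subsetP U_sub_G _ Uw.
have := Uw; rewrite in_U Gw /= => /eqP ew.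
have gx : mx w - 1%:M \in g by rewrite -in_G.
have [_ g2 g3] := pattern_blocks gx.
have ul0 : ulsubmx (mx w - 1%:M) = 0 by rewrite -ulphi_sub1 w1 subrr.
have ex : mx w - 1%:M = UR (ursubmx (mx w - 1%:M)) + DR (drsubmx (mx w - 1%:M)).
  by rewrite {1}[mx w - 1%:M]block_split (pattern_dl0 gx) ul0 add_block_mx !addr0 add0r.
have : gdag w *m mx w = 1%:M by rewrite ew mulVmx ?mx_unit.
rewrite gdagE -{2}[mx w](subrK 1%:M).
move: (mx w - 1%:M) gx g2 g3 ex => x gx g2 g3 ex.
move: (ursubmx x) (drsubmx x) ex g2 g3 => c d ex g2 g3; subst x.
have [b eb] := dag_UR g2; have [a ea] := dag_DR g3.
rewrite (dagD g2 g3) eb ea => e1.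
have a0 : a = 0.
  have := congr1 ulsubmx e1; rewrite scalar_mx_block !add_block_mx mulmx_block.
  rewrite !block_mxKul !(mulmx0, mul0mx, addr0, add0r, mulmx1).
  by move/(canRL (addKr _)); rewrite addNr.
have d0 : DR d = 0 by rewrite -(dagK g3) ea a0 block_mx0 dag0.
have b0 : b = - c.
  have := congr1 ursubmx e1; rewrite scalar_mx_block !add_block_mx mulmx_block.
  rewrite !block_mxKur !(mulmx0, mul0mx, addr0, add0r, mulmx1, mul1mx) a0.
  have /eq_block_mx[_ _ _ ->] : DR d = block_mx 0 0 0 0 by rewrite d0 block_mx0.
  rewrite !(mulmx0, mul0mx, addr0, add0r, mulmx1, mul1mx).
  by move/eqP; rewrite addrC addr_eq0 => /eqP.
rewrite d0 addr0 in gx *; rewrite inE in_anti_fixed gx eb b0 opp_block_mx !oppr0 eqxx.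
by apply/nbarP; split=> //; exists c.
Qed.

Lemma N_mulH : (N * H)%g = U.
Proof.
apply/eqP; rewrite eqEsubset mul_subG ?N_sub_U ?H_sub_U //=.
apply/subsetP=> v Uv; apply/mulsgP.
have Gv := subsetP U_sub_G _ Uv.
by exists (v * (hof v)^-1)%g (hof v); rewrite ?U_div_hof ?hof_in ?mulgKV.
Qed.

Lemma N_H_TI : N :&: H = 1%g.
Proof.
apply/trivgP/subsetP=> v /setIP[Nv Hv]; apply/set1P.
by apply: H_inj; rewrite ?group1 // ulphi_N // ulphi1.
Qed.

Lemma nbar_mull v y : v \in G -> y \in nbar L P -> mx v *m y \in nbar L P.
Proof.
move=> Gv /nbarP[gy [b ey]]; apply/nbarP; split; first exact: pattern_mull.
exists (ulphi v *m b); rewrite ey [mx v]block_split (mx_dl0 Gv) mulmx_block.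
by rewrite !mulmx0 !mul0mx !addr0.
Qed.

Lemma nbar_mulr v y : v \in G -> y \in nbar L P -> y *m mx v \in nbar L P.
Proof.
move=> Gv /nbarP[gy [b ey]]; apply/nbarP; split; first exact: pattern_mulr.
exists (b *m drsubmx (mx v)); rewrite ey {1}[mx v]block_split (mx_dl0 Gv) mulmx_block.
by rewrite !mulmx0 !mul0mx !addr0 ?add0r.
Qed.

Lemma nbar_mull_ulphi v y : v \in G -> y \in nbar L P ->
  mx v *m y = UL (ulphi v) *m y.
Proof.
move=> Gv /nbarP[gy [b ey]]; rewrite ey {1}[mx v]block_split (mx_dl0 Gv).
by rewrite !mulmx_block !mulmx0 !mul0mx !addr0.
Qed.

Lemma gact_U v x : v \in U -> gact v x = mx v *m x *m mx v^-1%g.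
Proof. by rewrite in_U => /andP[_ /eqP]; rewrite /gact mxV => ->. Qed.

Lemma gact_nalg v x : v \in U -> x \in nalg -> gact v x \in nalg.
Proof.
move=> Uv /setIP[ux nx]; have Gv := subsetP U_sub_G _ Uv.
rewrite inE gact_anti_fixed // gact_U // nbar_mulr ?groupV //.
exact: nbar_mull.
Qed.

Lemma mx_conj v w : mx (v ^ w)%g - 1%:M = mx w^-1%g *m (mx v - 1%:M) *m mx w.
Proof.
rewrite conjgE !mxM mulmxBr mulmxBl mulmx1 mulmxA -[mx w^-1%g *m mx w]mxM.
by rewrite mulVg mx1.
Qed.

Lemma U_norm_N : U \subset 'N(N).
Proof.
apply/subsetP=> v Uv; rewrite inE; apply/subsetP=> _ /imsetP[m Nm ->].
rewrite in_N mx_conj; rewrite in_N in Nm.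
have := gact_nalg (groupVr Uv) Nm; rewrite gact_U ?groupV // invgK.
by [].
Qed.

Lemma U_sdprod : N ><| H = U.
Proof.
by rewrite sdprodE ?N_mulH ?N_H_TI // (subset_trans H_sub_U U_norm_N).
Qed.

Lemma card_U : #|U| = (#|N| * #|H|)%N.
Proof. by rewrite (sdprod_card U_sdprod). Qed.

Lemma remgr_U v : v \in U -> remgr N H v = hof v.
Proof.
move=> Uv; have Gv := subsetP U_sub_G _ Uv.
by rewrite -{1}(mulgKV (hof v) v) (remgrMid N_H_TI) ?U_div_hof ?hof_in.
Qed.

Lemma divgr_U v : v \in U -> divgr N H v = (v * (hof v)^-1)%g.
Proof.
move=> Uv; have Gv := subsetP U_sub_G _ Uv.
by rewrite -{1}(mulgKV (hof v) v) (divgrMid N_H_TI) ?U_div_hof ?hof_in.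
Qed.

(** * The Springer morphism *)

Variables (f : gT -> matrix2n) (coef : nat -> F).
Hypothesis fE : {in G, forall v, f v = (mx v - 1%:M)
   + \sum_(2 <= i < n + n) iota (coef i) *: (mx v - 1%:M) ^+ i}.
Hypothesis f_U : [set f v | v in U] = u_.

Lemma pattern_exp x i : x \in g -> (0 < i)%N -> x ^+ i \in g.
Proof.
move=> gx; case: i => // i _; elim: i => [|i IH]; first by rewrite expr1.
by rewrite exprS; apply: (patternM hP).
Qed.

(** Chosen so that [f v] is [v - 1] times [1 + fcof v]. The exponents [i.-1] are at least 1, so
    [fcof v] has no constant term and [1 + fcof v] is again in [G]. *)
Definition fcof v := \sum_(2 <= i < n + n) iota (coef i) *: (mx v - 1%:M) ^+ i.-1.

Lemma fcof_in v : v \in G -> fcof v \in g.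
Proof.
rewrite in_G => gx; rewrite /fcof big_nat.
apply: (big_ind (fun y => y \in g)) => [||i /andP[i1 _]]; first exact: pattern0.
  exact: patternD.
by rewrite (FsubspaceZ pattern_Fsubspace) ?pattern_exp //; case: i i1 => [|[|i]].
Qed.

Lemma f_factor v : v \in G -> f v = (mx v - 1%:M) *m (1%:M + fcof v).
Proof.
move=> Gv; rewrite (fE Gv) mulmxDr mulmx1 /fcof mulmx_sumr !big_nat; congr (_ + _).
apply: eq_bigr => i /andP[i1 _]; rewrite -scalemxAr; congr (_ *: _).
by case: i i1 => [|i] // _; rewrite exprS.
Qed.

Lemma f_anti_fixed v : v \in U -> f v \in u_.
Proof. by move=> Uv; rewrite -f_U; apply: imset_f. Qed.

Lemma f_conj v w : v \in G -> w \in G ->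
  f (v ^ w)%g = mx w^-1%g *m f v *m mx w.
Proof.
move=> Gv Gw; rewrite (fE Gv) fE ?groupJ // mx_conj.
rewrite [in RHS]mulmxDr [in RHS]mulmxDl; congr (_ + _).
rewrite mulmx_sumr mulmx_suml; apply: eq_bigr => i _.
rewrite -scalemxAr -scalemxAl; congr (_ *: _).
have cancelw : mx w *m mx w^-1%g = 1%:M by rewrite -mxM mulgV mx1.
elim: i => [|i IH].
  rewrite !expr0 mulmx1 -mxM mulVg mx1.
  by [].
rewrite !exprS IH -!mulmxE !mulmxA; congr (_ *m _); congr (_ *m _).
by rewrite -[LHS]mulmxA cancelw mulmx1.
Qed.

Lemma f_N v : v \in N -> f v = mx v - 1%:M.
Proof.
move=> Nv; have Gv := subsetP (subset_trans N_sub_U U_sub_G) _ Nv.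
rewrite (fE Gv) big_nat big1 ?addr0 // => i /andP[i1 _].
rewrite in_N in Nv; have [_ [b ->]] := nbarP _ (nalg_nbar Nv).
have sq0 : UR b *m UR b = 0.
  by rewrite mulmx_block !mulmx0 !mul0mx !addr0 block_mx0.
case: i i1 => [|[|i]] // _; rewrite !exprS mulrA.
by rewrite [X in X * _]sq0 mul0r scaler0.
Qed.

Lemma f_ul v : v \in G ->
  ulsubmx (f v) = (ulphi v - 1%:M) *m ulphi (gl_of (1%:M + fcof v)).
Proof.
move=> Gv; have gr := fcof_in Gv; have Gr := gl_of_in gr.
have -> : f v = (mx v - 1%:M) *m mx (gl_of (1%:M + fcof v)).
  by rewrite (f_factor Gv) (gl_ofE gr).
by rewrite mulmx_ul ?(mx_dl0 Gr) // ulphi_sub1.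
Qed.

Lemma card_anti_fixed : #|u_| = #|U|.
Proof.
apply/eqP; rewrite -(eqr_nat algC) card_U card_N card_H; apply/eqP.
have := sum_anti_fixed (fun=> 1); rewrite sumr_const => ->.
rewrite (eq_bigr (fun=> #|nalg|%:R)) => [|s _]; last by rewrite sumr_const.
by rewrite sumr_const -[LHS]mulr_natr natrM.
Qed.

(** [f_U] gives surjectivity onto the anti-fixed elements, and there are as many of these as
    elements of [U]. *)
Lemma f_inj : {in U &, injective f}.
Proof. by apply/imset_injP; rewrite f_U card_anti_fixed. Qed.

Lemma sum_U_f (E : matrix2n -> algC) : \sum_(v in U) E (f v) = \sum_(x in u_) E x.
Proof. by rewrite -f_U big_imset //; apply: f_inj. Qed.

(** * Functionals on u and supercharacters *)

Section Functional.

Variable theta : F -> algC.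
Hypothesis htheta : nontrivial_additive_char theta.
Hypothesis two_neq0 : 2%:R != 0 :> F.
Implicit Types l : {ffun matrix2n -> F}.

Local Notation udual := (Fdual iota u_).
Local Notation bar := (bar P dag).

Definition nu l (a : 'M[L]_n) := l (UL a - dag (UL a)).

Lemma nu_linear l : l \in udual -> Flinear iota aalg (nu l).
Proof.
move=> ul; have [lD lZ] := Fdual_linear ul; split=> [x y|c x]; rewrite !aalgP.
  move=> gx gy; rewrite /nu -lD ?sub_dag_anti_fixed // ULD (dagD gx gy).
  by rewrite opprD addrACA.
move=> gx; rewrite /nu -lZ ?sub_dag_anti_fixed // ULZ dagZ // scalerBr.
by [].
Qed.

Lemma functional_ucomb l s t : l \in udual -> s \in aalg -> t \in nalg ->
  l (ucomb s t) = nu l s + l t.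
Proof.
move=> ul gs nt; have [lD _] := Fdual_linear ul.
by rewrite /ucomb lD ?sub_dag_anti_fixed -?aalgP ?nalg_anti_fixed.
Qed.

Lemma barE l y : y \in nbar L P -> bar l y = 2%:R^-1 * l (y - dag y).
Proof. exact: restrictE. Qed.

Lemma bar_linear l : Flinear iota nalg l -> Flinear iota (nbar L P) (bar l).
Proof.
move=> [lD lZ]; split=> [x y nx ny|c x nx].
  rewrite !barE ?(FsubspaceD nbar_Fsubspace) // -mulrDr -lD ?sub_dag_nalg //.
  by rewrite (dagD (nbar_pattern nx) (nbar_pattern ny)) opprD addrACA.
have e : iota c *: x - dag (iota c *: x) = iota c *: (x - dag x).
  by rewrite (dagZ _ (nbar_pattern nx)) scalerBr.
by rewrite !barE ?(FsubspaceZ nbar_Fsubspace) // e lZ ?sub_dag_nalg // mulrCA.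
Qed.

(** For anti-fixed [t] the difference [t - dag t] is [2 t], which the factor 1/2 in [bar]
    compensates. *)
Lemma bar_nalg l t : Flinear iota nalg l -> t \in nalg -> bar l t = l t.
Proof.
move=> [lD _] nt; rewrite barE ?nalg_nbar //.
have /andP[_ /eqP->] : (t \in g) && (dag t == - t).
  by rewrite -in_anti_fixed nalg_anti_fixed.
by rewrite opprK lD // -mulr2n -[l t *+ 2]mulr_natl mulKf.
Qed.

Lemma bar_dag l y : Flinear iota nalg l -> y \in nbar L P -> bar l (dag y) = - bar l y.
Proof.
move=> hl ny; rewrite !barE ?dag_nbar // dagK ?nbar_pattern //.
by rewrite -opprB (FlinearN hl) ?sub_dag_nalg // mulrN.
Qed.

Lemma udual_nalg l : l \in udual -> Flinear iota nalg l.
Proof.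
move=> /Fdual_linear[lD lZ]; split=> [x y /nalg_anti_fixed ux /nalg_anti_fixed uy|].
  exact: lD.
by move=> c x /nalg_anti_fixed; apply: lZ.
Qed.

(* H_psi = 1 + calg l, cf. Cset_stabilizer. *)
Definition calg l : {set 'M[L]_n} :=
  [set s in aalg | [forall y in nbar L P, bar l (UL s *m y) == 0]].

Lemma calgP l s : reflect (s \in aalg /\ {in nbar L P, forall y, bar l (UL s *m y) = 0})
  (s \in calg l).
Proof.
rewrite [X in reflect _ X]in_set.
apply: (iffP andP) => [[gs /forall_inP s0]|[gs s0]]; split=> //.
  by move=> y /s0/eqP.
by apply/forall_inP=> y /s0->.
Qed.

Lemma calg_Fsubspace l : Flinear iota nalg l -> Fsubspace iota (calg l).
Proof.
move=> hl; have [bD bZ] := bar_linear hl; split.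
- apply/calgP; split=> [|y ny]; first exact: Fsubspace0 aalg_Fsubspace.
  by rewrite block_mx0 mul0mx (Flinear0 nbar_Fsubspace (bar_linear hl)).
- move=> x y /calgP[gx x0] /calgP[gy y0]; apply/calgP.
  split=> [|z nz]; first exact: (FsubspaceD aalg_Fsubspace).
  by rewrite ULD mulmxDl bD ?UL_nbar // x0 ?y0 ?addr0.
move=> c x /calgP[gx x0]; apply/calgP.
split=> [|z nz]; first exact: (FsubspaceZ aalg_Fsubspace).
by rewrite ULZ -scalemxAl bZ ?UL_nbar // x0 ?mulr0.
Qed.

Lemma calg_aalg l s : s \in calg l -> s \in aalg. Proof. by case/calgP. Qed.

Lemma calgM l s a : s \in calg l -> a \in aalg -> s *m a \in calg l.
Proof.
move=> /calgP[gs s0] ga; apply/calgP; split=> [|y ny]; first exact: aalgM.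
by rewrite ULM -mulmxA s0 ?UL_nbar.
Qed.

Lemma sum_Pset_functional l s t : l \in udual -> s \in aalg -> t \in nalg ->
  \sum_(v in Pset) theta (l (gact v (ucomb s t)))
  = #|nbar L P|%:R * (s \in calg l)%:R * theta (l t)
    * \sum_(a in aalg) theta (nu l (s + s *m a)).
Proof.
move=> ul gs nt; rewrite sum_Pset mulr_sumr; apply: eq_bigr => a ga.
have hl := udual_nalg ul; have [lD lZ] := hl.
(* With [z = s y], the functional takes [z - dag z] to twice [bar l z]. As 2 is invertible in [F],
   the sum over [y] tests whether [s] lies in [calg l]. *)
have sum_y : \sum_(y in nbar L P) theta (2%:R * bar l (UL s *m y))
    = #|nbar L P|%:R * (s \in calg l)%:R.
  have [bD bZ] := bar_linear hl.
  rewrite (sum_theta_linear htheta nbar_Fsubspace (m := fun y => 2%:R * bar l (UL s *m y))).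
    congr (_ * (nat_of_bool _)%:R); apply/forall_inP/calgP=> [s0|[_ s0] y ny].
      split=> // y /s0; by rewrite mulf_eq0 (negPf two_neq0) => /eqP.
    by rewrite s0 // mulr0.
  split=> [x y nx ny|c x nx].
    by rewrite mulmxDr bD ?UL_nbar // mulrDr.
  by rewrite -scalemxAr bZ ?UL_nbar // mulrCA.
rewrite -sum_y !mulr_suml; apply: eq_bigr => y ny.
have nz := UL_nbar gs ny.
rewrite (gact_pel ga ny gs nt) functional_ucomb //.
- rewrite lD ?sub_dag_nalg // barE // mulVKf // !(thetaD htheta).
  by rewrite mulrC -mulrA mulrCA mulrA.
- by rewrite (FsubspaceD aalg_Fsubspace) ?aalgM.
by rewrite (FsubspaceD nalg_Fsubspace) ?sub_dag_nalg.
Qed.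

Lemma sum_Pset_anti_fixed l x : l \in udual -> x \in u_ ->
  \sum_(v in Pset) theta (l (gact v x))
  = #|nbar L P|%:R * (ulsubmx x \in calg l)%:R * theta (l (upart x))
    * \sum_(h in H) theta (nu l (ulsubmx x *m ulphi h)).
Proof.
move=> ul /ucombP[gs nt ex]; rewrite {1}ex (sum_Pset_functional ul gs nt).
rewrite -(sum_aalg (fun b => theta (nu l (ulsubmx x *m b)))); congr (_ * _).
apply: eq_bigr => a _.
by rewrite mulmxDr mulmx1.
Qed.

Lemma bar_left_invariant l v y : Flinear iota nalg l -> v \in G ->
  ulphi v - 1%:M \in calg l -> y \in nbar L P -> bar l (mx v *m y) = bar l y.
Proof.
move=> hl Gv /calgP[_ v0] ny; have [bD _] := bar_linear hl.
rewrite nbar_mull_ulphi // -[ulphi v](subrK 1%:M) ULD mulmxDl.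
have e1 : UL 1%:M *m y = y.
  have /nbarP[_ [b ->]] := ny.
  by rewrite mulmx_block !mulmx0 !mul0mx !addr0 mul1mx.
by rewrite e1 bD ?UL_nbar ?ulphi_in // v0 // add0r.
Qed.

Definition Cset l : {set gT} := [set h in H | ulphi h - 1%:M \in calg l].

Lemma in_Cset l h : (h \in Cset l) = (h \in H) && (ulphi h - 1%:M \in calg l).
Proof. by rewrite [LHS]in_set. Qed.

Lemma Cset_left_invariant l h : Flinear iota nalg l -> h \in H ->
  reflect {in nbar L P, forall y, bar l (mx h *m y) = bar l y} (h \in Cset l).
Proof.
move=> hl Hh; have Gh := subsetP H_sub_G _ Hh; rewrite in_Cset Hh /=.
apply: (iffP idP) => [hc y ny|inv]; first exact: bar_left_invariant.
apply/calgP; split=> [|y ny]; first exact: ulphi_in.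
have [bD _] := bar_linear hl.
have := inv y ny; rewrite nbar_mull_ulphi // -{1}[ulphi h](subrK 1%:M) ULD mulmxDl.
have e1 : UL 1%:M *m y = y.
  have /nbarP[_ [b ->]] := ny.
  by rewrite mulmx_block !mulmx0 !mul0mx !addr0 mul1mx.
rewrite e1 bD ?UL_nbar ?ulphi_in // => /(canRL (addrK _)).
by rewrite subrr.
Qed.

Lemma Cset_group_set l : Flinear iota nalg l -> group_set (Cset l).
Proof.
move=> hl; apply/group_setP; split=> [|h k].
  rewrite in_Cset group1 ulphi1 subrr (Fsubspace0 (calg_Fsubspace hl)).
  by [].
move=> Ch Ck; have [Hh Hk] : h \in H /\ k \in H.
  by move: Ch Ck; rewrite !in_Cset => /andP[-> _] /andP[-> _].
have [Gh Gk] := (subsetP H_sub_G _ Hh, subsetP H_sub_G _ Hk).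
apply/(Cset_left_invariant hl (groupM Hh Hk)) => y ny.
rewrite mxM -mulmxA (Cset_left_invariant hl Hh Ch) ?nbar_mull //.
exact: (Cset_left_invariant hl Hk Ck).
Qed.

(** Since [k] is in [U], its inverse has dagger [k]. Dagger therefore turns multiplication by [k] on
    the right into multiplication by [k^-1] on the left, and [bar l] merely changes sign under
    dagger, twice in all. *)
Lemma bar_right_invariant l k : Flinear iota nalg l -> k \in Cset l ->
  {in nbar L P, forall y, bar l (y *m mx k) = bar l y}.
Proof.
move=> hl Ck y ny; have Hk : k \in H by move: Ck; rewrite in_Cset => /andP[].
have [Uk Gk] := (subsetP H_sub_U _ Hk, subsetP H_sub_G _ Hk).
have gk : gdag k^-1%g = mx k.
  have := Uk; rewrite in_U => /andP[_ /eqP ek].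
  by rewrite gdagV // ek invmxK.
have Ckv : k^-1%g \in Cset l by apply: (@groupVr _ (Group (Cset_group_set hl))).
have Hkv := groupVr Hk.
rewrite -[y in LHS]dagK ?nbar_pattern // -gk.
rewrite -dag_mull ?groupV ?dag_in ?nbar_pattern //.
rewrite bar_dag ?nbar_mull ?groupV ?dag_nbar //.
by rewrite (Cset_left_invariant hl Hkv Ckv) ?dag_nbar // bar_dag // opprK.
Qed.

Lemma ulphi_calg l h a : a \in aalg -> Flinear iota nalg l ->
  h \in H -> (a *m ulphi h \in calg l) = (a \in calg l).
Proof.
move=> ga hl Hh; have aux b k : k \in H -> b \in calg l -> b *m ulphi k \in calg l.
  move=> Hk cb; rewrite -[ulphi k](subrK 1%:M) mulmxDr mulmx1.
  by rewrite (FsubspaceD (calg_Fsubspace hl)) ?calgM ?ulphi_in ?(subsetP H_sub_G).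
apply/idP/idP=> [ch|]; last exact: aux.
have Gh := subsetP H_sub_G _ Hh.
have := aux _ _ (groupVr Hh) ch; rewrite -mulmxA -ulphiM ?groupV // mulgV.
by rewrite ulphi1 mulmx1.
Qed.

Lemma upart_mul1D x y : dlsubmx x = 0 -> dlsubmx y = 0 ->
  upart (x *m (1%:M + y))
  = UL (ulsubmx x) *m upart (1%:M + y) + (upart x + upart x *m y).
Proof.
rewrite /upart => x0 y0; move: (block_split x) (block_split y); rewrite x0 y0.
move: (ulsubmx x) (ursubmx x) (drsubmx x) (ulsubmx y) (ursubmx y) (drsubmx y).
move=> a b d p q t -> ->; rewrite scalar_mx_block !add_block_mx !mulmx_block.
rewrite !block_mxKur !add_block_mx.
by rewrite !(mulmx0, mul0mx, addr0, add0r, mulmxDr, mulmx1).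
Qed.

(* Modulo terms killed by l, multiplication on the right by an element of C acts
   trivially on nbar, so only the linear term of f(m k) contributes. *)
Lemma functional_f_div l m k : l \in udual -> m \in N -> k \in Cset l ->
  l (upart (f (m * k)%g)) = l (f m).
Proof.
move=> ul Nm Ck; have hl := udual_nalg ul; have [bD bZ] := bar_linear hl.
have Hk : k \in H by move: Ck; rewrite in_Cset => /andP[].
have [Uk Gk] := (subsetP H_sub_U _ Hk, subsetP H_sub_G _ Hk).
have Um := subsetP N_sub_U _ Nm; have Gm := subsetP U_sub_G _ Um.
have inv_r := bar_right_invariant hl Ck.
set v := (m * k)%g; have Gv : v \in G by rewrite groupM.
have Uv : v \in U by rewrite groupM.
have ny0 : mx m - 1%:M \in nbar L P by apply: nalg_nbar; rewrite -in_N.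
have kill y : y \in nbar L P -> y *m (mx m - 1%:M) = 0.
  have [_ [b ->]] := nbarP _ ny0; case/nbarP=> _ [b' ->].
  by rewrite mulmx_block !mulmx0 !mul0mx !addr0 block_mx0.
set x := mx v - 1%:M.
have xE : x = (mx k - 1%:M) + (mx m - 1%:M) *m mx k.
  by rewrite /x mxM mulmxBl mul1mx [RHS]addrC addrA subrK.
have nx y : y \in nbar L P -> y *m x \in nbar L P.
  move=> ny; rewrite mulmxBr mulmx1 (FsubspaceB nbar_Fsubspace) //.
  exact: nbar_mulr.
(* Here [y (m k - 1) = y k - y], because [y (m - 1) = 0], and [bar l] does not see [k] on the
   right. *)
have bx y : y \in nbar L P -> bar l (y *m x) = 0.
  move=> ny; rewrite /x mulmxBr mulmx1 mxM mulmxA.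
  rewrite -{1}[mx m](subrK 1%:M) mulmxDr kill // add0r mulmx1.
  rewrite (FlinearB nbar_Fsubspace (bar_linear hl)) ?nbar_mulr // inv_r //.
  by rewrite subrr.
have nxi y i : y \in nbar L P -> y *m x ^+ i \in nbar L P.
  elim: i y => [|i IH] y ny; first by rewrite expr0 mulmx1.
  by rewrite exprS -mulmxE mulmxA IH ?nx.
have bxi y i : y \in nbar L P -> (0 < i)%N -> bar l (y *m x ^+ i) = 0.
  case: i => // i ny _; rewrite exprSr -mulmxE mulmxA bx //.
  exact: nxi.
have gx : x \in g by rewrite /x -in_G.
have [gUL gUR gDR] := pattern_blocks gx.
have nux : upart x \in nbar L P by apply/nbarP; split=> //; exists (ursubmx x).
have fcofb y : y \in nbar L P -> bar l (y *m fcof v) = 0 /\ y *m fcof v \in nbar L P.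
  move=> ny; rewrite /fcof -/x mulmx_sumr big_nat.
  apply: (big_ind (fun z => bar l z = 0 /\ z \in nbar L P)).
  - by rewrite (Flinear0 nbar_Fsubspace (bar_linear hl)) (Fsubspace0 nbar_Fsubspace).
  - move=> z z' [z0 nz] [z0' nz']; rewrite bD // z0 z0' addr0.
    by rewrite (FsubspaceD nbar_Fsubspace).
  move=> i /andP[i1 _]; rewrite -scalemxAr (FsubspaceZ nbar_Fsubspace) ?nxi //.
  by rewrite bZ ?nxi // bxi ?mulr0 //; case: i i1 => [|[|i]].
have cUL : ulsubmx x \in calg l.
  rewrite /x -ulphi_sub1 ulphiM // ulphi_N // mul1mx.
  by move: Ck; rewrite in_Cset => /andP[].
have [_ nfu _] := ucombP (f_anti_fixed Uv).
rewrite -(bar_nalg hl nfu).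
(* The first summand is killed because the upper left block of [x] is in [calg l], the last because
   [fcof v] has only positive powers of [x]. What remains is [upart x], that is, [(m - 1) k]. *)
have ufx : upart (f v) = UL (ulsubmx x) *m upart (1%:M + fcof v)
    + (upart x + upart x *m fcof v).
  by rewrite (f_factor Gv) upart_mul1D ?pattern_dl0 ?fcof_in.
have nur : upart (1%:M + fcof v) \in nbar L P.
  have gr := fcof_in Gv; have [_ g2 _] := pattern_blocks gr.
  have -> : upart (1%:M + fcof v) = upart (fcof v).
    by rewrite /upart; congr block_mx; apply/matrixP=> i j; rewrite !mxE eq_lrshift add0r.
  by apply/nbarP; split=> //; exists (ursubmx (fcof v)).
have [bf nf] := fcofb _ nux.
rewrite ufx bD ?UL_nbar ?(FsubspaceD nbar_Fsubspace) ?(calg_aalg cUL) //.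
have [_ -> //] := calgP _ _ cUL; rewrite add0r bD // bf addr0.
have -> : upart x = (mx m - 1%:M) *m mx k.
  rewrite xE; have /nbarP[_ [b ->]] := nbar_mulr Gk ny0.
  have /in_HP[h _ ->] := Hk.
  by rewrite /upart scalar_mx_block opp_block_mx !add_block_mx block_mxKur !oppr0 !add0r.
rewrite inv_r // f_N // bar_nalg //.
by rewrite -in_N.
Qed.

(** Up to a constant, the average over the right translates of [nu l] by [A] of their additive
    characters at [h - 1]. It makes sense on all of [H]; an indicator of [C] accompanies it. *)
Definition phi0 l h := \sum_(h' in H) theta (nu l ((ulphi h - 1%:M) *m ulphi h')).

Lemma sum_Pset_f l (x : gT) : l \in udual -> x \in U ->
  \sum_(v in Pset) theta (l (gact v (f x)))
  = #|nbar L P|%:R * (theta (l (f (divgr N H x)))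
      * ((remgr N H x \in Cset l)%:R * phi0 l (remgr N H x))).
Proof.
move=> ul Ux; have hl := udual_nalg ul; have Gx := subsetP U_sub_G _ Ux.
rewrite (sum_Pset_anti_fixed ul (f_anti_fixed Ux)) f_ul //.
have Nd := U_div_hof Ux; rewrite divgr_U // remgr_U //.
have Hk := hof_in Gx; set k := hof x in Nd Hk *.
have ek : ulphi x = ulphi k by rewrite ulphi_hof.
have ga : ulphi k - 1%:M \in aalg by rewrite -ek ulphi_in.
set y := gl_of _; have Gy : y \in G by apply/gl_of_in/fcof_in.
have Hy := hof_in Gy; rewrite -(ulphi_hof Gy) ek ulphi_calg // in_Cset Hk /=.
case: (boolP (_ \in calg l)) => [ck|_]; last by rewrite !(mulr0, mul0r).
rewrite !mulr1 mul1r -mulrA; congr (_ * (_ * _)).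
  have Ck : k \in Cset l by rewrite in_Cset Hk.
  by rewrite -(functional_f_div ul Nd Ck) mulgKV.
(* The factor [1 + fcof x] multiplies the upper left block on the right by a fixed element of [A],
   which the sum over [H] absorbs. *)
rewrite /phi0 [RHS](reindex_inj (mulgI (hof y))) /=; apply: eq_big => h.
  by rewrite groupMl.
by move=> Hh; rewrite (ulphiM _ (subsetP H_sub_G _ Hh)) mulmxA.
Qed.

(** * Orbits of functionals, and chi_l as an average over G *)

Definition dact v l :=
  restrict u_ (fun x => l (invmx (mx v) *m x *m group_dag dag (invmx (mx v)))).

Lemma dact_restrict v l : dact v l = restrict u_ (fun x => l (gact v^-1%g x)).
Proof. by rewrite /dact /gact /gdag mxV. Qed.

Lemma gact_functional_linear l v : l \in udual -> v \in G ->
  Flinear iota u_ (fun x => l (gact v x)).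
Proof.
move=> ul Gv; have [lD lZ] := Fdual_linear ul; split=> [x y ux uy|d x ux].
  by rewrite gactD lD ?gact_anti_fixed.
by rewrite gactZ lZ ?gact_anti_fixed.
Qed.

Lemma dact_in : {in G & udual, forall v l, dact v l \in udual}.
Proof.
move=> v l Gv ul; rewrite dact_restrict; apply: restrict_Fdual.
  exact: anti_fixed_Fsubspace.
by apply: gact_functional_linear; rewrite ?groupV.
Qed.

Lemma dactE v l x : x \in u_ -> dact v l x = l (gact v^-1%g x).
Proof. by move=> ux; rewrite dact_restrict restrictE. Qed.

Lemma dact1 : {in udual, forall l, dact 1%g l = l}.
Proof.
move=> l ul; apply: (Fdual_eq (dact_in (group1 G) ul) ul) => x ux.
by rewrite dactE // invg1 gact1.
Qed.

Lemma dactM : {in G & G & udual, forall v w l, dact (v * w)%g l = dact v (dact w l)}.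
Proof.
move=> v w l Gv Gw ul.
apply: (Fdual_eq (dact_in (groupM Gv Gw) ul) (dact_in Gv (dact_in Gw ul))) => x ux.
by rewrite !dactE ?gact_anti_fixed ?groupV // invMg gactM ?groupV.
Qed.

Lemma gact1_in : {in u_, forall x, gact 1%g x = x}.
Proof. by move=> x _; rewrite gact1. Qed.

Lemma gactM_in : {in G & G & u_, forall v w x, gact (v * w)%g x = gact v (gact w x)}.
Proof. by move=> v w x Gv Gw _; rewrite gactM. Qed.

Lemma gactS_in : {in G & u_, forall v x, gact v x \in u_}.
Proof. by move=> v x; apply: gact_anti_fixed. Qed.

Lemma Pset_subG : Pgroup \subset G. Proof. by apply/subsetP=> v; apply: Pset_sub. Qed.

Lemma dactMP : {in Pgroup & Pgroup & udual, forall v w l,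
  dact (v * w)%g l = dact v (dact w l)}.
Proof. by move=> v w l Pv Pw; apply: dactM; apply: (subsetP Pset_subG). Qed.

Lemma dactSP : {in Pgroup & udual, forall v l, dact v l \in udual}.
Proof. by move=> v l Pv; apply: dact_in; apply: (subsetP Pset_subG). Qed.

Definition schar l (x : gT) : algC :=
  #|orb Pgroup dact l|%:R / #|orb G dact l|%:R
    * \sum_(m in orb G dact l) theta (m (f x)).

Lemma card_neq0 (K : {group gT}) : #|K|%:R != 0 :> algC.
Proof. exact: neq0CG. Qed.

Lemma card_orb_neq0 (K : {group gT}) (T : finType) (act : gT -> T -> T) t :
  #|orb K act t|%:R != 0 :> algC.
Proof.
rewrite pnatr_eq0 -lt0n; apply/card_gt0P; exists (act 1%g t).
by apply: imset_f.
Qed.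

(** An orbit sum is the orbit length times an average over [G], so the length in the denominator of
    [schar] cancels. *)
Lemma schar_sum l (x : gT) : l \in udual -> x \in U ->
  schar l x = #|orb Pgroup dact l|%:R / #|G|%:R
    * \sum_(v in G) theta (l (gact v (f x))).
Proof.
move=> ul Ux; have ufx := f_anti_fixed Ux.
have := orb_sum dact1 dactM dact_in (fun m => theta (m (f x))) ul.
rewrite (reindex_inj invg_inj) /=.
under eq_bigl => v do rewrite groupV.
under eq_bigr => v Gv do rewrite dactE // invgK.
move=> e; rewrite /schar -!mulrA; congr (_ * _).
have nG := card_neq0 G; have nO := card_orb_neq0 G dact l.
by rewrite -[in RHS](mulKf nO (\sum_(v in G) _)) [_ * \sum_(v in G) _]mulrC e mulrCA mulKf.
Qed.

Lemma ulphiV v : v \in G -> ulphi v^-1%g = invmx (ulphi v).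
Proof.
move=> Gv; have e : ulphi v *m ulphi v^-1%g = 1%:M.
  by rewrite -ulphiM ?groupV // mulgV ulphi1.
have [uv _] := mulmx1_unit e.
by rewrite -[LHS](mulKmx uv) e mulmx1.
Qed.

Lemma card_Pset : #|Pset|%:R = #|nbar L P|%:R * #|H|%:R :> algC.
Proof.
have := sum_Pset (fun=> 1); rewrite sumr_const => ->.
rewrite (eq_bigr (fun=> #|nbar L P|%:R)) => [|a _]; last by rewrite sumr_const.
by rewrite sumr_const card_H -[LHS]mulr_natr.
Qed.

(** * Right ideal supercharacters of C *)

Section RightIdeal.

Variables (l : {ffun matrix2n -> F}) (C : {group gT}).
Hypothesis hl : Flinear iota nalg l.
Hypothesis eC : C :=: Cset l.
Local Notation b := (calg l).
Local Notation hb := (calg_Fsubspace hl).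
Implicit Types m : {ffun 'M[L]_n -> F}.

Lemma C_sub_H : C \subset H.
Proof. by rewrite eC; apply/subsetP=> h; rewrite in_Cset => /andP[]. Qed.

Lemma C_sub_G : C \subset G. Proof. exact: subset_trans C_sub_H H_sub_G. Qed.

Lemma C_calg k : k \in C -> ulphi k - 1%:M \in b.
Proof. by rewrite eC in_Cset => /andP[]. Qed.

Lemma alg_of_H : alg_of [set ulphi v | v in H] = aalg.
Proof.
apply/setP=> a; apply/imsetP/idP=> [[_ /imsetP[v Hv ->] ->]|ga].
  by rewrite ulphi_in ?(subsetP H_sub_G).
exists (1%:M + a); last by rewrite addrC addKr.
by rewrite -ulphi_hel //; apply: imset_f; apply: hel_in.
Qed.

Lemma alg_of_C : alg_of [set ulphi v | v in C] = b.
Proof.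
apply/setP=> a; apply/imsetP/idP=> [[_ /imsetP[v Cv ->] ->]|ba].
  exact: C_calg.
have ga := calg_aalg ba; exists (1%:M + a); last by rewrite addrC addKr.
rewrite -ulphi_hel //; apply: imset_f.
by rewrite eC in_Cset hel_in //= ulphi_hel // addrC addKr.
Qed.

Lemma sum_calg (E : 'M[L]_n -> algC) :
  \sum_(a in b) E (1%:M + a) = \sum_(h in C) E (ulphi h).
Proof.
rewrite [RHS](reindex_onto hel (fun h => ulphi h - 1%:M)) /= => [|h Ch]; last first.
  by apply: hof_H; apply: (subsetP C_sub_H).
rewrite [RHS](eq_big (mem b) (fun a => E (1%:M + a))) // => a; last first.
  move=> /andP[_ /eqP ea]; congr E.
  by apply/eqP; rewrite [1%:M + a]addrC -subr_eq ea.
apply/andP/idP=> [[Ch /eqP ea]|ba]; first by have := C_calg Ch; rewrite ea.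
have ga := calg_aalg ba; rewrite eC in_Cset hel_in // ulphi_hel //.
by rewrite [1%:M + a]addrC addrK eqxx.
Qed.

Lemma card_C : #|C| = #|b|.
Proof.
apply/eqP; rewrite -(eqr_nat algC); apply/eqP.
by have := sum_calg (fun=> 1); rewrite !sumr_const => ->.
Qed.

Lemma calg_mulr x h : x \in b -> h \in H -> x *m ulphi h \in b.
Proof. by move=> bx Hh; rewrite (ulphi_calg (calg_aalg bx)). Qed.

Lemma calg_mull x h : x \in b -> h \in C -> ulphi h *m x \in b.
Proof.
move=> bx Ch; rewrite -[ulphi h](subrK 1%:M) mulmxDl mul1mx.
by rewrite (FsubspaceD hb) ?calgM ?C_calg ?(calg_aalg bx).
Qed.

(** [biact] acts through the inverse of [h], from the right; dropping the inverse gives a left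
    action with the same orbits. *)
Definition rract h m := restrict b (fun x => m (x *m ulphi h)).

Lemma rractE h m x : x \in b -> rract h m x = m (x *m ulphi h).
Proof. exact: restrictE. Qed.

Lemma rract_in : {in H & Fdual iota b, forall h m, rract h m \in Fdual iota b}.
Proof.
move=> h m Hh bm; have [mD mZ] := Fdual_linear bm.
apply: restrict_Fdual; first exact: hb.
split=> [x y bx byy|d x bx]; first by rewrite mulmxDl mD ?calg_mulr.
by rewrite -scalemxAl mZ ?calg_mulr.
Qed.

Lemma rract1 : {in Fdual iota b, forall m, rract 1%g m = m}.
Proof.
move=> m bm; apply: (Fdual_eq (rract_in (group1 H) bm) bm) => x bx.
by rewrite rractE // ulphi1 mulmx1.
Qed.

Lemma rractM : {in H & H & Fdual iota b, forall g h m,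
  rract (g * h)%g m = rract g (rract h m)}.
Proof.
move=> g h m Hg Hh bm.
apply: (Fdual_eq (rract_in (groupM Hg Hh) bm) (rract_in Hg (rract_in Hh bm))) => x bx.
by rewrite !rractE ?calg_mulr // ulphiM ?(subsetP H_sub_G) // mulmxA.
Qed.

(** The two-sided orbits become orbits of one group, the direct product of [C] and [H]. *)
Definition bact (ch : gT * gT) m :=
  restrict b (fun x => m (ulphi ch.1^-1%g *m x *m ulphi ch.2)).

Local Notation CH := (setX_group C H).

Lemma bact_closed (ch : gT * gT) x : ch \in CH -> x \in b ->
  ulphi ch.1^-1%g *m x *m ulphi ch.2 \in b.
Proof.
by rewrite inE => /andP[Cc Hh] bx; rewrite calg_mulr // calg_mull ?groupV.
Qed.

Lemma bact_in : {in CH & Fdual iota b, forall ch m, bact ch m \in Fdual iota b}.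
Proof.
move=> ch m CHch bm; have [mD mZ] := Fdual_linear bm.
apply: restrict_Fdual; first exact: hb.
split=> [x y bx byy|d x bx]; first by rewrite mulmxDr mulmxDl mD ?bact_closed.
by rewrite -scalemxAr -scalemxAl mZ ?bact_closed.
Qed.

Lemma bact1 : {in Fdual iota b, forall m, bact 1%g m = m}.
Proof.
move=> m bm; apply: (Fdual_eq (bact_in (group1 CH) bm) bm) => x bx.
by rewrite /bact restrictE //= invg1 ulphi1 mulmx1 mul1mx.
Qed.

Lemma bactM : {in CH & CH & Fdual iota b, forall g h m,
  bact (g * h)%g m = bact g (bact h m)}.
Proof.
move=> g h m CHg CHh bm.
apply: (Fdual_eq (bact_in (groupM CHg CHh) bm) (bact_in CHg (bact_in CHh bm))) => x bx.
rewrite /bact !restrictE ?bact_closed // -[(g * h)%g]/((g.1 * h.1)%g, (g.2 * h.2)%g) /=.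
have [Cg Hg] : g.1 \in C /\ g.2 \in H by move: CHg; rewrite inE => /andP[].
have [Ch Hh] : h.1 \in C /\ h.2 \in H by move: CHh; rewrite inE => /andP[].
rewrite invMg (ulphiM _ (groupVr (subsetP C_sub_G _ Cg))).
by rewrite (ulphiM _ (subsetP H_sub_G _ Hh)) !mulmxA.
Qed.

Definition phim m h : algC :=
  \sum_(h' in H) theta (m ((ulphi h - 1%:M) *m ulphi h')).

Local Notation superchar0 m :=
  (right_ideal_superchar theta [set ulphi v | v in H] [set ulphi v | v in C] m).

(** The orbit sum is a sum over [C] and [H] of terms in [c^-1 (k - 1) h]; with [h = c h'] this is
    [(k ^ c - 1) h']. *)
Lemma right_ideal_superchar_sum m k : m \in Fdual iota b -> k \in C ->
  superchar0 m (ulphi k) = #|orb H rract m|%:R / (#|C|%:R * #|H|%:R)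
    * \sum_(c in C) phim m (k ^ c)%g.
Proof.
move=> bm Ck; rewrite /right_ideal_superchar alg_of_C.
have sCG := subsetP C_sub_G; have sHG := subsetP H_sub_G.
have -> : [set biact b 1%:M h m | h in [set ulphi v | v in H]] = orb H rract m.
  apply/setP=> y; apply/imsetP/imsetP=> [[_ /imsetP[v Hv ->] ->]|[v Hv ->]].
    exists v^-1%g; rewrite ?groupV //; apply/ffunP=> x; rewrite !ffunE.
    by rewrite invmx1 mul1mx ulphiV ?sHG.
  exists (ulphi v^-1%g); first by apply: imset_f; rewrite groupV.
  by apply/ffunP=> x; rewrite !ffunE invmx1 mul1mx -ulphiV ?invgK // groupV sHG.
have -> : [set biact b g h m | g in [set ulphi v | v in C], h in [set ulphi v | v in H]]
    = orb CH bact m.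
  apply/setP=> y; apply/imset2P/imsetP.
    case=> _ _ /imsetP[c Cc ->] /imsetP[v Hv ->] ->; exists (c, v^-1%g).
      by rewrite inE /= Cc groupV.
    by apply/ffunP=> x; rewrite !ffunE /= (ulphiV (sCG _ Cc)) (ulphiV (sHG _ Hv)).
  case=> -[c v]; rewrite inE /= => /andP[Cc Hv] ->.
  exists (ulphi c) (ulphi v^-1%g); rewrite ?imset_f ?groupV //.
  apply/ffunP=> x; rewrite !ffunE /= -[invmx (ulphi v^-1%g)]ulphiV ?groupV ?sHG //.
  by rewrite invgK ulphiV ?sCG.
have := orb_sum bact1 bactM bact_in (fun y => theta (y (ulphi k - 1%:M))) bm.
set O := orb CH bact m; have nO : #|O|%:R != 0 :> algC.
  rewrite pnatr_eq0 -lt0n; apply/card_gt0P; exists m.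
  exact: (orb_refl CH bact1 bm).
have -> : \sum_(p in CH) theta (bact p m (ulphi k - 1%:M))
    = \sum_(c in C) phim m (k ^ c)%g.
  rewrite (eq_bigl (fun p => (p.1 \in C) && (p.2 \in H))) => [|p]; last by rewrite inE.
  rewrite -(pair_big (mem C) (mem H)
    (fun c h => theta (bact (c, h) m (ulphi k - 1%:M)))) /=.
  apply: eq_bigr => c Cc; rewrite /phim.
  rewrite [RHS](reindex_inj (mulgI c^-1%g)) /=.
  have Hc := subsetP C_sub_H _ Cc; apply: eq_big => [h|h Hh].
    by rewrite [RHS]groupMl ?groupV.
  rewrite /bact restrictE ?C_calg //=.
  have -> : ulphi (k ^ c)%g - 1%:M = ulphi c^-1%g *m (ulphi k - 1%:M) *m ulphi c.
    rewrite mulmxBr mulmx1 mulmxBl -!ulphiM ?groupV ?groupM ?sCG // mulVg ulphi1.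
    by rewrite conjgE mulgA.
  by rewrite -!mulmxA -ulphiM ?groupM ?groupV ?sHG // mulKVg.
rewrite cardsX natrM => e.
have [nC nH] := (card_neq0 C, card_neq0 H).
set D := \sum_(c in C) _ in e *; set T := \sum_(y in O) _ in e *.
have -> : T = D * #|O|%:R / (#|C|%:R * #|H|%:R).
  by rewrite e mulrC mulKf // mulf_neq0.
by field; rewrite nO nH nC.
Qed.

(** Trades the conjugation for a free left factor from [C]. As [C] is [1 + calg l], the sum over
    that factor is an additive character sum. *)
Lemma phim_conj_sum m k : m \in Fdual iota b -> k \in C ->
  \sum_(c in C) phim m (k ^ c)%g
  = \sum_(h in H) \sum_(c in C) theta (m (ulphi c *m (ulphi k - 1%:M) *m ulphi h)).
Proof.
move=> bm Ck; have sCG := subsetP C_sub_G; have sHG := subsetP H_sub_G.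
rewrite [RHS]exchange_big /= [RHS](reindex_inj invg_inj) /=.
apply: eq_big => [c|c Cc]; first by rewrite groupV.
have Hc := subsetP C_sub_H _ Cc.
rewrite /phim (reindex_inj (mulgI c^-1%g)) /=; apply: eq_big => [h|h].
  by rewrite groupMl ?groupV.
rewrite groupMl ?groupV // => Hh.
have -> : ulphi (k ^ c)%g - 1%:M = ulphi c^-1%g *m (ulphi k - 1%:M) *m ulphi c.
  rewrite mulmxBr mulmx1 mulmxBl -!ulphiM ?groupV ?groupM ?sCG // mulVg ulphi1.
  by rewrite conjgE mulgA.
by rewrite -!mulmxA -!ulphiM ?groupM ?groupV ?sHG // mulKVg.
Qed.

Lemma right_ideal_superchar_conj m : m \in Fdual iota b ->
  {in C &, forall x y : gT, superchar0 m (ulphi (x ^ y)%g) = superchar0 m (ulphi x)}.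
Proof.
move=> bm x y Cx Cy; rewrite !right_ideal_superchar_sum ?groupJ //; congr (_ * _).
rewrite [RHS](reindex_inj (mulgI y)) /=.
by apply: eq_big => [c|c _]; rewrite ?groupMl ?conjgM.
Qed.

(* The space spanned by the functions theta (mu (g - 1)) on B, mu in the orbit of
   m under A, is invariant under right translations, which permute these functions
   up to scalars; this gives a monomial representation. *)
Lemma right_ideal_superchar_char m : m \in Fdual iota b ->
  class_fun C (fun v => superchar0 m (ulphi v)) \is a character.
Proof.
move=> bm; have sCG := subsetP C_sub_G; have sHG := subsetP H_sub_G.
have sCH := subsetP C_sub_H.
have sO : {subset orb H rract m <= Fdual iota b}.
  exact: (subsetP (orb_sub rract_in bm)).
have [|||chi Nchi chiE] := @monomial_character _ C _ (orb H rract m) rract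
   (fun v t => theta (t (ulphi v - 1%:M))).
- move=> t Ot; have bt := sO t Ot; rewrite (rract1 bt) ulphi1 subrr.
  by rewrite (Flinear0 hb (Fdual_linear bt)) (theta0 htheta).
- move=> v t Cv /imsetP[h Hh ->]; rewrite -(rractM (sCH _ Cv) Hh bm).
  by apply: imset_f; rewrite (groupM (sCH _ Cv) Hh).
- move=> v w t Cv Cw Ot; have bt := sO t Ot; rewrite rractM ?sCH //; split=> //.
  rewrite rractE ?C_calg // ulphiM ?sCG // -(thetaD htheta).
  have [tD _] := Fdual_linear bt.
  rewrite -tD ?C_calg ?calg_mulr ?C_calg ?sCH // mulmxBl mul1mx.
  by congr (theta (t _)); rewrite [RHS]addrC addrA subrK.
suff -> : class_fun C (fun v => superchar0 m (ulphi v)) = chi by [].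
apply/cfun_inP=> k Ck; rewrite chiE // class_funE //; last first.
  exact: right_ideal_superchar_conj.
rewrite right_ideal_superchar_sum // phim_conj_sum // big_mkcondr.
set O := orb H rract m.
have := orb_sum rract1 rractM rract_in
  (fun t => if rract k t == t then theta (t (ulphi k - 1%:M)) else 0) bm.
rewrite -/O => e.
have nC := card_neq0 C; have nH := card_neq0 H.
suff -> : \sum_(h in H) \sum_(c in C) theta (m (ulphi c *m (ulphi k - 1%:M) *m ulphi h))
    = #|C|%:R * \sum_(h in H) (if rract k (rract h m) == rract h m
        then theta (rract h m (ulphi k - 1%:M)) else 0).
  apply: (mulfI nH); rewrite -e; set D := \sum_(h in H) _.
  by field; rewrite nH nC.
rewrite mulr_sumr; apply: eq_bigr => h Hh.
have [mD mZ] := Fdual_linear bm.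
have bk := calg_mulr (C_calg Ck) Hh.
(* Putting [c = 1 + x] separates a sum over [x] in [calg l] that is nonzero exactly when [k] fixes
   [rract h m], which is the condition for a diagonal entry in the monomial representation. *)
rewrite -(sum_calg (fun z => theta (m (z *m (ulphi k - 1%:M) *m ulphi h)))).
have bxk x : x \in b -> x *m (ulphi k - 1%:M) *m ulphi h \in b.
  by move=> bx; rewrite calg_mulr // calgM // (calg_aalg (C_calg Ck)).
rewrite (eq_bigr (fun x => theta (m ((ulphi k - 1%:M) *m ulphi h))
   * theta (m (x *m (ulphi k - 1%:M) *m ulphi h)))); last first.
  move=> x bx; rewrite -(thetaD htheta) -(mD _ _ bk (bxk _ bx)).
  by rewrite (mulmxDl 1%:M) mul1mx (mulmxDl (ulphi k - 1%:M)).
rewrite -mulr_sumr (sum_theta_linear htheta hb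
  (m := fun x => m (x *m (ulphi k - 1%:M) *m ulphi h))); last first.
  split=> [x y bx byy|d x bx]; first by rewrite !mulmxDl mD ?bxk.
  by rewrite -!scalemxAl mZ ?bxk.
rewrite rractE ?C_calg // -card_C mulrCA; congr (_ * _).
rewrite (_ : (rract k (rract h m) == rract h m)
  = [forall x in b, m (x *m (ulphi k - 1%:M) *m ulphi h) == 0]).
  by case: ifP; rewrite ?mulr1 ?mulr0.
have Hk := sCH _ Ck.
apply/eqP/forall_inP=> [e' x bx|e'].
  have := congr1 (fun t : {ffun 'M[L]_n -> F} => t x) e'.
  rewrite /= !rractE ?calg_mulr // => ex.
  rewrite mulmxBr mulmx1 mulmxBl (FlinearB hb (Fdual_linear bm)) ?calg_mulr //.
  by rewrite ex subrr.
apply: (Fdual_eq (rract_in (sCH _ Ck) (rract_in Hh bm)) (rract_in Hh bm)) => x bx.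
rewrite !rractE ?calg_mulr //.
apply/eqP; rewrite -subr_eq0 -(FlinearB hb (Fdual_linear bm)) ?calg_mulr //.
by rewrite -mulmxBl -{2}[x]mulmx1 -mulmxBr; apply: e'.
Qed.

End RightIdeal.

(** * The length of the P-orbit, and chi_l as an average over U *)

Section MainIdentity.

Variables (l : {ffun matrix2n -> F}) (C : {group gT}).
Hypothesis ul : l \in udual.
Hypothesis eC : C :=: Cset l.
Let hl : Flinear iota nalg l := udual_nalg ul.
Local Notation b := (calg l).
Local Notation m0 := (restrict b (nu l)).

Lemma restrict_nu_dual : m0 \in Fdual iota b.
Proof.
have [nD nZ] := nu_linear ul; apply: restrict_Fdual; first exact: calg_Fsubspace hl.
by split=> [x y bx byy|d x bx]; rewrite ?nD ?nZ ?(calg_aalg bx) // (calg_aalg byy).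
Qed.

Lemma restrict_nu_stable h : h \in H ->
  (rract l h m0 == m0) = [forall x in b, nu l (x *m ulphi h - x) == 0].
Proof.
move=> Hh; have bm := restrict_nu_dual; have aF := aalg_Fsubspace.
have sub x : x \in b -> nu l (x *m ulphi h - x) = nu l (x *m ulphi h) - nu l x.
  move=> bx; apply: (FlinearB aF (nu_linear ul)); last exact: calg_aalg bx.
  by apply: calg_aalg; apply: (calg_mulr hl).
apply/eqP/forall_inP=> [e x bx|e].
  have := congr1 (fun t : {ffun 'M[L]_n -> F} => t x) e.
  rewrite /= rractE // !restrictE ?(calg_mulr hl) // => ex.
  by rewrite sub // ex subrr.
apply: (Fdual_eq (rract_in hl Hh bm) bm) => x bx.
rewrite rractE // !restrictE ?(calg_mulr hl) //.
by apply/eqP; rewrite -subr_eq0 -sub //; apply: e.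
Qed.

(* Both orbits are counted through their stabilizers; that of P is computed by
   Fourier analysis on u. *)
Lemma card_Porbit : #|orb Pgroup dact l|%:R * #|C|%:R
  = #|orb H (rract l) m0|%:R * #|H|%:R :> algC.
Proof.
have bm := restrict_nu_dual; have [lD lZ] := Fdual_linear ul.
have uF := anti_fixed_Fsubspace; have aF := aalg_Fsubspace.
have nu_lin := nu_linear ul; have [nuD nuZ] := nu_lin.
have [nH nC] := (card_neq0 H, card_neq0 C).
have nP := card_neq0 Pgroup.
have nu0 : #|u_|%:R != 0 :> algC.
  by rewrite card_anti_fixed; apply: card_neq0.
have e1 := orb_stab (rract1 hl) (rractM hl) (rract_in hl) bm.
have e2 := orb_stab dact1 dactMP dactSP ul.
have stabE v : v \in Pset -> (dact v l == l)%:R * #|u_|%:R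
    = \sum_(x in u_) theta (l (gact v^-1%g x) - l x) :> algC.
  move=> Pv; have Gv : v \in G := Pset_sub Pv.
  rewrite (sum_theta_linear htheta uF (m := fun x => l (gact v^-1%g x) - l x)).
    rewrite mulrC; congr (_ * (nat_of_bool _)%:R).
    apply/eqP/forall_inP=> [e x ux|e].
      by rewrite -dactE // e subrr.
    apply: (Fdual_eq (dact_in Gv ul) ul) => x ux.
    by rewrite dactE //; apply/eqP; rewrite -subr_eq0; apply: e.
  have [gD gZ] := gact_functional_linear ul (groupVr Gv).
  split=> [x y ux uy|d x ux]; first by rewrite gD // lD // opprD addrACA.
  by rewrite gZ // lZ // mulrBr.
have stab_sum : (\sum_(v in Pset) (dact v l == l)%:R) * #|u_|%:R
    = #|nbar L P|%:R * #|nalg|%:R * #|C|%:R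
      * \sum_(h in H) (rract l h m0 == m0)%:R :> algC.
  rewrite mulr_suml; under eq_bigr => v Pv do rewrite stabE //.
  rewrite (reindex_inj invg_inj) /=.
  under eq_bigl => v do rewrite -[v^-1%g \in Pset]/(v^-1%g \in Pgroup) groupV.
  under eq_bigr => v _ do rewrite invgK.
  rewrite exchange_big /= sum_anti_fixed.
  (* The sum over [P] restricts [s] to [calg l], and [theta (l t)] cancels, so [t] contributes only
     a factor [#|nalg|]. The remaining sum over [s] tests whether [h] fixes [m0]. *)
  transitivity (\sum_(s in aalg) \sum_(t in nalg) (s \in b)%:R * (#|nbar L P|%:R
     * \sum_(h in H) theta (nu l (s *m ulphi h - s)))).
    apply: eq_bigr => s ga; apply: eq_bigr => t nt.
    under eq_bigr => v _ do rewrite thetaD //.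
    rewrite -mulr_suml.
    rewrite -[\sum_(v in _) _]/(\sum_(v in Pset) theta (l (gact v (ucomb s t)))).
    rewrite (sum_Pset_anti_fixed ul (ucomb_in ga nt)) ucomb_ul // ucomb_ur //.
    rewrite (functional_ucomb ul ga nt) opprD thetaD //.
    have e0 : theta (l t) * theta (- l t) = 1 by rewrite -thetaD // subrr theta0.
    have -> : \sum_(h in H) theta (nu l (s *m ulphi h - s))
        = (\sum_(h in H) theta (nu l (s *m ulphi h))) * theta (- nu l s).
      rewrite mulr_suml; apply: eq_bigr => h Hh; rewrite -(thetaD htheta).
      rewrite -(FlinearN nu_lin ga) -nuD ?(FsubspaceN aF) //.
      rewrite -[ulphi h](subrK 1%:M) mulmxDr mulmx1 (FsubspaceD aF) ?aalgM //.
      by rewrite ulphi_in ?(subsetP H_sub_G).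
    set S := \sum_(h in H) _; rewrite -[RHS]mulr1 -e0.
    by ring.
  transitivity (\sum_(s in b) (#|nalg|%:R * (#|nbar L P|%:R
     * \sum_(h in H) theta (nu l (s *m ulphi h - s))))).
    rewrite [RHS]big_mkcond [LHS]big_mkcond; apply: eq_bigr => s _.
    rewrite sumr_const; case: (boolP (s \in b)) => [bs|_].
      by rewrite (calg_aalg bs) /= mul1r [RHS]mulr_natl.
    by rewrite mul0r mul0rn if_same.
  rewrite -!mulr_sumr exchange_big /= mulrCA -!mulrA; congr (_ * (_ * _)).
  rewrite mulr_sumr; apply: eq_bigr => h Hh.
  rewrite (sum_theta_linear htheta (calg_Fsubspace hl)
    (m := fun s => nu l (s *m ulphi h - s))).
    by rewrite (card_C eC) restrict_nu_stable.
  have inA s : s \in b -> s *m ulphi h - s \in aalg.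
    move=> bs; apply: (FsubspaceB aF); last exact: calg_aalg bs.
    by apply: calg_aalg; apply: (calg_mulr hl).
  split=> [x y bx byy|d x bx].
    by rewrite mulmxDl opprD addrACA nuD ?inA.
  by rewrite -scalemxAl -scalerBr nuZ ?inA.
have cu : #|u_|%:R = #|nalg|%:R * #|H|%:R :> algC.
  by rewrite card_anti_fixed card_U card_N natrM.
have cP : #|Pgroup|%:R = #|nbar L P|%:R * #|H|%:R :> algC := card_Pset.
set A := \sum_(v in Pset) _ in stab_sum; set B := \sum_(h in H) _ in stab_sum.
have e1' : B * #|orb H (rract l) m0|%:R = #|H|%:R := e1.
have e2' : A * #|orb Pgroup dact l|%:R = #|Pgroup|%:R := e2.
have nA : A != 0.
  by apply: contraNneq nP => A0; rewrite -e2' A0 mul0r.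
apply: (mulfI nA); rewrite mulrA e2' cP.
have nn : #|nalg|%:R != 0 :> algC.
  by apply: contraNneq nu0; rewrite cu => ->; rewrite mul0r.
apply: (mulfI nn).
have -> : #|nalg|%:R * (A * (#|orb H (rract l) m0|%:R * #|H|%:R))
    = A * #|u_|%:R * #|orb H (rract l) m0|%:R.
  by rewrite cu !mulrA [#|nalg|%:R * A]mulrC mulrAC.
rewrite stab_sum -[_ * B * _]mulrA e1'.
by rewrite !mulrA [#|nbar L P|%:R * _]mulrC mulrAC.
Qed.

(* The function on U that induces chi_l, up to averaging over C. *)
Definition Ifun x := theta (l (f (divgr N H x)))
  * ((remgr N H x \in Cset l)%:R * phi0 l (remgr N H x)).

Lemma f_conj_gact (x w : gT) : x \in U -> w \in U -> f (x ^ w)%g = gact w^-1%g (f x).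
Proof.
move=> Ux Uw; have [Gx Gw] := (subsetP U_sub_G _ Ux, subsetP U_sub_G _ Uw).
by rewrite f_conj // gact_U ?groupV // invgK.
Qed.

Lemma schar_conj (x w : gT) : x \in U -> w \in U -> schar l (x ^ w)%g = schar l x.
Proof.
move=> Ux Uw; rewrite !schar_sum ?groupJ //; congr (_ * _).
have Gw := subsetP U_sub_G _ Uw.
rewrite f_conj_gact // [LHS](reindex_inj (mulIg w)) /=.
apply: eq_big => [v|v]; rewrite groupMr // => Gv.
by rewrite -gactM ?groupM ?groupV // mulgK.
Qed.

(** Along [G = P H] the sum over [G] becomes a sum of [Ifun] over conjugates by [H]. As [schar l] is
    invariant under [U], averaging it over [U] swallows these conjugations, and [card_Porbit]
    settles the constant. *)
Lemma schar_average (x : gT) : x \in U ->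
  schar l x = #|orb H (rract l) m0|%:R / (#|N|%:R * #|C|%:R * #|H|%:R)
    * \sum_(w in U) Ifun (x ^ w)%g.
Proof.
move=> Ux; have Gx := subsetP U_sub_G _ Ux.
have Phi y : y \in U -> \sum_(v in G) theta (l (gact v (f y)))
    = \sum_(h in H) #|nbar L P|%:R * Ifun (y ^ h)%g.
  move=> Uy; rewrite sum_G (reindex_inj invg_inj) /=.
  apply: eq_big => [h|h]; rewrite groupV // => Hh.
  have Uh := subsetP H_sub_U _ Hh.
  rewrite -sum_Pset_f ?groupJ //; apply: eq_bigr => v Pv.
  have [Gv Gh] := (Pset_sub Pv, subsetP H_sub_G _ Hh).
  by rewrite (gactM _ Gv (groupVr Gh)) -(f_conj_gact Uy Uh).
have e : #|U|%:R * schar l x = #|orb Pgroup dact l|%:R / #|G|%:R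
    * (#|nbar L P|%:R * (#|H|%:R * \sum_(w in U) Ifun (x ^ w)%g)).
  rewrite mulr_natl -sumr_const.
  under eq_bigr => w Uw do rewrite -(schar_conj Ux Uw) schar_sum ?groupJ // Phi ?groupJ //.
  rewrite -mulr_sumr; congr (_ * _); under eq_bigr => w Uw do rewrite -mulr_sumr.
  rewrite -mulr_sumr exchange_big /=; congr (_ * _).
  rewrite mulr_natl -sumr_const; apply: eq_bigr => h Hh.
  have Uh := subsetP H_sub_U _ Hh.
  rewrite [RHS](reindex_inj (mulIg h)) /=.
  by apply: eq_big => [w|w _]; rewrite ?groupMr ?conjgM.
have [nH nC] := (card_neq0 H, card_neq0 C).
have [nN nU] := (card_neq0 N, card_neq0 U).
have nG := card_neq0 G; have eP := card_Porbit.
have nb : #|nbar L P|%:R != 0 :> algC.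
  by apply: contraNneq nG; rewrite card_G card_Pset => ->; rewrite !mul0r.
apply: (mulfI nU); rewrite e card_G card_Pset card_U natrM.
have -> : #|orb H (rract l) m0|%:R = #|orb Pgroup dact l|%:R * #|C|%:R / #|H|%:R :> algC.
  by rewrite eP mulfK.
by field; rewrite nN nC nH nb.
Qed.

End MainIdentity.

(** * The linear characters psi of N and their stabilizers *)

Definition psil l : 'CF(N) := class_fun N (fun v => theta (l (f v))).

Lemma theta_fN_morph l : Flinear iota nalg l ->
  {in N &, {morph (fun v => theta (l (f v))) : v w / (v * w)%g >-> v * w}}.
Proof.
move=> [lD lZ] v w Nv Nw; rewrite !f_N ?groupM //; rewrite !in_N in Nv Nw.
rewrite -(thetaD htheta) -lD // mxM pattern_mul.
have [_ [b1 ->]] := nbarP _ (nalg_nbar Nv); have [_ [b2 ->]] := nbarP _ (nalg_nbar Nw).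
by rewrite mulmx_block !mulmx0 !mul0mx !addr0 block_mx0 add0r.
Qed.

Lemma theta_fN_conj l : Flinear iota nalg l ->
  {in N &, forall v w, theta (l (f (v ^ w)%g)) = theta (l (f v))}.
Proof.
move=> hl v w Nv Nw; have M := theta_fN_morph hl.
rewrite conjgE !M ?groupM ?groupV // mulrCA -M ?groupV // mulVg.
rewrite (f_N (group1 N)) mx1 subrr (Flinear0 nalg_Fsubspace hl) (theta0 htheta).
by rewrite mulr1.
Qed.

Definition chi l : 'CF(U) := class_fun U (schar l).

Lemma chiE l v : l \in udual -> v \in U -> chi l v = schar l v.
Proof.
by move=> ul Uv; rewrite class_funE // => x y Ux Uy; apply: schar_conj.
Qed.

Lemma psilE l : Flinear iota nalg l -> {in N, forall m, psil l m = theta (l (f m))}.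
Proof.
move=> hl m Nm; rewrite class_funE // => v w Nv Nw.
exact: theta_fN_conj.
Qed.

Lemma psilM l : Flinear iota nalg l ->
  {in N &, {morph psil l : v w / (v * w)%g >-> v * w}}.
Proof. by move=> hl v w Nv Nw; rewrite /= !psilE ?groupM //; apply: theta_fN_morph. Qed.

Lemma psil1 l : Flinear iota nalg l -> psil l 1%g = 1.
Proof.
move=> hl; rewrite psilE // (f_N (group1 N)) mx1 subrr.
by rewrite (Flinear0 nalg_Fsubspace hl) (theta0 htheta).
Qed.

Lemma nbar_gact v y : v \in U -> y \in nbar L P -> gact v y \in nbar L P.
Proof.
move=> Uv ny; have Gv := subsetP U_sub_G _ Uv.
by rewrite gact_U // nbar_mulr ?groupV // nbar_mull.
Qed.

Lemma nalg_f v : v \in N -> f v \in nalg.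
Proof. by move=> Nv; rewrite f_N // -in_N. Qed.

Lemma fN_onto t : t \in nalg -> exists2 m, m \in N & f m = t.
Proof.
move=> nt; have gx := anti_fixed_pattern (nalg_anti_fixed nt).
have e : mx (gl_of (1%:M + t)) - 1%:M = t by rewrite gl_ofE // addrC addKr.
have Nm : gl_of (1%:M + t) \in N by rewrite in_N e.
by exists (gl_of (1%:M + t)) => //; rewrite f_N.
Qed.

(** [theta] need not be injective, but the values of a nonzero linear form fill [F], and [theta] is
    nontrivial there. *)
Lemma theta_eq1 (r : nat) (V : {set 'M[L]_r}) (m : 'M[L]_r -> F) :
  Fsubspace iota V -> Flinear iota V m ->
  {in V, forall x, theta (m x) = 1} -> {in V, forall x, m x = 0}.
Proof.
move=> hV hm m1 x Vx; have := sum_theta_linear htheta hV hm.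
rewrite (eq_bigr (fun=> 1)) // sumr_const; case: forall_inP => [m0 _|_].
  by apply/eqP/m0.
rewrite mulr0 => /eqP; rewrite pnatr_eq0 cards_eq0 => /eqP V0.
by rewrite V0 inE in Vx.
Qed.

Lemma psil_stabP l k : Flinear iota nalg l -> k \in U ->
  reflect {in N, forall m, psil l (m ^ k)%g = psil l m}
          [forall t in nalg, l (gact k^-1%g t) == l t].
Proof.
move=> hl Uk; have NJ m : m \in N -> (m ^ k)%g \in N.
  by move=> Nm; rewrite memJ_norm // (subsetP U_norm_N).
have sNU := subsetP N_sub_U.
apply: (iffP forall_inP) => [inv m Nm|inv t nt].
  by rewrite !psilE ?NJ // (f_conj_gact (sNU _ Nm) Uk) (eqP (inv _ (nalg_f Nm))).
rewrite -subr_eq0; apply/eqP.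
apply: (theta_eq1 (V := nalg) (m := fun t => l (gact k^-1%g t) - l t)) => //.
- exact: nalg_Fsubspace.
- have [lD lZ] := hl; have ga z : z \in nalg -> gact k^-1%g z \in nalg.
    by move=> nz; rewrite gact_nalg ?groupV.
  split=> [x y nx ny|d x nx].
    by rewrite gactD !lD ?ga // opprD addrACA.
  by rewrite gactZ !lZ ?ga // mulrBr.
move=> z /fN_onto[m Nm <-]; have := inv m Nm.
rewrite !psilE ?NJ // (f_conj_gact (sNU _ Nm) Uk) => e.
by rewrite (thetaD htheta) e (thetaN htheta) mulfV ?(theta_neq0 htheta).
Qed.

(** Conjugation by [k] multiplies by [k^-1] on the left and by [k] on the right; [bar l], which
    agrees with [l] on [nalg], is invariant under both. *)
Lemma Cset_psil l k : Flinear iota nalg l -> k \in Cset l ->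
  {in N, forall m, psil l (m ^ k)%g = psil l m}.
Proof.
move=> hl Ck; have Hk : k \in H by move: Ck; rewrite in_Cset => /andP[].
have Uk := subsetP H_sub_U _ Hk; apply/(psil_stabP hl Uk)/forall_inP=> t nt.
have nbt := nalg_nbar nt; have Hkv := groupVr Hk; have Gk := subsetP U_sub_G _ Uk.
have Ckv : k^-1%g \in Cset l by apply: (@groupVr _ (Group (Cset_group_set hl))).
rewrite -!(bar_nalg hl) ?gact_nalg ?groupV // gact_U ?groupV // invgK -mulmxA.
rewrite (Cset_left_invariant hl Hkv Ckv) ?nbar_mulr //.
by rewrite (bar_right_invariant hl Ck).
Qed.

(** * The main identity, with an intermediate group I between C and H *)

Section Identity.

Variables (l : {ffun matrix2n -> F}) (C I : {group gT}).
Hypothesis ul : l \in udual.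
Hypothesis eC : C :=: Cset l.
Hypothesis sCI : C \subset I.
Hypothesis sIH : I \subset H.
Hypothesis psiI : {in I & N, forall k m, psil l (m ^ k)%g = psil l m}.
Let hl : Flinear iota nalg l := udual_nalg ul.
Local Notation m0 := (restrict (calg l) (nu l)).
Local Notation X := (class_fun C (fun v =>
  right_ideal_superchar theta [set ulphi v | v in H] [set ulphi v | v in C] m0
    (ulphi v))).

(** The indicator makes the formula valid for every [h], as [sdprod_fun] also evaluates the
    character outside [C]. *)
Lemma superchar0_average h : X h = #|orb H (rract l) m0|%:R / (#|C|%:R * #|H|%:R)
  * \sum_(k in C) ((h ^ k)%g \in Cset l)%:R * phi0 l (h ^ k)%g.
Proof.
have bm := restrict_nu_dual ul; have [Ch|nCh] := boolP (h \in C).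
  rewrite class_funE //; last exact: (right_ideal_superchar_conj hl eC bm).
  rewrite (right_ideal_superchar_sum hl eC bm) //; congr (_ * _).
  apply: eq_bigr => k Ck; have Chk : (h ^ k)%g \in C by rewrite groupJ.
  rewrite -eC Chk mul1r; apply: eq_bigr => h' Hh'.
  by rewrite restrictE // (calg_mulr hl) // (C_calg eC).
rewrite cfun0 // big1 ?mulr0 // => k Ck.
by rewrite -eC groupJr // (negPf nCh) mul0r.
Qed.

Lemma sdprod_ind_superchar : sdprod_ind U (psil l) ('Ind[I, C] X) = chi l.
Proof.
have nCI := (card_neq0 C, card_neq0 I).
have [nN nH] := (card_neq0 N, card_neq0 H).
have psiC : {in C & N, forall k m, psil l (m ^ k)%g = psil l m}.
  by move=> k m Ck; apply: psiI; apply: (subsetP sCI).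
apply/cfun_inP=> x Ux; rewrite chiE // (schar_average ul eC) // -/hl.
rewrite (sdprod_ind_sum U_sdprod sIH (psilM hl) (psil1 hl) psiI) //.
(* Induction to [I] is an average over [I], which the sum over [U] absorbs; the same is done next
   for the average over [C]. *)
have -> : \sum_(w in U) sdprod_fun H (psil l) ('Ind[I, C] X) (x ^ w)%g
    = #|C|%:R^-1 * (#|I|%:R * \sum_(w in U) sdprod_fun H (psil l) X (x ^ w)%g).
  rewrite -(sdprod_fun_average U_sdprod sIH psiI _ Ux) mulr_sumr.
  by apply: eq_bigr => w _; rewrite /sdprod_fun cfIndE // mulrCA.
have -> : \sum_(w in U) sdprod_fun H (psil l) X (x ^ w)%g
    = #|orb H (rract l) m0|%:R / (#|C|%:R * #|H|%:R)
      * (#|C|%:R * \sum_(w in U) Ifun l (x ^ w)%g).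
  have sCH := subset_trans sCI sIH.
  have -> : \sum_(w in U) Ifun l (x ^ w)%g = \sum_(w in U) sdprod_fun H (psil l)
      (fun h => (h \in Cset l)%:R * phi0 l h) (x ^ w)%g.
    apply: eq_bigr => w Uw; rewrite /sdprod_fun psilE //.
    by have [] := sdprod_split U_sdprod (groupJ Ux Uw).
  rewrite -(sdprod_fun_average U_sdprod sCH psiC _ Ux) mulr_sumr.
  by apply: eq_bigr => w _; rewrite /sdprod_fun superchar0_average mulrCA.
by field; rewrite nN nH !nCI.
Qed.

End Identity.

Lemma chi_character : {in udual, forall l, chi l \is a character}.
Proof.
move=> l ul; have hl := udual_nalg ul.
pose C := Group (Cset_group_set hl); have eC : C :=: Cset l by [].
have psiC : {in C & N, forall k m, psil l (m ^ k)%g = psil l m}.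
  by move=> k m Ck; apply: Cset_psil.
(* The choice [I = C] reduces the claim to right ideal supercharacters. *)
rewrite -(sdprod_ind_superchar ul eC (subxx C) (C_sub_H eC) psiC).
apply: (sdprod_ind_char U_sdprod (C_sub_H eC) (psilM hl) (psil1 hl) psiC).
apply/cfInd_char/(right_ideal_superchar_char hl eC).
exact: restrict_nu_dual.
Qed.

(** * The theory with supercharacters chi_l *)

Section OrbitTheory.

Lemma sum_schar l m : l \in udual -> m \in udual ->
  \sum_(v in U) theta (l (f v)) * (theta (m (f v)))^* = #|U|%:R * (l == m)%:R.
Proof.
move=> ul um; have [lD lZ] := Fdual_linear ul; have [mD mZ] := Fdual_linear um.
have uF := anti_fixed_Fsubspace.
under eq_bigr => v _ do rewrite -(thetaN_conj htheta) -(thetaD htheta).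
rewrite (sum_U_f (fun x => theta (l x - m x))).
rewrite (sum_theta_linear htheta uF (m := fun x => l x - m x)).
  rewrite card_anti_fixed; congr (_ * (nat_of_bool _)%:R).
  apply/forall_inP/eqP=> [e|-> x _]; last by rewrite subrr.
  by apply: (Fdual_eq ul um) => x ux; apply/eqP; rewrite -subr_eq0; apply: e.
split=> [x y ux uy|d x ux]; first by rewrite lD ?mD // opprD addrACA.
by rewrite lZ ?mZ // mulrBr.
Qed.

Local Notation orbG := (orb G dact).

Lemma cfdot_chi l m : l \in udual -> m \in udual -> m \notin orbG l ->
  '[chi l, chi m] = 0.
Proof.
move=> ul um nlm; rewrite cfdotE; apply/eqP; rewrite mulf_eq0; apply/orP; right.
have sl := subsetP (orb_sub dact_in ul); have sm := subsetP (orb_sub dact_in um).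
rewrite (eq_bigr (fun v => (#|orb Pgroup dact l|%:R / #|orbG l|%:R)
   * (#|orb Pgroup dact m|%:R / #|orbG m|%:R)^*
   * \sum_(l' in orbG l) \sum_(m' in orbG m) theta (l' (f v)) * (theta (m' (f v)))^*)).
  rewrite -mulr_sumr exchange_big big1 /= ?mulr0 // => l' Ol.
  rewrite exchange_big big1 //= => m' Om.
  rewrite (sum_schar (sl _ Ol) (sm _ Om)); case: (l' =P m') => [e|_]; last by rewrite mulr0.
  case/negP: nlm; rewrite -(orb_eq dactM ul Ol) e (orb_eq dactM um Om).
  exact: (orb_refl G dact1 um).
move=> v Uv; rewrite !chiE // /schar rmorphM rmorph_sum /= mulrACA; congr (_ * _).
by rewrite mulr_suml; apply: eq_bigr => l' _; rewrite mulr_sumr.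
Qed.

(** Only the factor [#|orb Pgroup dact l|] needs an argument: [P] is normal in [G], so [dact w]
    carries the [P]-orbit of [l] bijectively to that of [m]. *)
Lemma chi_orbit l m : l \in udual -> m \in orbG l -> chi m = chi l.
Proof.
move=> ul Om; have um := subsetP (orb_sub dact_in ul) _ Om.
apply/cfun_inP=> v Uv; rewrite !chiE // !schar_sum //.
have /imsetP[w Gw em] := Om.
have -> : #|orb Pgroup dact m| = #|orb Pgroup dact l|.
  have Gwv := groupVr Gw.
  have sP := subsetP Pset_subG.
  have conjP p : p \in Pgroup -> (p ^ w)%g \in Pgroup.
    rewrite ![_ \in Pgroup]PsetE => /andP[Gp /eqP p1]; rewrite groupJ //=.
    rewrite conjgE !ulphiM ?groupM // p1 mul1mx -ulphiM // mulVg.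
    by rewrite ulphi1.
  have conjPV p : p \in Pgroup -> (p ^ w^-1)%g \in Pgroup.
    rewrite ![_ \in Pgroup]PsetE => /andP[Gp /eqP p1]; rewrite groupJ //=.
    rewrite conjgE !ulphiM ?groupM ?groupV // p1 mul1mx -ulphiM ?groupV // mulVg.
    by rewrite ulphi1.
  have -> : orb Pgroup dact m = [set dact w y | y in orb Pgroup dact l].
    apply/setP=> y; apply/imsetP/imsetP=> [[p Pp ->]|[_ /imsetP[p Pp ->] ->]].
      exists (dact (p ^ w)%g l); first by apply: imset_f; apply: conjP.
      have Gp := sP _ Pp; rewrite em -!dactM ?groupJ //.
      by rewrite conjgE mulgA mulgA mulgV mul1g.
    exists (p ^ w^-1)%g; first exact: conjPV.
    have Gp := sP _ Pp; rewrite em -!dactM ?groupJ //.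
    by rewrite conjgE invgK -!mulgA mulVg mulg1.
  rewrite card_in_imset // => y z /imsetP[p Pp ->] /imsetP[p' Pp' ->] e.
  have [Gp Gp'] := (sP _ Pp, sP _ Pp').
  have := congr1 (dact w^-1%g) e.
  rewrite -(dactM (groupVr Gw) Gw (dact_in Gp ul)).
  by rewrite -(dactM (groupVr Gw) Gw (dact_in Gp' ul)) mulVg !dact1 ?dact_in.
congr (_ * _); rewrite [RHS](reindex_inj (mulgI w^-1%g)) /=.
apply: eq_big => [x|x Gx]; first by rewrite groupMl ?groupV.
have ufv := f_anti_fixed Uv.
rewrite em dactE ?gact_anti_fixed // -gactM ?groupV //.
Qed.

(** The value at 1 is the length of the [P]-orbit of [l]. *)
Lemma chi1_neq0 l : l \in udual -> chi l != 0.
Proof.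
move=> ul; apply/eqP=> /cfunP/(_ 1%g); rewrite cfunE chiE // schar_sum //.
have f1 : f 1%g = 0 by rewrite (f_N (group1 N)) mx1 subrr.
have -> : \sum_(v in G) theta (l (gact v (f 1%g))) = #|G|%:R.
  rewrite -sumr_const; apply: eq_bigr => v _; rewrite f1 /gact mulmx0 mul0mx.
  by rewrite (Flinear0 anti_fixed_Fsubspace (Fdual_linear ul)) (theta0 htheta).
rewrite divfK ?card_neq0 // => /eqP.
by rewrite (negPf (card_orb_neq0 _ _ _)).
Qed.

Lemma chi_eq l m : l \in udual -> m \in udual -> (chi l == chi m) = (m \in orbG l).
Proof.
move=> ul um; apply/eqP/idP=> [e|/(chi_orbit ul)-> //].
apply: contraT => /(cfdot_chi ul um); rewrite e => /eqP.
by rewrite cfnorm_eq0 (negPf (chi1_neq0 um)).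
Qed.

Lemma constt_chi_exists i : exists2 l, l \in udual & i \in irr_constt (chi l).
Proof.
have [/exists_inP[l ul il]|none] :=
    boolP [exists l in udual, i \in irr_constt (chi l)]; first by exists l.
(* These coefficients cancel the weights in [schar_sum]. The sum over all [l] then detects
   [f v = 0], which by injectivity of [f] means [v = 1]. *)
have sumE : cfReg U = \sum_(l in udual) (#|orb Pgroup dact l|%:R)^-1 *: chi l.
  apply/cfun_inP=> v Uv; rewrite cfRegE sum_cfunE.
  have ufv := f_anti_fixed Uv.
  rewrite (eq_bigr (fun l => #|G|%:R^-1 * \sum_(w in G) theta (l (gact w (f v))))).
    rewrite -mulr_sumr exchange_big /=.
    rewrite (eq_bigr (fun=> #|U|%:R * (f v == 0)%:R)) => [|w Gw]; last first.
      rewrite (sum_theta_dual htheta anti_fixed_Fsubspace) ?gact_anti_fixed //.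
      rewrite card_anti_fixed; congr (_ * (nat_of_bool _)%:R).
      apply/eqP/eqP=> [e|->]; last by rewrite /gact mulmx0 mul0mx.
      rewrite -[f v]gact1 -(mulVg w) gactM ?groupV // e.
      by rewrite /gact mulmx0 mul0mx.
    rewrite sumr_const -[X in _ * X]mulr_natl mulKf ?card_neq0 //.
    have f1 : f 1%g = 0 by rewrite (f_N (group1 N)) mx1 subrr.
    have -> : (f v == 0) = (v == 1%g).
      apply/eqP/eqP=> [e|->]; last exact: f1.
      by apply: f_inj; rewrite ?group1 // f1.
    by rewrite mulr_natr.
  move=> l ul; rewrite cfunE chiE // schar_sum // mulrA mulrA mulVf ?mul1r //.
  exact: card_orb_neq0.
have : '[cfReg U, 'chi_i] != 0.
  rewrite cfReg_sum cfdot_suml (bigD1 i) //= big1 => [|j ji]; last first.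
    by rewrite cfdotZl cfdot_irr (negPf ji) mulr0.
  by rewrite cfdotZl cfdot_irr eqxx mulr1 addr0 irr1_neq0.
rewrite sumE cfdot_suml big1 ?eqxx // => l ul; rewrite cfdotZl.
move/exists_inPn: none => /(_ l ul); rewrite irr_consttE negbK => /eqP->.
by rewrite mulr0.
Qed.

Lemma constt_chi_unique i l m : l \in udual -> m \in udual ->
  i \in irr_constt (chi l) -> i \in irr_constt (chi m) -> chi l = chi m.
Proof.
move=> ul um il im; apply/eqP; rewrite chi_eq //; apply: contraT => nlm.
have := constt_ortho_char (chi_character ul) (chi_character um) il im (cfdot_chi ul um nlm).
by move/eqP; rewrite cfdot_irr eqxx oner_eq0.
Qed.

Definition kclass v : {set gT} := [set w in U | f w \in orb G gact (f v)].

Lemma kclass_partition : partition [set kclass v | v in U] U.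
Proof.
have -> : [set kclass v | v in U] = preim_partition (fun v => orb G gact (f v)) U.
  apply/setP=> B; apply/imsetP/imsetP=> [[v Uv ->]|[v Uv ->]]; exists v => //.
    apply/setP=> w; rewrite !inE; apply: andb_id2l => Uw.
    have [ufv ufw] := (f_anti_fixed Uv, f_anti_fixed Uw).
    apply/idP/eqP=> [/(orb_eq gactM_in ufv)-> //|->].
    exact: (orb_refl G gact1_in ufw).
  apply/setP=> w; rewrite !inE; apply: andb_id2l => Uw.
  have [ufv ufw] := (f_anti_fixed Uv, f_anti_fixed Uw).
  apply/eqP/idP=> [->|/(orb_eq gactM_in ufv)-> //].
  exact: (orb_refl G gact1_in ufw).
exact: preim_partitionP.
Qed.

Lemma kclass_card : #|[set kclass v | v in U]| = #|[set orb G gact x | x in u_]|.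
Proof.
have -> : [set kclass v | v in U]
    = [set [set w in U | f w \in O] | O : {set matrix2n} in [set orb G gact x | x in u_]].
  apply/setP=> B; apply/imsetP/imsetP=> [[v Uv ->]|[_ /imsetP[x ux ->] ->]].
    by exists (orb G gact (f v)); rewrite ?imset_f ?f_anti_fixed.
  move: ux; rewrite -f_U => /imsetP[v Uv ->]; by exists v.
apply: card_in_imset => _ _ /imsetP[x ux ->] /imsetP[y uy ->] /setP e.
move: (ux); rewrite -f_U => /imsetP[v Uv ev].
have := e v; rewrite !inE Uv -ev (orb_refl G gact1_in ux) => /esym.
by move/(orb_eq gactM_in uy).
Qed.

(* Burnside's lemma, with #|fixed points| equal on u and on its dual. *)
Lemma card_dual_orbits :
  #|[set orbG l | l in udual]| = #|[set orb G gact x | x in u_]|.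
Proof.
apply/eqP; rewrite -(eqr_nat algC); apply/eqP.
apply: (mulIf (card_neq0 G)).
rewrite (card_orbits dact1 dactM dact_in) (card_orbits gact1_in gactM_in gactS_in).
have uF := anti_fixed_Fsubspace.
have nu0 : #|u_|%:R != 0 :> algC by rewrite card_anti_fixed card_neq0.
rewrite [RHS](reindex_inj invg_inj) /=; apply: eq_big => v; first by rewrite groupV.
move=> Gv; have Gvv := groupVr Gv; apply: (mulfI nu0).
(* Summed over [x] first, this counts the functionals fixed by [v]; summed over [l] first, the
   points fixed by [v^-1]. Hence the reindexing by inversion above. *)
transitivity (\sum_(l in udual) \sum_(x in u_) theta (l (gact v^-1%g x - x))).
  rewrite mulr_sumr; apply: eq_bigr => l ul; have [lD lZ] := Fdual_linear ul.
  have lB := FlinearB uF (Fdual_linear ul).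
  have [gD gZ] := gact_functional_linear ul Gvv.
  rewrite (sum_theta_linear htheta uF (m := fun x => l (gact v^-1%g x - x))).
    congr (_ * (nat_of_bool _)%:R).
    apply/eqP/forall_inP=> [e x ux|e].
      by rewrite lB ?gact_anti_fixed // -dactE // e subrr.
    apply: (Fdual_eq (dact_in Gv ul) ul) => x ux.
    rewrite dactE //; apply/eqP; rewrite -subr_eq0 -lB ?gact_anti_fixed //.
    exact: e.
  split=> [x y ux uy|d x ux].
    by rewrite !lB ?gact_anti_fixed ?(FsubspaceD uF) // gD // lD // opprD addrACA.
  by rewrite !lB ?gact_anti_fixed ?(FsubspaceZ uF) // gZ // lZ // mulrBr.
rewrite exchange_big mulr_sumr /=; apply: eq_bigr => x ux.
rewrite (sum_theta_dual htheta uF) ?subr_eq0 //.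
by rewrite (FsubspaceB uF) ?gact_anti_fixed.
Qed.

Lemma orbit_supercharacter_theory : supercharacter_theory
  ([set kclass v | v in U], [seq chi l | l in udual]).
Proof.
have memX xi : (xi \in [seq chi l | l in udual]) -> exists2 l, l \in udual & xi = chi l.
  by case/imageP=> l ul ->; exists l.
split.
- split; first exact: kclass_partition.
  move=> _ x /imsetP[v Uv ->]; rewrite [x \in _]inE => /andP[Ux fx].
  apply/subsetP=> _ /imsetP[w Uw ->]; rewrite inE groupJ //.
  have [ufv ufx] := (f_anti_fixed Uv, f_anti_fixed Ux).
  rewrite -(orb_eq gactM_in ufv fx) f_conj_gact //; apply: imset_f.
  by rewrite groupV (subsetP U_sub_G).
- split; first by move=> _ /memX[l ul ->]; apply: chi_character.
  by apply/negP=> /memX[l ul e0]; have := chi1_neq0 ul; rewrite -e0 eqxx.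
- rewrite kclass_card -card_dual_orbits.
  (* [chi] is constant on orbits and separates them, so [rep] is injective on orbits; these are
     nonempty, so the default 0 is never taken. *)
  pose rep (O : {set {ffun matrix2n -> F}}) := if [pick l in O] is Some l then chi l else 0.
  have repE l : l \in udual -> rep (orbG l) = chi l.
    move=> ul; rewrite /rep; case: pickP => [m /(chi_orbit ul) //|/(_ l)].
    by rewrite (orb_refl G dact1 ul).
  have -> : #|[set orbG l | l in udual]|
      = size (map rep (enum [set orbG l | l in udual])).
    by rewrite size_map -cardE.
  apply/perm_size/uniq_perm.
  - exact: undup_uniq.
  - rewrite map_inj_in_uniq ?enum_uniq // => O O'; rewrite !mem_enum.
    case/imsetP=> l ul -> /imsetP[m um ->]; rewrite !repE // => e.
    have : m \in orbG l by rewrite -chi_eq // e.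
    by move/(orb_eq dactM ul).
  move=> xi; rewrite mem_undup; apply/idP/mapP=> [/memX[l ul ->]|[O]].
    by exists (orbG l); rewrite ?repE // mem_enum; apply: imset_f.
  by rewrite mem_enum => /imsetP[l ul ->] ->; rewrite repE //; apply: image_f.
- move=> _ _ /imsetP[v Uv ->] /memX[l ul ->] x y.
  rewrite !inE => /andP[Ux fx] /andP[Uy fy]; have ufv := f_anti_fixed Uv.
  have const z : z \in U -> f z \in orb G gact (f v) -> chi l z = chi l v.
    move=> Uz /imsetP[w Gw ew]; rewrite !chiE // !schar_sum //; congr (_ * _).
    rewrite [RHS](reindex_inj (mulIg w)) /=.
    by apply: eq_big => [g'|g' Gg]; rewrite ?groupMr // ew gactM.
  by rewrite !const.
move=> i; set s := [seq _ <- _ | _].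
have us : uniq s by rewrite filter_uniq ?undup_uniq.
have [l ul il] := constt_chi_exists i.
have ls : chi l \in s by rewrite mem_filter il mem_undup; apply: image_f.
have : s =i [:: chi l].
  move=> xi; rewrite inE; apply/idP/eqP=> [|-> //].
  rewrite mem_filter mem_undup => /andP[ix /memX[m um ex]].
  by rewrite ex in ix *; apply: (constt_chi_unique (i := i)).
by move=> e; have /perm_size -> := uniq_perm us (isT : uniq [:: chi l]) e.
Qed.

End OrbitTheory.

(** * The groups H_psi: membership in the lattice and normality *)

Lemma bar_eq l l' : {in nalg, l =1 l'} -> bar l = bar l'.
Proof.
move=> e; apply/ffunP=> y; rewrite !ffunE; case: ifPn => // ny.
by rewrite e ?sub_dag_nalg.
Qed.

Lemma calg_eq l l' : {in nalg, l =1 l'} -> calg l = calg l'.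
Proof. by move=> e; rewrite /calg (bar_eq e). Qed.

Lemma psil_eq l l' : Flinear iota nalg l -> Flinear iota nalg l' ->
  {in nalg, l =1 l'} -> psil l = psil l'.
Proof. by move=> hl hl' e; apply/cfun_inP=> m Nm; rewrite !psilE // e ?nalg_f. Qed.

Lemma Cset_stabilizer l h : Flinear iota nalg l -> h \in H -> (h \in Cset l)
  = (restrict (nbar L P) (fun y => bar l (invmx (mx h) *m y)) == bar l).
Proof.
move=> hl Hh; have Hhv := groupVr Hh; have Ghv := subsetP H_sub_G _ Hhv.
rewrite -mxV -[LHS](@groupV _ (Group (Cset_group_set hl))).
apply/(Cset_left_invariant hl Hhv)/eqP=> [inv|e y ny].
  apply/ffunP=> y; rewrite ffunE; case: ifPn => [ny|nny]; first exact: inv.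
  by rewrite restrict_out.
have := congr1 (fun t : {ffun matrix2n -> F} => t y) e.
by rewrite /= restrictE.
Qed.

Lemma Cset_right_ideal l (C : {group gT}) : Flinear iota nalg l -> C :=: Cset l ->
  right_ideal iota (alg_of [set ulphi v | v in C]) (alg_of [set ulphi v | v in H]).
Proof.
move=> hl eC; rewrite (alg_of_C eC) alg_of_H; split; first exact: calg_Fsubspace.
- by apply/subsetP=> x; apply: calg_aalg.
by move=> x a cx ga; apply: calgM.
Qed.

Lemma mem_inertia_psil l k : Flinear iota nalg l ->
  k \in 'I_H[psil l] ->
  k \in H /\ {in N, forall m, psil l (m ^ k)%g = psil l m}.
Proof.
move=> hl /setIP[Hk]; rewrite inE => /andP[nk /eqP e]; split=> // m Nm.
by rewrite -{1}e cfConjgE // conjgK.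
Qed.

Lemma Cset_sub_inertia l (C : {group gT}) : Flinear iota nalg l -> C :=: Cset l ->
  C \subset 'I_H[psil l].
Proof.
move=> hl eC; apply/subsetP=> k Ck; have Hk := subsetP (C_sub_H eC) _ Ck.
have nk : k \in 'N(N) by rewrite (subsetP U_norm_N) ?(subsetP H_sub_U).
rewrite inE Hk inE nk; apply/eqP/cfun_inP=> m Nm; rewrite cfConjgE //.
by apply: Cset_psil; rewrite // -eC groupV.
Qed.

(** As [k] fixes [psi], the map [gact k^-1] preserves [bar l]; it also carries left multiplication
    by [h] to left multiplication by [h ^ k]. *)
Lemma Cset_normal l (C : {group gT}) : Flinear iota nalg l -> C :=: Cset l ->
  C <| 'I_H[psil l].
Proof.
move=> hl eC; rewrite /normal Cset_sub_inertia //=.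
apply/subsetP=> k /(mem_inertia_psil hl)[Hk psik].
rewrite inE; apply/subsetP=> _ /imsetP[h Ch ->].
have [Uk Gk] := (subsetP H_sub_U _ Hk, subsetP H_sub_G _ Hk).
have Hh := subsetP (C_sub_H eC) _ Ch; have Gh := subsetP H_sub_G _ Hh.
have Hhk : (h ^ k)%g \in H by rewrite groupJ.
have [lD lZ] := hl.
have linv t : t \in nalg -> l (gact k^-1%g t) = l t.
  by have /forall_inP inv := introT (psil_stabP hl Uk) psik; move/inv/eqP.
have binv y : y \in nbar L P -> bar l (gact k^-1%g y) = bar l y.
  move=> ny; rewrite !barE ?nbar_gact ?groupV //.
  by rewrite dag_gact ?groupV ?nbar_pattern // -gactN -gactD linv ?sub_dag_nalg.
rewrite eC; apply/(Cset_left_invariant hl Hhk) => y ny.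
set z := gact k y; have nz : z \in nbar L P by apply: nbar_gact.
have yz : y = gact k^-1%g z by rewrite -gactM ?groupV // mulVg gact1.
rewrite yz binv //.
have -> : mx (h ^ k)%g *m gact k^-1%g z = gact k^-1%g (mx h *m z).
  have kkV : mx k *m mx k^-1%g = 1%:M by rewrite -mxM mulgV mx1.
  by rewrite conjgE !mxM /gact -!mulmxA [mx k *m (mx k^-1%g *m _)]mulmxA kkV mul1mx.
rewrite eC in Ch.
by rewrite binv ?nbar_mull // (Cset_left_invariant hl Hh Ch).
Qed.

(** Since [u] is the direct sum of an upper left part and [nalg], functionals on the summands
    combine freely once [m] is extended from [calg l] to [aalg]. This makes every character of the
    little groups list some [chi l']. *)
Lemma extend_functional l (m : {ffun 'M[L]_n -> F}) :
  l \in Fdual iota nalg -> m \in Fdual iota (calg l) ->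
  exists l', [/\ l' \in udual, {in nalg, l' =1 l} & restrict (calg l') (nu l') = m].
Proof.
move=> nl cm; have hl := Fdual_linear nl.
have [m' am' mm'] := Fdual_extend htheta aalg_Fsubspace (calg_Fsubspace hl)
  (introT subsetP (fun x => @calg_aalg l x)) cm.
have [mD mZ] := Fdual_linear am'; have [lD lZ] := hl.
pose l' := restrict u_ (fun x => m' (ulsubmx x) + l (upart x)).
have upartD x y : upart (x + y) = upart x + upart y.
  rewrite /upart add_block_mx !addr0; congr block_mx.
  by apply/matrixP=> i j; rewrite !mxE.
have upartZ d x : upart (d *: x) = d *: upart x.
  rewrite /upart scale_block_mx !scaler0; congr block_mx.
  by apply/matrixP=> i j; rewrite !mxE.
have ulD (x y : matrix2n) : ulsubmx (x + y) = ulsubmx x + ulsubmx y.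
  by apply/matrixP=> i j; rewrite !mxE.
have ulZ d (x : matrix2n) : ulsubmx (d *: x) = d *: ulsubmx x.
  by apply/matrixP=> i j; rewrite !mxE.
have ul' : l' \in udual.
  apply: restrict_Fdual; first exact: anti_fixed_Fsubspace.
  split=> [x y /ucombP[ax nx _] /ucombP[ay ny _]|d x /ucombP[ax nx _]].
    by rewrite ulD upartD mD // lD // addrACA.
  by rewrite ulZ upartZ mZ // lZ // mulrDr.
have a0 := Fsubspace0 aalg_Fsubspace; have n0 := Fsubspace0 nalg_Fsubspace.
have l'l : {in nalg, l' =1 l}.
  move=> t nt; rewrite restrictE ?nalg_anti_fixed //.
  have et : ucomb 0 t = t by rewrite /ucomb block_mx0 dag0 subrr add0r.
  rewrite -{1 2}et ucomb_ul // ucomb_ur // (Flinear0 aalg_Fsubspace (Fdual_linear am')).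
  by rewrite add0r.
exists l'; split=> //; rewrite (calg_eq l'l).
apply: (Fdual_eq _ cm) => [|x cx].
  apply: restrict_Fdual; first exact: calg_Fsubspace.
  have [nD nZ] := nu_linear ul'.
  split=> [x y cx cy|d x cx]; first by rewrite nD ?(calg_aalg cx) ?(calg_aalg cy).
  by rewrite nZ ?(calg_aalg cx).
rewrite restrictE // -mm' // /nu.
have ax := calg_aalg cx.
have -> : UL x - dag (UL x) = ucomb x 0 by rewrite /ucomb addr0.
rewrite restrictE ?ucomb_in // ucomb_ul // ucomb_ur //.
by rewrite (Flinear0 nalg_Fsubspace hl) addr0.
Qed.

Lemma psil_lin_char l : Flinear iota nalg l -> psil l \is a linear_char.
Proof.
move=> hl; have [|||xi Nxi xiE] := @monomial_character _ N unit [set: unit]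
    (fun _ t => t) (fun v _ => psil l v).
- by move=> t _; rewrite psil1.
- by move=> *; rewrite inE.
- by move=> v w t Nv Nw _; rewrite (psilM hl Nv Nw) mulrC.
have -> : psil l = xi.
  apply/cfun_inP=> v Nv; rewrite xiE // (bigD1 tt) ?inE //= big1 ?addr0 // => -[].
  by rewrite andbF.
rewrite qualifE /= Nxi xiE // (bigD1 tt) ?inE //= big1 ?addr0 ?psil1 //.
by case; rewrite andbF.
Qed.

Lemma psil_conj l v : l \in udual -> v \in U -> (psil l ^ v)%CF = psil (dact v^-1%g l).
Proof.
move=> ul Uv; have Gv := subsetP U_sub_G _ Uv; have ul' := dact_in (groupVr Gv) ul.
apply/cfun_inP=> m Nm; have nv := subsetP U_norm_N _ Uv.
rewrite cfConjgE // (psilE (udual_nalg ul')) //.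
rewrite (psilE (udual_nalg ul)) ?memJ_norm ?groupV //.
have Um := subsetP N_sub_U _ Nm.
by rewrite f_conj_gact ?groupV // dactE ?f_anti_fixed.
Qed.

(** * The set of little groups supercharacters *)

Section LittleGroups.

Variable Cof : {ffun matrix2n -> F} -> {group gT}.
Hypothesis CofE : forall l, Flinear iota nalg l -> Cof l :=: Cset l.
Variable S : {set Iirr N}.
Hypothesis hS : orbit_representatives U S.

Definition Cof_superchars (C : {group gT}) : seq 'CF(C) :=
  let A := [set ulphi v | v in H] in
  let B := [set ulphi v | v in C] in
  [seq class_fun C (fun v => right_ideal_superchar theta A B m (ulphi v))
     | m in Fdual iota (alg_of B)].

Definition Cof_little_chars : seq 'CF(U) :=
  flatten [seq little_group_chars U H (psil l) (Cof_superchars (Cof l))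
     | l in [set l in Fdual iota nalg | psil l \in [seq 'chi_j | j in S]]].

Lemma chi_little_groups : [seq chi l | l in udual] =i Cof_little_chars.
Proof.
have inI l k m : Flinear iota nalg l -> k \in 'I_H[psil l] -> m \in N ->
    psil l (m ^ k)%g = psil l m.
  by move=> hl /(mem_inertia_psil hl)[_ inv] /inv.
have sIH l : 'I_H[psil l] \subset H by apply: subsetIl.
move=> xi; apply/imageP/flattenP=> [[l ul ->]|[s /imageP[l]]].
  have hl := udual_nalg ul; have /irrP[i ei] := lin_char_irr (psil_lin_char hl).
  (* [S] meets the [U]-orbit of [psil l]. Replacing [l] by a conjugate [l1] lying over that
     representative does not change [chi l]. *)
  have : (0 < #|[set j in S | 'chi_j \in ('chi_i ^: U)%CF]|)%N by rewrite hS.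
  case/card_gt0P=> j; rewrite inE => /andP[Sj /cfclassP[v Uv ej]].
  rewrite -ei psil_conj // in ej; have Gv := subsetP U_sub_G _ Uv.
  set l1 := dact v^-1%g l in ej.
  have ul1 : l1 \in udual by rewrite dact_in ?groupV.
  have hl1 := udual_nalg ul1.
  have -> : chi l = chi l1 by rewrite (chi_orbit ul) //; apply: imset_f; rewrite groupV.
  pose l2 := restrict nalg l1.
  have nl2 : l2 \in Fdual iota nalg by apply: restrict_Fdual; first exact: nalg_Fsubspace.
  have hl2 := Fdual_linear nl2.
  have e12 : {in nalg, l1 =1 l2} by move=> t nt; rewrite /l2 [RHS]restrictE.
  have ep := psil_eq hl1 hl2 e12; have ec := calg_eq e12.
  have eC : Cof l2 :=: Cset l1 by rewrite CofE // /Cset ec.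
  exists (little_group_chars U H (psil l2) (Cof_superchars (Cof l2))).
    apply/imageP; exists l2 => //; rewrite inE nl2 -ep -ej.
    by apply: image_f.
  have := sdprod_ind_superchar ul1 eC (Cset_sub_inertia hl1 eC) (sIH l1)
    (fun k m Ik Nm => inI l1 k m hl1 Ik Nm).
  rewrite ep => <-; apply: map_f; apply: map_f.
  apply/imageP; exists (restrict (calg l1) (nu l1)) => //.
  by rewrite (alg_of_C eC); apply: restrict_nu_dual.
rewrite inE => /andP[nl _] ->; have hl := Fdual_linear nl.
have eC := CofE hl; case/mapP=> _ /mapP[X /imageP[m cm ->] ->] ->.
rewrite (alg_of_C eC) in cm; have [l' [ul' l'l <-]] := extend_functional nl cm.
have hl' := udual_nalg ul'; exists l' => //.
have eC' : Cof l :=: Cset l' by rewrite eC /Cset (calg_eq l'l).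
have ep := psil_eq hl' hl l'l.
have := sdprod_ind_superchar ul' eC' (Cset_sub_inertia hl' eC') (sIH l')
  (fun k m Ik Nm => inI l' k m hl' Ik Nm).
by rewrite ep.
Qed.

End LittleGroups.

End Functional.

End Blocks.

(** * Transfer to the concrete matrix groups *)

Lemma supercharacter_theory_eq_mem (gT : finGroupType) (U : {group gT})
    (K : {set {set gT}}) (X Y : seq 'CF(U)) :
  X =i Y -> supercharacter_theory (K, X) -> supercharacter_theory (K, Y).
Proof.
move=> eXY [defK [XN X0] szX constX cardX].
have eu : perm_eq (undup X) (undup Y).
  by apply: uniq_perm; rewrite ?undup_uniq // => xi; rewrite !mem_undup eXY.
split=> //.
- by split=> [xi|]; rewrite -eXY //; apply: XN.
- by rewrite -(perm_size eu).
- by move=> B xi KB; rewrite -eXY; apply: constX.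
by move=> i; rewrite -(cardX i); apply/esym/perm_size/perm_filter.
Qed.

Theorem theorem6p2 (p e q k n : nat) (F L : finFieldType)
    (iota : {rmorphism F -> L})
    (P : rel 'I_(n.+1 + n.+1))
    (dag : 'M[L]_(n.+1 + n.+1) -> 'M[L]_(n.+1 + n.+1))
    (theta : F -> algC)
    (f : {'GL_(n.+1 + n.+1)[L]} -> 'M[L]_(n.+1 + n.+1))
    (p_prime : prime p) (p_odd : odd p) (e_gt0 : (0 < e)%N)
    (q_def : q = (p ^ e)%N) (k_gt0 : (0 < k)%N)
    (cardF : #|F| = q) (cardL : #|L| = (q ^ k)%N)
    (hP : pattern_order P)
    (hdag : anti_involution iota (pattern_algebra L P) dag)
    (hunits : reverses_matrix_units (pattern_algebra L P) dag)
    (htheta : nontrivial_additive_char theta)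
    (hf : springer_morphism iota P dag f)
    (S : {set Iirr (N_group hdag)})
    (hS : orbit_representatives (U_group hP hdag) S) :
  let orbitT := orbit_theory hP hdag theta f in
  supercharacter_theory orbitT /\
  exists2 T, little_groups_theory (hP := hP) (hdag := hdag) hunits theta f S T
           & same_supercharacter_theory T orbitT.
Proof.
pose gT : finGroupType := {'GL_(n.+1 + n.+1)[L]}.
pose mx : gT -> 'M[L]_(n.+1 + n.+1) := @mx_of L n.
have mxM (v w : gT) : mx (v * w)%g = mx v *m mx w by exact: mx_ofM.
have mx1 : mx 1%g = 1%:M by exact: mx_of1.
have mx_inj : injective mx by exact: mx_of_inj.
have mx_onto m : m \in unitmx -> exists v, mx v = m.
  move=> um; have um' : m \is a @GRing.unit 'M[L]_((n.+1 + n.+1).-1.+1) by exact: um.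
  by exists (FinRing.Unit um').
pose G : {group gT} := pattern_group L hP.
pose U : {group gT} := U_group hP hdag.
pose H : {group gT} := H_group hP hdag hunits.
pose N : {group gT} := N_group hdag.
have in_G (v : gT) : (v \in G) = (mx v - 1%:M \in pattern_algebra L P).
  exact: in_pattern.
have in_U (v : gT) : (v \in U) = (v \in G) && (gdag dag mx v == invmx (mx v)).
  by rewrite in_G; exact: (@in_U L n P dag v).
have in_N (v : gT) : (v \in N) = (mx v - 1%:M \in nalg P dag).
  rewrite [LHS]in_set; apply/existsP/setIP=> [[x /andP[ux /eqP ev]]|[ux nx]].
    have -> : mx v - 1%:M = block_mx 0 x 0 0.
      by rewrite /mx ev scalar_mx_block opp_block_mx add_block_mx !subrr !subr0.
    split=> //; apply/nbarP; split; last by exists x.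
    exact: anti_fixed_pattern ux.
  have [_ [b eb]] := nbarP _ _ nx; exists b; rewrite -eb ux /=.
  apply/eqP; rewrite -[mx_of v](subrK 1%:M) -/(mx v) eb scalar_mx_block add_block_mx.
  by rewrite !addr0 !add0r.
have in_HP (v : gT) : reflect
    (exists2 h : 'M_n.+1, block_mx h 0 0 1%:M - 1%:M \in pattern_algebra L P
       & mx v = block_mx h 0 0 (invmx (tilde dag h))) (v \in H).
  exact: in_H.
(* The oddness of [p] enters here, through the 1/2 in [bar]. *)
have two_neq0 : 2%:R != 0 :> F.
  have pF : p \in [pchar F] by apply: (card_finPcharP (n := e)); rewrite ?cardF.
  apply/eqP=> two0; have := pcharf0 pF.
  rewrite -[p]odd_double_half p_odd -mul2n natrD natrM two0 mul0r addr0 => /eqP.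
  by rewrite oner_eq0.
have [[coef fE0] f_U0] := hf.
have fE : {in G, forall v : gT, f v = (mx v - 1%:M)
   + \sum_(2 <= i < n.+1 + n.+1) iota (coef i) *: (mx v - 1%:M) ^+ i} by exact: fE0.
have f_U : [set f v | v in U] = anti_fixed P dag by exact: f_U0.
have orbT := orbit_supercharacter_theory hP hdag hunits mxM mx1 mx_inj mx_onto in_G
  in_U in_N in_HP fE f_U htheta two_neq0.
have eT : orbit_theory hP hdag theta f
    = ([set kclass dag mx G U f v | v in U],
       [seq chi dag hP G mxM mx1 U f theta l
         | l in Fdual iota (anti_fixed P dag)]).
  by [].
have enalg : n_alg P dag f = nalg P dag.
  apply/setP=> t; apply/imsetP/idP=> [[v Nv ->]|nt].
    exact: (nalg_f mxM mx1 in_G in_U in_N fE Nv).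
  have [v Nv <-] := fN_onto mxM mx1 mx_onto in_G in_U in_N fE nt.
  by exists v.
have eC (l : {ffun 'M[L]_(n.+1 + n.+1) -> F}) : Flinear iota (nalg P dag) l ->
    Hpsi_group hP hdag hunits l = Cset P dag mx H l :> {set gT}.
  move=> hl; apply/setP=> h; have [Hh|nHh] := boolP (h \in H).
    rewrite (Cset_stabilizer hP hdag hunits mxM mx1 mx_inj mx_onto in_G in_U in_HP hl Hh).
    by rewrite [LHS]in_set; move: (Hh); rewrite /H /= => ->.
  by rewrite [LHS]in_set [RHS]in_set; move: (nHh); rewrite /H /= => /negPf->.
have echi : (orbit_theory hP hdag theta f).2
    =i little_groups_superchars hP hunits theta f S.
  rewrite eT /little_groups_superchars enalg.
  exact: (chi_little_groups hP hdag hunits mxM mx1 mx_inj mx_onto in_G in_U in_N in_HP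
    fE f_U htheta two_neq0 eC hS).
split; first by rewrite eT.
(* The superclasses are those of the orbit theory; by [echi] the little groups characters form a
   supercharacter theory with them. *)
exists ((orbit_theory hP hdag theta f).1, little_groups_superchars hP hunits theta f S).
  split=> //.
    move=> l; rewrite enalg => /Fdual_linear hl; have eCl := eC l hl; split.
      split; first by apply/subsetP=> h; rewrite [h \in _]in_set => /andP[].
      exact: (Cset_right_ideal hP hdag hunits mxM mx1 mx_inj mx_onto in_G in_U in_HP
        hl eCl).
    exact: (Cset_normal hP hdag hunits mxM mx1 mx_inj mx_onto in_G in_U in_N in_HP fE
      htheta two_neq0 hl eCl).
  by apply: (supercharacter_theory_eq_mem echi); rewrite -surjective_pairing eT.
by [].
Qed.
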